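(* Consider the hardware-impaired uplink model described in the context. Suppose that BS $j$ has statistical channel knowledge and applies the receive filters $\mathbf{v}_{jk}(t)\in\mathbb{C}^N$, $t=B+1,\ldots,T$ (i.e., it forms $\mathbf{v}_{jk}^{H}(t)\mathbf{y}_j(t)$) to receive the signals from its $k$th UE, and that all UEs transmit with full power, i.e. $\mathbb{E}\{|x_{lm}(t)|^2\}=p_{lm}$ for all $l,m$. Then an ergodic achievable rate of UE $k$ in cell $j$ is $$R_{jk}=\frac{1}{T}\sum_{t=B+1}^{T}\log_2\left(1+\mathrm{SINR}_{jk}(t)\right)\quad[\text{bit/channel use}],$$ where $$\mathrm{SINR}_{jk}(t)=\frac{p_{jk}\,|\mathbb{E}\{\mathbf{v}_{jk}^{H}(t)\mathbf{h}_{jjk}(t)\}|^2}{\sum_{l=1}^{L}\sum_{m=1}^{K}p_{lm}\mathbb{E}\{|\mathbf{v}_{jk}^{H}(t)\mathbf{h}_{jlm}(t)|^2\}-p_{jk}|\mathbb{E}\{\mathbf{v}_{jk}^{H}(t)\mathbf{h}_{jjk}(t)\}|^2+\mathbb{E}\{|\mathbf{v}_{jk}^{H}(t)\boldsymbol{\upsilon}_j(t)|^2\}+\sigma^2\xi\,\mathbb{E}\{\|\mathbf{v}_{jk}(t)\|^2\}}.$$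
   Context: Model. There are $L\ge1$ cells, each with one base station (BS) having $N$ antennas and $K$ single-antenna users (UEs). A coherence block has $T$ channel uses $t\in\{1,\ldots,T\}$, the first $B\ge K$ of which are used for pilots and the remaining ones for data; realizations are independent between blocks. The channel from UE $k$ in cell $l$ to BS $j$ is $\mathbf{h}_{jlk}=[h_{jlk}^{(1)}\ldots h_{jlk}^{(N)}]^T\sim\mathcal{CN}(\mathbf{0},\lambda_{jlk}\mathbf{I}_N)$ with $\lambda_{jlk}>0$ (circularly symmetric complex Gaussian), constant over the block; different channels are independent. Write $\mathbf{H}_{jl}=[\mathbf{h}_{jl1}\ldots\mathbf{h}_{jlK}]$. The signal received by BS $j$ at channel use $t$ is $$\mathbf{y}_j(t)=\mathbf{D}_{\boldsymbol{\phi}_j(t)}\sum_{l=1}^{L}\mathbf{H}_{jl}\mathbf{x}_l(t)+\boldsymbol{\upsilon}_j(t)+\boldsymbol{\eta}_j(t),$$ where $\mathbf{x}_l(t)=[x_{l1}(t)\ldots x_{lK}(t)]^T$ are the transmit signals, with $\mathbb{E}\{|x_{lk}(t)|^2\}\le p_{lk}$; $x_{lk}(t)$ is a deterministic pilot symbol for $t\le B$ and an information symbol from a Gaussian codebook for $t>B$. The effective channel is $\mathbf{h}_{jlk}(t)=\mathbf{D}_{\boldsymbol{\phi}_j(t)}\mathbf{h}_{jlk}$. (1) Phase drift: $\mathbf{D}_{\boldsymbol{\phi}_j(t)}=\mathrm{diag}(e^{\imath\phi_{j1}(t)},\ldots,e^{\imath\phi_{jN}(t)})$, where $\imath$ is the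 imaginary unit and each $\phi_{jn}$ is a discrete-time Wiener process: $\phi_{jn}(t)$ equals $\phi_{jn}(t-1)$ plus an independent $\mathcal{N}(0,\delta)$ innovation, $\delta\ge0$; the processes are independent across antennas. (2) Distortion noise: conditionally on the channels, $\boldsymbol{\upsilon}_j(t)\sim\mathcal{CN}(\mathbf{0},\boldsymbol{\Upsilon}_j(t))$ with $\boldsymbol{\Upsilon}_j(t)=\kappa^2\sum_{l=1}^{L}\sum_{k=1}^{K}\mathbb{E}\{|x_{lk}(t)|^2\}\,\mathrm{diag}(|h_{jlk}^{(1)}|^2,\ldots,|h_{jlk}^{(N)}|^2)$, $\kappa\ge0$, independent between antennas and channel uses. (3) Receiver noise: $\boldsymbol{\eta}_j(t)\sim\mathcal{CN}(\mathbf{0},\sigma^2\xi\mathbf{I}_N)$ with $\sigma^2>0$, $\xi\ge1$, independent over time. Channels, phase-drift processes, data symbols and receiver noise are mutually independent, and given the channels the distortion noise is independent of the phase drifts, data symbols and receiver noise. The receive filters are computed from what is available at BS $j$ (channel statistics and the received pilot signals $\mathbf{y}_j(1),\ldots,\mathbf{y}_j(B)$). ''Ergodic achievable rate'' means a rate (in bit per channel use, coding over arbitrarily many coherence blocks) at which UE $k$ in cell $j$ can communicate to BS $j$ with vanishing error probability. $(\cdot)^H$ denotes conjugate transpose. *)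

(* Defs.v *)
(* MathComp / MathComp-Analysis *)
From HB Require Import structures.
From mathcomp Require Import all_boot all_order all_algebra.
From mathcomp Require Import complex.
From mathcomp Require Import all_classical all_reals all_analysis.

Set Implicit Arguments.
Unset Strict Implicit.
Unset Printing Implicit Defensive.

Import Order.TTheory GRing.Theory Num.Theory.

Local Open Scope classical_set_scope.
Local Open Scope ring_scope.
Local Open Scope complex_scope.

Section complex_random_variables.
Context {R : realType}.

(* Measurability of complex data is expressed through this identification of
   R[i] with R^2 and its Borel sigma-algebra. *)
Definition reim (z : R[i]) : measurableTypeR R * measurableTypeR R :=
  (complex.Re z, complex.Im z).

Definition abs2 (z : R[i]) : R := complex.Re z ^+ 2 + complex.Im z ^+ 2.

Definition norm2 n (v : 'cV[R[i]]_n) : R := \sum_(a < n) abs2 (v a 0).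

Definition expi (x : R) : R[i] := cos x +i* sin x.

(* v^H y *)
Definition hdot n (v y : 'cV[R[i]]_n) : R[i] :=
  ((map_mx conjc v)^T *m y) 0 0.

Definition log2 (x : R) : R := ln x / ln 2.

(* N(0, v), v being the variance: the library's [normal_prob] takes the standard
   deviation and is not a Dirac mass when the latter is 0. *)
Definition gauss (v : R) : probability (measurableTypeR R) R :=
  if v == 0 then [the probability _ _ of dirac (0 : measurableTypeR R)]
  else [the probability _ _ of normal_prob 0 (Num.sqrt v)].

(* CN(0, v) as a measure on R^2: independent N(0, v/2) real and imaginary
   parts. *)
Definition cgauss (v : R) : set (measurableTypeR R * measurableTypeR R) -> \bar R :=
  (gauss (v / 2) \x gauss (v / 2))%E.

(* Borel sigma-algebra of the space of m x n complex matrices, generated by the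
   entries. *)
Definition mx_events m n : set (set 'M[R[i]]_(m, n)) :=
  <<s [set U | exists a b (A : set (measurableTypeR R * measurableTypeR R)),
         measurable A /\ U = [set Z : 'M[R[i]]_(m, n) | A (reim (Z a b))]] >>.

Section on_a_probability_space.
Context {d : measure_display} {Omega : measurableType d}.
Variable P : probability Omega R.

Definition cmeasurable (Z : Omega -> R[i]) : Prop :=
  measurable_fun [set: Omega] (reim \o Z).

Definition has_claw (Z : Omega -> R[i]) (v : R) : Prop :=
  forall A, measurable A -> P ((reim \o Z) @^-1` A) = cgauss v A.

Definition has_law (X : Omega -> R) (v : R) : Prop :=
  forall A : set (measurableTypeR R), measurable A ->
    P (X @^-1` A) = gauss v A.

Definition cexp (Z : Omega -> R[i]) : R[i] :=
  fine ('E_P[fun w => complex.Re (Z w)])%E +i* fine ('E_P[fun w => complex.Im (Z w)])%E.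

Definition exp_abs2 (Z : Omega -> R[i]) : \bar R :=
  ('E_P[fun w => abs2 (Z w)])%E.

Definition revents (X : Omega -> R) : set (set Omega) :=
  [set U | exists2 A : set (measurableTypeR R), measurable A & U = X @^-1` A].

Definition cevents (Z : Omega -> R[i]) : set (set Omega) :=
  [set U | exists2 A, measurable A & U = (reim \o Z) @^-1` A].

(* Mutual independence of the classes of events [F i], [i] ranging over [D]. *)
Definition mutually_independent (I : Type) (D : set I)
    (F : I -> set (set Omega)) : Prop :=
  forall (q : nat) (s : 'I_q -> I) (A : 'I_q -> set Omega),
    injective s -> (forall a, D (s a) /\ F (s a) (A a)) ->
    P (\bigcap_(a in [set: 'I_q]) A a) = (\prod_(a < q) P (A a))%E.

End on_a_probability_space.
End complex_random_variables.

(* Throughout, [L] cells, [K] UEs per cell, [N] antennas per BS, pilot length [B]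
   and block length [T].  Coherence blocks are indexed by b = 0, 1, 2, ... and
   channel uses inside a block by t = 1, ..., T. *)
Record uplink_params (R : realType) (L K : nat) := UplinkParams {
  chvar : 'I_L -> 'I_L -> 'I_K -> R;      (* chvar j l k = lambda_{jlk} *)
  pmax : 'I_L -> 'I_K -> R;               (* p_{lk} *)
  pilot : 'I_L -> 'I_K -> nat -> R[i];    (* x_{lk}(t) for t <= B *)
  delta : R;
  kappa : R;
  sigma2 : R;
  xi : R }.

Record uplink_rvs (R : realType) (L K N : nat) (Omega : Type) := UplinkRvs {
  channel : nat -> 'I_L -> 'I_L -> 'I_K -> Omega -> 'cV[R[i]]_N; (* b j l k *)
  phase : nat -> 'I_L -> 'I_N -> nat -> Omega -> R;              (* b j n t *)
  symbol : nat -> 'I_L -> 'I_K -> nat -> Omega -> R[i];          (* b l k t *)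
  distortion : nat -> 'I_L -> nat -> Omega -> 'cV[R[i]]_N;       (* b j t *)
  noise : nat -> 'I_L -> nat -> Omega -> 'cV[R[i]]_N }.          (* b j t *)

(* Names of the elementary random variables seen by a given BS, the distortion
   noise excepted.  A phase-drift process is split into its value at t = 1, whose
   law is unconstrained, and its innovations. *)
Inductive source (L K N : nat) :=
  | Channel of nat & 'I_L & 'I_L & 'I_K & 'I_N
  | FirstPhase of nat & 'I_N
  | Innovation of nat & 'I_N & nat
  | Data of nat & 'I_L & 'I_K & nat
  | Noise of nat & 'I_N & nat.

Section uplink.
Context {R : realType} {L K N B T : nat}.
Context {d : measure_display} {Omega : measurableType d}.
Variables (P : probability Omega R).
Variables (pr : uplink_params R L K) (X : uplink_rvs R L K N Omega).

Definition innovation b j n t (w : Omega) : R :=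
  phase X b j n t.+1 w - phase X b j n t w.

(* Diagonal entry of antenna [n] in Upsilon_j(t). *)
Definition distortion_var b j n t (w : Omega) : R :=
  kappa pr ^+ 2 * \sum_(l < L) \sum_(m < K)
    fine (exp_abs2 P (symbol X b l m t)) * abs2 (channel X b j l m w n 0).

Definition phase_mx b j t (w : Omega) : 'M[R[i]]_N :=
  diag_mx (\row_n expi (phase X b j n t w)).

Definition eff_channel b j l m t (w : Omega) : 'cV[R[i]]_N :=
  phase_mx b j t w *m channel X b j l m w.

Definition channel_mx b j l (w : Omega) : 'M[R[i]]_(N, K) :=
  \matrix_(n, m) channel X b j l m w n 0.

(* y_j(t) in block [b] when the cells transmit the vectors [x l] *)
Definition received_from (x : 'I_L -> 'cV[R[i]]_K) b j t (w : Omega)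
    : 'cV[R[i]]_N :=
  phase_mx b j t w *m (\sum_(l < L) channel_mx b j l w *m x l)
  + distortion X b j t w + noise X b j t w.

Definition symbols b t (w : Omega) (l : 'I_L) : 'cV[R[i]]_K :=
  \col_m symbol X b l m t w.

Definition received b j t (w : Omega) : 'cV[R[i]]_N :=
  received_from (symbols b t w) b j t w.

(* [y_j(1) ... y_j(B)] *)
Definition pilot_obs b j (w : Omega) : 'M[R[i]]_(N, B) :=
  \matrix_(n, s) received b j s.+1 w n 0.

Definition source_events (j : 'I_L) (s : source L K N) : set (set Omega) :=
  match s with
  | Channel b i l m n => cevents (fun w => channel X b i l m w n 0)
  | FirstPhase b n => revents (phase X b j n 1)
  | Innovation b n t => revents (innovation b j n t)
  | Data b l m t => cevents (symbol X b l m t)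
  | Noise b n t => cevents (fun w => noise X b j t w n 0)
  end.

Definition is_channel : set (source L K N) :=
  [set s | if s is Channel _ _ _ _ _ then True else False].

Definition in_range : set (source L K N) :=
  [set s | match s with
           | Channel _ _ _ _ _ | FirstPhase _ _ => True
           | Innovation _ _ t => (1 <= t < T)%N
           | Data _ _ _ t => (B < t <= T)%N
           | Noise _ _ t => (1 <= t <= T)%N
           end].

Definition generated (j : 'I_L) (D : set (source L K N)) : set (set Omega) :=
  <<s \bigcup_(s in D) source_events j s >>.

Record uplink_params_ok : Prop := {
  chvar_gt0 : forall j l m, 0 < chvar pr j l m;
  delta_ge0 : 0 <= delta pr;
  kappa_ge0 : 0 <= kappa pr;
  sigma2_gt0 : 0 < sigma2 pr;
  xi_ge1 : 1 <= xi pr;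
  pilot_len_ge : (K <= B)%N;
  pilot_len_le : (B <= T)%N }.

Record uplink_model : Prop := {
  channel_meas : forall b j l m n,
    cmeasurable (fun w => channel X b j l m w n 0);
  phase_meas : forall b j n t, (1 <= t <= T)%N ->
    measurable_fun [set: Omega] (phase X b j n t);
  symbol_meas : forall b l m t, (1 <= t <= T)%N ->
    cmeasurable (symbol X b l m t);
  distortion_meas : forall b j n t, (1 <= t <= T)%N ->
    cmeasurable (fun w => distortion X b j t w n 0);
  noise_meas : forall b j n t, (1 <= t <= T)%N ->
    cmeasurable (fun w => noise X b j t w n 0);

  power_le : forall b l m t, (1 <= t <= T)%N ->
    (exp_abs2 P (symbol X b l m t) <= (pmax pr l m)%:E)%E;
  symbol_pilot : forall b l m t w, (1 <= t <= B)%N ->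
    symbol X b l m t w = pilot pr l m t;

  channel_law : forall b j l m n,
    has_claw P (fun w => channel X b j l m w n 0) (chvar pr j l m);
  first_phase_law : forall b j n (A : set (measurableTypeR R)), measurable A ->
    P (phase X b j n 1 @^-1` A) = P (phase X 0 j n 1 @^-1` A);
  innovation_law : forall b j n t, (1 <= t < T)%N ->
    has_law P (innovation b j n t) (delta pr);
  data_law : forall b l m t, (B < t <= T)%N ->
    has_claw P (symbol X b l m t) (fine (exp_abs2 P (symbol X b l m t)));
  noise_law : forall b j n t, (1 <= t <= T)%N ->
    has_claw P (fun w => noise X b j t w n 0) (sigma2 pr * xi pr);
  sources_indep : forall j,
    mutually_independent P in_range (source_events j);

  (* Given all channels, the components of the distortion noise at BS j are
     independent CN(0, distortion_var) variables, jointly independent of the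
     phase drifts, data symbols and receiver noise (event F, whose conditional
     probability given the channels is P F): the conditional law is spelled out
     by its integrals over the events E generated by the channels. *)
  distortion_law : forall (j : 'I_L) (q : nat) (s : 'I_q -> nat * 'I_N * nat)
      (A : 'I_q -> set (measurableTypeR R * measurableTypeR R))
      (E F : set Omega),
    injective s ->
    (forall a, (1 <= (s a).2 <= T)%N /\ measurable (A a)) ->
    generated j is_channel E ->
    generated j (in_range `\` is_channel) F ->
    P (E `&` F `&` \bigcap_(a in [set: 'I_q])
         [set w | A a (reim (distortion X (s a).1.1 j (s a).2 w (s a).1.2 0))])
    = (P F * \int[P]_(w in E) \prod_(a < q)
         cgauss (distortion_var (s a).1.1 j (s a).1.2 (s a).2 w) (A a))%E }.

Definition full_power : Prop := forall b l m t, (1 <= t <= T)%N ->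
  exp_abs2 P (symbol X b l m t) = (pmax pr l m)%:E.

(* A receive filter for channel use t computed from the pilot observations. *)
Definition filter_meas (v : nat -> 'M[R[i]]_(N, B) -> 'cV[R[i]]_N) : Prop :=
  forall t n (A : set (measurableTypeR R * measurableTypeR R)),
    (B < t <= T)%N -> measurable A -> mx_events [set Y | A (reim (v t Y n 0))].

Section receiver.
Variables (v : nat -> 'M[R[i]]_(N, B) -> 'cV[R[i]]_N) (j : 'I_L) (k : 'I_K).

Definition filter_rv b t (w : Omega) : 'cV[R[i]]_N := v t (pilot_obs b j w).

(* All blocks being identically distributed, the expectations are taken in
   block 0. *)
Definition filtered_channel l m t (w : Omega) : R[i] :=
  hdot (filter_rv 0 t w) (eff_channel 0 j l m t w).

Definition filtered_distortion t (w : Omega) : R[i] :=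
  hdot (filter_rv 0 t w) (distortion X 0 j t w).

(* The nonnegative expectations entering the SINR are finite; otherwise [fine]
   would send them to 0.  The first bound also makes E{v^H h} well defined. *)
Definition finite_moments : Prop := forall t, (B < t <= T)%N ->
  [/\ (forall l m, (exp_abs2 P (filtered_channel l m t) < +oo)%E),
      (exp_abs2 P (filtered_distortion t) < +oo)%E &
      ('E_P[fun w => norm2 (filter_rv 0 t w)] < +oo)%E].

Definition SINR (t : nat) : R :=
  pmax pr j k * abs2 (cexp P (filtered_channel j k t)) /
  (\sum_(l < L) \sum_(m < K)
      pmax pr l m * fine (exp_abs2 P (filtered_channel l m t))
   - pmax pr j k * abs2 (cexp P (filtered_channel j k t))
   + fine (exp_abs2 P (filtered_distortion t))
   + sigma2 pr * xi pr * fine ('E_P[fun w => norm2 (filter_rv 0 t w)])%E).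

Definition rate : R :=
  T%:R^-1 * \sum_(B.+1 <= t < T.+1) log2 (1 + SINR t).

(* A code of UE k in cell j over [n] blocks with [M] messages; entry (b, s) of a
   codeword is sent in block b at channel use B + 1 + s, and the decoder sees the
   correspondingly indexed filter outputs. *)
Record block_code n M := BlockCode {
  codeword : 'I_M -> 'M[R[i]]_(n, T - B);
  decoder : 'M[R[i]]_(n, T - B) -> 'I_M;
  decoder_meas : forall i, mx_events (decoder @^-1` [set i]) }.

(* E|x_jk(t)|^2 = p in every data channel use, for a uniform message *)
Definition code_power n M (c : block_code n M) (p : R) : Prop :=
  forall b s, (\sum_(i < M) abs2 (codeword c i b s)) / M%:R = p.

(* The data symbol of UE k in cell j is [z], all other UEs send their own. *)
Definition coded_symbols (z : R[i]) b t (w : Omega) (l : 'I_L) : 'cV[R[i]]_K :=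
  \col_m if (l == j) && (m == k) then z else symbol X b l m t w.

Definition filter_output n M (c : block_code n M) (i : 'I_M) (w : Omega)
    : 'M[R[i]]_(n, T - B) :=
  \matrix_(b < n, s < T - B) let t := (B + s.+1)%N in
    hdot (filter_rv b t w)
         (received_from (coded_symbols (codeword c i b s) b t w) b j t w).

Definition error_prob n M (c : block_code n M) : \bar R :=
  ((M%:R^-1)%:E * \sum_(i < M)
     P [set w | decoder c (filter_output c i w) != i])%E.

(* Codes over n blocks whose rate is within any prescribed margin of [r] reach
   any prescribed error probability once n is large. *)
Definition ergodic_achievable_rate (r : R) : Prop :=
  forall margin eps : R, 0 < margin -> 0 < eps ->
  exists n0, forall n, (n0 <= n)%N ->
  exists M (c : block_code n M),
    [/\ (0 < M)%N,
        r - margin <= log2 M%:R / (n * T)%N%:R,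
        code_power c (pmax pr j k) &
        (error_prob c <= eps%:E)%E].

End receiver.
End uplink.

(* Main.v *)
(* Random coding with a mismatched threshold decoder.  In slot t the filter
   output is v^H y = a x + w, where x is the coded symbol, a = v^H h and w
   collects interference, distortion and noise.  Only the mean g = E a and the
   second moments are used: x is treated as received through the deterministic
   gain g in noise of power N0, the denominator of the SINR.  With
   theta = 1/N0 and s = theta p |g|^2 = SINR, the metric of a slot is

     theta / (1 + v s) |y|^2 - theta |y - g x|^2.

   - Codewords are drawn from a finite symmetric constellation with exact power
     p, obtained by discretising a Gaussian; v > 0 is its mismatch.  For every y,
     averaging exp(metric) over the constellation gives at most e^eps/(1 + v s),
     which controls the false codewords.
   - The transmitted codeword has mean metric at least (1 + s)/(1 + v s) - 1,
     because the symmetry of the constellation kills the cross terms; a weak law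
     over the pairwise independent, identically distributed blocks shows that
     the total metric is close to its mean.  Neither step uses the joint law of
     a and w, so that their dependence within a block is harmless.
   - ln (1 + v s) + (1 + s)/(1 + v s) - 1 >= ln (1 + s), whatever v is.

   The codebook found meets the power constraint in every slot up to a factor
   1 + eta; a fraction eta of extra messages with suitable constant symbols makes
   the average power exactly p, and counts as errors.  The distortion noise is
   handled through its conditional law, which makes distinct blocks independent
   and data symbols and receiver noise independent of everything that
   multiplies them. *)
Require Import Defs.
From HB Require Import structures.
From mathcomp Require Import all_boot all_order all_algebra.
From mathcomp Require Import complex.
From mathcomp Require Import all_classical all_reals all_analysis.
From mathcomp Require Import measurable_realfun ring lra zify.

Set Implicit Arguments.
Unset Strict Implicit.
Unset Printing Implicit Defensive.
Import Order.TTheory GRing.Theory Num.Theory.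
Local Open Scope classical_set_scope.
Local Open Scope ring_scope.
Local Open Scope complex_scope.

(** * Averages over random codebooks *)

(** The channel uses of one block share channels, phase drifts and pilot observations, so a block is
    the unit that the law of large numbers sees, and the metric is summed over its slots. The
    exponential bound holds for every fixed output, hence factors over the independently drawn
    symbols of a block, and the mean is linear; dependence between slots therefore costs nothing
    either. A finite alphabet, fixed before the number of blocks, turns every average over codebooks
    into a finite weighted sum. On the channel side the obstacle is that the filter, the effective
    channels and the distortion are mutually dependent: the pilot observations contain channels and
    phases, and the distortion variance contains the channels. These three are never separated. A
    data symbol or a noise sample is instead removed by setting its coordinate to 0: the result is
    independent of that coordinate, and what multiplies the coordinate does not change. Removing
    them one after the other produces exactly the denominator of the SINR. Independence between
    blocks is needed for pairs only, so the distortion law is integrated for two blocks at a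
    time. *)

Section iid.
Context {R : realFieldType}.

(** Nested three times below: symbols of a block, blocks of a codeword, codewords of a codebook. *)
Definition iid_weight (I W : finType) (q : W -> R) (c : {ffun I -> W}) : R :=
  \prod_i q (c i).

Variables (I W : finType) (q : W -> R).
Hypothesis (q0 : forall x, 0 <= q x) (q1 : \sum_x q x = 1).

Lemma iid_weight_ge0 (c : {ffun I -> W}) : 0 <= iid_weight q c.
Proof. by apply: prodr_ge0 => i _. Qed.

Lemma iid_sum_prod (f : I -> W -> R) :
  \sum_(c : {ffun I -> W}) iid_weight q c * (\prod_i f i (c i)) =
  \prod_i \sum_x q x * f i x.
Proof.
rewrite (bigA_distr_bigA (fun i x => q x * f i x)); apply: eq_bigr => c _.
by rewrite -big_split.
Qed.

Lemma iid_sum : \sum_(c : {ffun I -> W}) iid_weight q c = 1.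
Proof.
transitivity (\prod_(i : I) \sum_x q x * 1).
  by rewrite -iid_sum_prod; apply: eq_bigr => c _; rewrite big1 ?mulr1.
by rewrite big1// => i _; under eq_bigr do rewrite mulr1.
Qed.

Lemma iid_sum1 (i : I) (f : W -> R) :
  \sum_(c : {ffun I -> W}) iid_weight q c * f (c i) = \sum_x q x * f x.
Proof.
transitivity (\prod_(i' : I) \sum_x q x * (if i' == i then f x else 1)).
  rewrite -iid_sum_prod; apply: eq_bigr => c _.
  by rewrite -big_mkcond big_pred1_eq.
rewrite (bigD1 i)//= eqxx [X in _ * X]big1 ?mulr1// => i' /negbTE ->.
by under eq_bigr do rewrite mulr1.
Qed.

Lemma iid_sum2 (i i' : I) (f : W -> W -> R) : i != i' ->
  \sum_(c : {ffun I -> W}) iid_weight q c * f (c i) (c i') =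
  \sum_x \sum_x' q x * q x' * f x x'.
Proof.
move=> ii'.
(* [g x x'] is the indicator that [c] takes the values [x] at [i] and [x'] at [i'], written as a
   product over all coordinates so that [iid_sum_prod] applies. *)
pose g x x' (c : {ffun I -> W}) := \prod_(a : I)
   ((if a == i then (c a == x)%:R else 1) *
    (if a == i' then (c a == x')%:R else 1 : R)).
have gE x x' c : g x x' c = (c i == x)%:R * (c i' == x')%:R.
  by rewrite /g big_split -!big_mkcond !big_pred1_eq.
transitivity (\sum_(c : {ffun I -> W}) \sum_x \sum_x'
    iid_weight q c * g x x' c * f x x').
  apply: eq_bigr => c _.
  rewrite (bigD1 (c i))//= [X in _ + X]big1 ?addr0; last first.
    move=> x xc; apply: big1 => x' _.
    by rewrite gE eq_sym (negbTE xc) !(mul0r, mulr0).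
  rewrite (bigD1 (c i'))//= [X in _ + X]big1 ?addr0; last first.
    by move=> x xc; rewrite gE [c i' == _]eq_sym (negbTE xc) !(mul0r, mulr0).
  by rewrite gE !eqxx !mulr1.
rewrite exchange_big/=; apply: eq_bigr => x _.
rewrite exchange_big/=; apply: eq_bigr => x' _.
rewrite -mulr_suml; congr (_ * _).
rewrite /g (iid_sum_prod (fun a y => (if a == i then (y == x)%:R else 1) *
    (if a == i' then (y == x')%:R else 1))).
have i'i : i' != i by rewrite eq_sym.
rewrite (bigD1 i)//= (bigD1 i')//= [X in _ * (_ * X)]big1 ?mulr1; last first.
  move=> a /andP[/negbTE -> /negbTE ->].
  by under eq_bigr do rewrite !mulr1.
rewrite !eqxx (negbTE ii') (negbTE i'i).
congr (_ * _).
  rewrite (bigD1 x)//= eqxx big1 ?addr0 ?mulr1// => y /negbTE ->.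
  by rewrite mul0r mulr0.
rewrite (bigD1 x')//= eqxx big1 ?addr0 ?mulr1 ?mul1r// => y /negbTE ->.
by rewrite !mulr0.
Qed.

Lemma iid_sum_const (k : R) :
  \sum_(c : {ffun I -> W}) iid_weight q c * k = k.
Proof. by rewrite -mulr_suml iid_sum mul1r. Qed.

Lemma iid_le (f g : {ffun I -> W} -> R) : (forall c, f c <= g c) ->
  \sum_c iid_weight q c * f c <= \sum_c iid_weight q c * g c.
Proof. by move=> fg; apply: ler_sum => c _; rewrite ler_wpM2l ?iid_weight_ge0. Qed.

(** Selection of a good codebook: if [f] exceeded [e] everywhere, so would its average, strictly
    because some [c0] has positive weight. *)
Lemma iid_exists_le (f : {ffun I -> W} -> R) (e : R) :
  \sum_c iid_weight q c * f c <= e -> exists c, f c <= e.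
Proof.
move=> fe; apply/existsP; apply: contraT; rewrite negb_exists => /forallP h.
suff : e < \sum_c iid_weight q c * f c by rewrite ltNge fe.
rewrite -[ltLHS]iid_sum_const.
have [c0 c00] : exists c0 : {ffun I -> W}, iid_weight q c0 != 0.
  apply/existsP; apply: contraT; rewrite negb_exists => /forallP h0.
  have := iid_sum; rewrite big1 => [/eqP|c _].
    by rewrite eq_sym oner_eq0.
  by apply/eqP; rewrite -[_ == _]negbK h0.
rewrite (bigD1 c0)//= [ltRHS](bigD1 c0)//=; apply: ltr_leD.
  have c0_gt0 : 0 < iid_weight q c0 by rewrite lt_def c00 iid_weight_ge0.
  by rewrite ltr_pM2l// ltNge h.
apply: ler_sum => c _; rewrite ler_wpM2l ?iid_weight_ge0//.
by have := h c; rewrite -ltNge => /ltW.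
Qed.

(* Independence of the coordinates kills the cross terms of the square. *)
Lemma iid_second_moment (f : W -> R) : \sum_x q x * f x = 0 ->
  \sum_(c : {ffun I -> W}) iid_weight q c * (\sum_i f (c i)) ^+ 2 =
  #|I|%:R * \sum_x q x * f x ^+ 2.
Proof.
move=> f0.
under eq_bigr do rewrite expr2 mulr_suml mulr_sumr.
rewrite exchange_big/= -sum1_card natr_sum mulr_suml; apply: eq_bigr => i _.
rewrite mul1r.
under eq_bigr do rewrite mulr_sumr mulr_sumr.
rewrite exchange_big/= (bigD1 i)//= [X in _ + X]big1 ?addr0.
  by rewrite (iid_sum1 _ (fun x => f x * f x)).
move=> i' i'i; rewrite (iid_sum2 (fun x x' => f x * f x')) 1?eq_sym//.
under eq_bigr do under eq_bigr do rewrite mulrACA.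
rewrite -[LHS](_ : \sum_x (q x * f x) * (\sum_x' q x' * f x') = _).
  by rewrite -mulr_suml f0 mul0r.
by apply: eq_bigr => x _; rewrite mulr_sumr.
Qed.

End iid.

(** * A finite constellation that behaves like a Gaussian one *)

Section gauss_grid.
Context {R : realType}.
Implicit Types a c h x u : R.
Local Notation mu := (@lebesgue_measure R).

(** The standard deviation for which the normal density centred at c is proportional to exp (- a (u
    - c)^2). *)
Definition gauss_sd a : R := (Num.sqrt (2 * a))^-1.

Lemma gauss_sd_gt0 a : 0 < a -> 0 < gauss_sd a.
Proof. by move=> a0; rewrite invr_gt0 sqrtr_gt0 mulr_gt0. Qed.

Lemma gauss_sd_sqr a : 0 < a -> gauss_sd a ^+ 2 *+ 2 = a^-1.
Proof.
move=> a0; rewrite /gauss_sd exprVn sqr_sqrtr ?mulr_ge0// ?ltW//.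
by rewrite -mulr_natr; field; rewrite gt_eqF.
Qed.

Lemma expR_normal_pdf a c u : 0 < a ->
  expR (- (a * (u - c) ^+ 2)) =
  Num.sqrt (pi / a) * normal_pdf c (gauss_sd a) u.
Proof.
move=> a0; rewrite normal_pdfE ?gt_eqF ?gauss_sd_gt0//.
rewrite /normal_peak /normal_fun.
rewrite -mulrnAl gauss_sd_sqr// [a^-1 * _]mulrC mulVKf.
  by congr expR; rewrite invrK mulNr mulrC.
by rewrite gt_eqF// sqrtr_gt0 divr_gt0// pi_gt0.
Qed.

Lemma integral_expR_sqr a c (D : set R) : 0 < a -> measurable D ->
  (\int[mu]_(u in D) (expR (- (a * (u - c) ^+ 2)))%:E =
   (Num.sqrt (pi / a))%:E * normal_prob c (gauss_sd a) D)%E.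
Proof.
move=> a0 mD; rewrite /normal_prob -ge0_integralZl//=.
- by apply: eq_integral => u _; rewrite expR_normal_pdf.
- by apply/measurable_EFinP; apply: measurable_funTS; exact: measurable_normal_pdf.
by move=> u _; rewrite lee_fin normal_pdf_ge0.
Qed.

(* (u - c)^2 <= (1 + h)(x - c)^2 + (1 + 1/h) (u - x)^2 *)
Lemma sqr_shift_le h x c u : 0 < h -> `|u - x| <= h ->
  (u - c) ^+ 2 <= (1 + h) * (x - c) ^+ 2 + h * (1 + h).
Proof.
move=> h0 dh.
have -> : u - c = (x - c) + (u - x) by ring.
set X := x - c; set d := u - x in dh *.
have d2 : d ^+ 2 <= h ^+ 2 by rewrite -[d ^+ 2]real_normK ?num_real// lerXn2r// nnegrE ltW.
suff Xd : 2 * X * d <= h * X ^+ 2 + h.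
  have -> : (X + d) ^+ 2 = X ^+ 2 + 2 * X * d + d ^+ 2 by ring.
  have -> : (1 + h) * X ^+ 2 + h * (1 + h) = X ^+ 2 + h * X ^+ 2 + h + h ^+ 2.
    by ring.
  lra.
have : 0 <= h * (X - d / h) ^+ 2 by rewrite mulr_ge0 ?sqr_ge0// ltW.
have -> : h * (X - d / h) ^+ 2 = h * X ^+ 2 - 2 * X * d + d ^+ 2 / h.
  by field; rewrite gt_eqF.
have : d ^+ 2 / h <= h by rewrite ler_pdivrMr// -expr2.
lra.
Qed.

Lemma grid_integral_ub (f : R -> R) h x (y : R) : 0 < h ->
  measurable_fun setT f ->
  (forall u, x <= u <= x + h -> y <= f u) -> 0 <= y ->
  ((h * y)%:E <= \int[mu]_(u in `[x, (x + h)%R[%classic) (f u)%:E)%E.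
Proof.
move=> h0 mf yf y0.
have -> : ((h * y)%:E = \int[mu]_(u in `[x, (x + h)%R[%classic) (cst y%:E) u)%E.
  rewrite integral_cst//= lebesgue_measure_itv/= lte_fin ltrDl h0.
  by rewrite -EFinD addrAC subrr add0r -EFinM mulrC.
apply: ge0_le_integral => //=.
- by apply/measurable_EFinP; apply: measurable_funTS.
- by move=> u; rewrite in_itv/= => /andP[xu ux]; rewrite lee_fin yf// xu ltW.
Qed.

Lemma grid_integral_lb (f : R -> R) h x (y : R) : 0 < h ->
  measurable_fun setT f -> (forall u, 0 <= f u) ->
  (forall u, x <= u <= x + h -> f u <= y) ->
  (\int[mu]_(u in `[x, (x + h)%R[%classic) (f u)%:E <= (h * y)%:E)%E.
Proof.
move=> h0 mf f0 yf.
have -> : ((h * y)%:E = \int[mu]_(u in `[x, (x + h)%R[%classic) (cst y%:E) u)%E.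
  rewrite integral_cst//= lebesgue_measure_itv/= lte_fin ltrDl h0.
  by rewrite -EFinD addrAC subrr add0r -EFinM mulrC.
apply: ge0_le_integral => //=.
- by move=> u _; rewrite lee_fin.
- by apply/measurable_EFinP; apply: measurable_funTS.
- by move=> u; rewrite in_itv/= => /andP[xu ux]; rewrite lee_fin yf// xu ltW.
Qed.

(** For i = 0, ..., 2 m these are the multiples of h in [- h m, h m], symmetric about 0. *)
Definition gridpt h m (i : nat) : R := h * (i%:R - m%:R).

Lemma grid_measure (d : {measure set (measurableTypeR R) -> \bar R}) h m n :
  0 < h ->
  (\sum_(i < n) d `[gridpt h m i, (gridpt h m i + h)%R[%classic =
   d `[gridpt h m 0, gridpt h m n[%classic)%E.
Proof.
move=> h0; elim: n => [|n IH].
  by rewrite big_ord0 set_itvco0 measure0.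
rewrite big_ord_recr/= IH -measureU//=.
- congr (d _); have hn : gridpt h m n + h = gridpt h m n.+1.
    by rewrite /gridpt -natr1; ring.
  rewrite hn -itv_bndbnd_setU// bnd_simp.
    by rewrite /gridpt ler_pM2l// lerD2r ler_nat.
  by rewrite -hn lerDl ltW.
- apply/seteqP; split => // u [] /=; rewrite !in_itv/= => /andP[_ u1] /andP[u2 _].
  by move: u1; rewrite ltNge u2.
Qed.

(** By [sqr_shift_le] a term is at most exp (a h) times the wider Gaussian of parameter a / (1 + h),
    anywhere on the cell to its right. The cells are disjoint, so the sum is at most the full
    integral: the bound is uniform in the grid size and in the centre [c], which an exponential tilt
    will move. *)
Lemma grid_sum_ub h m n a c : 0 < h -> 0 < a ->
  \sum_(i < n) h * expR (- (a * (gridpt h m i - c) ^+ 2)) <=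
  expR (a * h) * Num.sqrt (pi * (1 + h) / a).
Proof.
move=> h0 a0.
have h1 : 0 < 1 + h by lra.
have a1 : 0 < a / (1 + h) by rewrite divr_gt0.
pose f u := expR (a * h) * expR (- (a / (1 + h) * (u - c) ^+ 2)).
have mf : measurable_fun setT f.
  apply: measurable_funM => //; apply: measurableT_comp => //.
  apply: measurable_funN; apply: measurable_funM => //.
  by apply: measurable_funX; exact: measurable_funB.
rewrite -lee_fin -sumEFin.
apply: (@le_trans _ _ (\sum_(i < n) \int[mu]_(u in `[gridpt h m i, (gridpt h m i + h)%R[%classic) (f u)%:E)%E).
  apply: lee_sum => i _; apply: grid_integral_ub => // u xu.
  rewrite /f -expRD ler_expR.
  have ux : `|u - gridpt h m i| <= h by rewrite ger0_norm; lra.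
  have := sqr_shift_le c h0 ux; set X := _ ^+ 2; set Y := _ ^+ 2 => XY.
  have : a * (X / (1 + h)) <= a * (Y + h).
    by rewrite ler_pM2l// ler_pdivrMr// (le_trans XY)//; nra.
  by rewrite mulrA mulrAC; nra.
have fE (D : set R) : measurable D -> (\int[mu]_(u in D) (f u)%:E =
   (expR (a * h) * Num.sqrt (pi * (1 + h) / a))%:E *
   normal_prob c (gauss_sd (a / (1 + h))) D)%E.
  move=> mD; rewrite /f; under eq_integral do rewrite EFinM.
  rewrite ge0_integralZl//=.
  - rewrite integral_expR_sqr// muleA -EFinM; congr ((_ * Num.sqrt _)%:E * _)%E.
    by field; rewrite !gt_eqF.
  - apply/measurable_EFinP; apply: measurable_funTS; apply: measurableT_comp => //.
    apply: measurable_funN; apply: measurable_funM => //.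
    by apply: measurable_funX; exact: measurable_funB.
under eq_bigr do rewrite fE//.
rewrite -ge0_sume_distrr; last by move=> i _; exact: measure_ge0.
rewrite (grid_measure (normal_prob c (gauss_sd (a / (1 + h)))) m n h0).
rewrite -[leRHS]mule1 lee_wpmul2l//.
exact: probability_le1.
Qed.

(** The comparison reversed, with the narrower Gaussian of parameter 1 + h. It bounds the total mass
    of the grid, for which one [m] capturing probability 1 - h is enough. *)
Lemma grid_sum_lb h : 0 < h -> h < 1 -> exists m,
  expR (- (h * (1 + h))) * (1 - h) * Num.sqrt (pi / (1 + h)) <=
  \sum_(i < (2 * m).+1) h * expR (- gridpt h m i ^+ 2).
Proof.
move=> h0 hl1.
have h1 : 0 < 1 + h by lra.
pose d := normal_prob 0 (gauss_sd (1 + h)).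
pose F (m : nat) : set (measurableTypeR R) :=
  `[gridpt h m 0, gridpt h m (2 * m).+1[%classic.
have FE m : F m = `[(- h * m%:R)%R, (h * (1 + m%:R))%R[%classic.
  have e : h * ((2 * m).+1%:R - m%:R) = h * (1 + m%:R).
    by rewrite -natr1 natrM; ring.
  by rewrite /F /gridpt e sub0r mulrN mulNr.
have [m mF] : exists m, ((1 - h)%:E <= d (F m))%E.
  have : d (F n) @[n --> \oo] --> d (\bigcup_n F n).
    apply: nondecreasing_cvg_mu => //.
    - by move=> m; rewrite FE; exact: measurable_itv.
    - by apply: bigcup_measurable => m _; rewrite FE; exact: measurable_itv.
    - move=> p q pq; apply/subsetPset => u; rewrite !FE/= !in_itv/= => /andP[u1 u2].
      apply/andP; split.
        by rewrite (le_trans _ u1)// !mulNr lerN2 ler_pM2l// ler_nat.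
      by rewrite (lt_le_trans u2)// ler_pM2l// lerD2l ler_nat.
  have -> : \bigcup_n F n = setT.
    apply/seteqP; split => // u _.
    exists (Num.truncn (`|u| / h)).+1 => //; rewrite FE/= in_itv/=.
    have : `|u| < h * (Num.truncn (`|u| / h)).+1%:R.
      by rewrite mulrC -ltr_pdivrMr// truncnS_gt.
    rewrite ltr_norml => /andP[u1 u2]; rewrite mulNr ltW//=.
    by rewrite (lt_trans u2)// ltr_pM2l// ltrDr.
  rewrite [d _](probability_setT (normal_prob 0 (gauss_sd (1 + h)))) => dF.
  have /dF : nbhs (1%:E : \bar R) [set x | ((1 - h)%:E < x)%E].
    by apply: open_ereal_gt'; rewrite lte_fin; lra.
  by move=> [N _ /(_ N (leqnn N))] /ltW; exists N.
exists m.
have -> : expR (- (h * (1 + h))) * (1 - h) * Num.sqrt (pi / (1 + h)) =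
  (expR (- (h * (1 + h))) * Num.sqrt (pi / (1 + h))) * (1 - h) by ring.
rewrite -lee_fin EFinM.
apply: (@le_trans _ _ ((expR (- (h * (1 + h))) * Num.sqrt (pi / (1 + h)))%:E *
   d (F m))%E).
  by rewrite lee_wpmul2l// lee_fin mulr_ge0 ?expR_ge0 ?sqrtr_ge0.
rewrite -[d (F m)](grid_measure (normal_prob 0 (gauss_sd (1 + h))))//.
rewrite EFinM -muleA ge0_sume_distrr; last first.
  by move=> i _; exact: measure_ge0.
rewrite ge0_sume_distrr; last first.
  by move=> i _; rewrite mule_ge0// lee_fin sqrtr_ge0.
rewrite -sumEFin; apply: lee_sum => i _.
rewrite -integral_expR_sqr// -ge0_integralZl//=; first last.
  apply/measurable_EFinP; apply: measurable_funTS; apply: measurableT_comp => //.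
  apply: measurable_funN; apply: measurable_funM => //.
  by apply: measurable_funX; exact: measurable_funB.
under eq_integral do rewrite -EFinM -expRD.
apply: grid_integral_lb => //.
- apply: measurableT_comp => //; apply: measurable_funD => //.
  apply: measurable_funN; apply: measurable_funM => //.
  by apply: measurable_funX; exact: measurable_funB.
move=> u xu; rewrite ler_expR subr0.
have ux : `|gridpt h m i - u| <= h by rewrite distrC ger0_norm; lra.
by have := sqr_shift_le 0 h0 ux; rewrite !subr0; lra.
Qed.

Lemma gridpt_rev h m (i : 'I_(2 * m).+1) : gridpt h m (rev_ord i) = - gridpt h m i.
Proof.
rewrite /gridpt /= subSS natrB; last by rewrite -ltnS.
by rewrite natrM; ring.
Qed.

Definition grid_mass h m : R := \sum_(i < (2 * m).+1) h * expR (- gridpt h m i ^+ 2).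

Definition grid_weight h m (i : 'I_(2 * m).+1) : R :=
  h * expR (- gridpt h m i ^+ 2) / grid_mass h m.

Lemma grid_mass_gt0 h m : 0 < h -> 0 < grid_mass h m.
Proof.
move=> h0; rewrite /grid_mass big_ord_recl ltr_pwDl ?mulr_gt0 ?expR_gt0//.
by apply: sumr_ge0 => i _; rewrite mulr_ge0 ?expR_ge0// ltW.
Qed.

Lemma grid_weight_ge0 h m i : 0 < h -> 0 <= @grid_weight h m i.
Proof.
by move=> h0; rewrite divr_ge0 ?mulr_ge0 ?expR_ge0 ?ltW// grid_mass_gt0.
Qed.

Lemma grid_weight_sum h m : 0 < h -> \sum_i @grid_weight h m i = 1.
Proof.
by move=> h0; rewrite -mulr_suml divff// gt_eqF// grid_mass_gt0.
Qed.

(** For N(0, 1/2) the average would be exp (b^2 / (4 (1 + tau))) / sqrt (1 + tau): complete the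
    square. The size [m] only serves the normalisation [grid_mass], hence is chosen before [tau] and
    [b]. *)
Lemma exists_grid h : 0 < h -> h <= 1 / 2 -> exists m, forall tau b, 0 <= tau ->
  \sum_i @grid_weight h m i * expR (- tau * gridpt h m i ^+ 2 + b * gridpt h m i) <=
  expR (h * (tau + 6)) / Num.sqrt (1 + tau) * expR (b ^+ 2 / (4 * (1 + tau))).
Proof.
move=> h0 h2; have h1 : h < 1 by lra.
have [m Sm] := grid_sum_lb h0 h1; exists m => tau b tau0.
have S0 := grid_mass_gt0 m h0.
have a0 : 0 < 1 + tau by lra.
have ha : 0 < 1 + h by lra.
under eq_bigr => i _.
  rewrite /grid_weight mulrAC -[h * _ * _]mulrA -expRD.
  rewrite (_ : _ + _ = b ^+ 2 / (4 * (1 + tau)) +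
    - ((1 + tau) * (gridpt h m i - b / (2 * (1 + tau))) ^+ 2)); last first.
    by field; rewrite gt_eqF.
  rewrite expRD mulrCA -mulrA; over.
rewrite -mulr_sumr mulrC -mulr_suml ler_wpM2r ?expR_ge0//.
rewrite ler_pdivrMr//.
apply: (le_trans (grid_sum_ub m (2 * m).+1 (b / (2 * (1 + tau))) h0 a0)).
apply: (le_trans _ (ler_wpM2l _ Sm)); last first.
  by rewrite divr_ge0 ?expR_ge0// sqrtr_ge0.
have -> : pi * (1 + h) / (1 + tau) = (pi / (1 + h)) * (1 + h) ^+ 2 / (1 + tau).
  by field; rewrite !gt_eqF.
have p0 : 0 <= pi / (1 + h) :> R by rewrite divr_ge0 ?pi_ge0// ltW.
rewrite (sqrtrM _ (mulr_ge0 p0 (sqr_ge0 _))) (sqrtrM _ p0).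
rewrite sqrtr_sqr (ger0_norm (ltW ha)) (sqrtrV (ltW a0)).
set s := Num.sqrt (pi / _); set r := (Num.sqrt _)^-1.
have sr : 0 <= s * r by rewrite mulr_ge0 ?invr_ge0 ?sqrtr_ge0.
suff H : expR ((1 + tau) * h) * (1 + h) <=
   expR (h * (tau + 6)) * (expR (- (h * (1 + h))) * (1 - h)).
  have := ler_wpM2r sr H; rewrite -subr_ge0 => H'.
  by rewrite -subr_ge0; apply: (le_trans H'); rewrite le_eqVlt; apply/orP; left; apply/eqP; ring.
(* The allowance h (tau + 6) is cut into pieces that absorb exp ((1 + tau) h), 1 + h, 1 - h and exp
   (- h (1 + h)); the last piece h (1 - h) is slack. The piece 2 h works because (1 + 2 h) (1 - h)
   >= 1 for h <= 1 / 2. *)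
have -> : expR (h * (tau + 6)) = expR ((1 + tau) * h) * expR h * expR (2 * h) *
   expR (h * (1 + h)) * expR (h * (1 - h)).
  by rewrite -!expRD; congr expR; ring.
have e1 : 1 + h <= expR h by exact: expR_ge1Dx.
have e2 : 1 <= expR (2 * h) * (1 - h).
  apply: (@le_trans _ _ ((1 + 2 * h) * (1 - h))); first nra.
  by rewrite ler_wpM2r ?expR_ge1Dx//; lra.
have e3 : 1 <= expR (h * (1 - h)).
  by apply: (le_trans _ (expR_ge1Dx _)); nra.
have -> : expR ((1 + tau) * h) * expR h * expR (2 * h) * expR (h * (1 + h)) *
    expR (h * (1 - h)) * (expR (- (h * (1 + h))) * (1 - h)) =
    expR ((1 + tau) * h) * (expR h * (expR (2 * h) * (1 - h)) * expR (h * (1 - h)))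
    * (expR (h * (1 + h)) * expR (- (h * (1 + h)))) by ring.
rewrite -[expR (h * (1 + h)) * _]expRD subrr expR0 mulr1 ler_wpM2l ?expR_ge0//.
apply: (le_trans e1); rewrite -mulrA ler_peMr ?expR_ge0//.
by rewrite -[leLHS]mulr1 ler_pM.
Qed.

(** The grid is rescaled to have second moment exactly 1 / 2; the square [c ^+ 2] of the scaling
    factor becomes the mismatch [v]. *)
Lemma exists_real_constellation (e taumax : R) : 0 < e -> 0 <= taumax ->
  exists (n : nat) (w x : 'I_n -> R) (v : R),
  [/\ 0 < v, (forall i, 0 <= w i) /\ \sum_i w i = 1,
      forall f : R -> R, \sum_i w i * f (- x i) = \sum_i w i * f (x i),
      \sum_i w i * x i ^+ 2 = 1 / 2 &
      forall tau b, 0 <= tau <= taumax ->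
      \sum_i w i * expR (- tau * x i ^+ 2 + b * x i) <=
      expR e / Num.sqrt (1 + v * tau) * expR (v * b ^+ 2 / (4 * (1 + v * tau)))].
Proof.
move=> e0 tm0.
(* The first bound forces the second moment of the grid above 1 / 4, hence [c ^+ 2 <= 2]; the second
   one then keeps the loss h (c^2 tau + 6) below [e]. *)
pose h := Num.min (200^-1) (e / (6 + 2 * taumax)).
have k0 : 0 < 6 + 2 * taumax by lra.
have h0 : 0 < h by rewrite lt_min invr_gt0 ltr0n divr_gt0.
have h200 : h <= 200^-1 by rewrite ge_min lexx.
have he : h * (6 + 2 * taumax) <= e by rewrite -ler_pdivlMr// ge_min lexx orbT.
have [|m Hm] := exists_grid h0; first lra.
pose w := @grid_weight h m; pose y := fun i : 'I_(2 * m).+1 => gridpt h m i.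
have w0 i : 0 <= w i by exact: grid_weight_ge0.
have w1 : \sum_i w i = 1 by exact: grid_weight_sum.
pose M := \sum_i w i * y i ^+ 2.
(* 1 - y^2 <= exp (- y^2), whose average is at most exp (7 h) / sqrt 2 by the grid bound at tau = 1,
   b = 0; and (200 / 193) / (7 / 5) < 3 / 4. *)
have M4 : 1 / 4 <= M.
  have : \sum_i w i * (1 - y i ^+ 2) <= 3 / 4.
    apply: (@le_trans _ _ (\sum_i w i * expR (- 1 * y i ^+ 2 + 0 * y i))).
      apply: ler_sum => i _; rewrite ler_wpM2l// mul0r addr0 mulN1r.
      exact: expR_ge1Dx.
    apply: (le_trans (Hm _ _ ler01)).
    rewrite expr0n/= mul0r expR0 mulr1.
    have s2 : 0 < Num.sqrt (1 + 1 : R) by rewrite sqrtr_gt0; lra.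
    rewrite ler_pdivrMr//.
    have E0 := expR_ge0 (h * (1 + 6)).
    have E1 : expR (h * (1 + 6)) <= 200 / 193.
      have : 1 - h * (1 + 6) <= expR (- (h * (1 + 6))) by exact: expR_ge1Dx.
      rewrite expRN => H.
      rewrite -[leLHS]invrK -[leRHS]invrK lef_pV2 ?posrE ?invr_gt0 ?expR_gt0//; lra.
    apply: (le_trans E1).
    have : (7 / 5) ^+ 2 <= Num.sqrt (1 + 1 : R) ^+ 2 by rewrite sqr_sqrtr; lra.
    rewrite ler_sqr ?nnegrE ?sqrtr_ge0//; lra.
  under eq_bigr do rewrite mulrBr mulr1.
  by rewrite sumrB w1 -/M; lra.
have M0 : 0 < M by lra.
pose c := (Num.sqrt (2 * M))^-1.
have c2 : c ^+ 2 = (2 * M)^-1 by rewrite exprVn sqr_sqrtr//; lra.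
exists (2 * m).+1, w, (fun i => c * y i), (c ^+ 2); split => //.
- by rewrite c2 invr_gt0; lra.
- move=> f; rewrite (reindex_inj rev_ord_inj)/=; apply: eq_bigr => i _.
  by rewrite /w /grid_weight /y gridpt_rev sqrrN mulrN opprK.
- transitivity (c ^+ 2 * M); last by rewrite c2; field; rewrite gt_eqF.
  by rewrite mulr_sumr; apply: eq_bigr => i _; ring.
move=> tau b /andP[t0 tm].
have ct0 : 0 <= c ^+ 2 * tau by rewrite mulr_ge0// sqr_ge0.
have c22 : c ^+ 2 <= 2.
  rewrite c2 -[leRHS]invrK lef_pV2 ?posrE ?invr_gt0//; lra.
have := Hm (c ^+ 2 * tau) (b * c) ct0.
under eq_bigr => i _.
  rewrite (_ : _ + _ = - tau * (c * y i) ^+ 2 + b * (c * y i)); last first.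
    by rewrite /y; ring.
  over.
move=> H; apply: (le_trans H).
rewrite [(b * c) ^+ 2]exprMn [_ * c ^+ 2]mulrC ler_wpM2r ?expR_ge0//.
rewrite ler_wpM2r ?invr_ge0 ?sqrtr_ge0// ler_expR (le_trans _ he)//.
rewrite ler_pM2l// [6 + _]addrC lerD2r.
by rewrite ler_pM ?sqr_ge0.
Qed.
End gauss_grid.

(** * The complex constellation as a product of two real ones *)

Section constellation.
Context {R : realType}.

Lemma abs2_ge0 (z : R[i]) : 0 <= abs2 z.
Proof. by rewrite addr_ge0 ?sqr_ge0. Qed.

(* Separating Re x from Im x makes the sums over a product grid factor. *)
Lemma abs2_sub_mul (y g : R[i]) (a b : R) :
  abs2 (y - g * (a +i* b)) = abs2 y
    - (- abs2 g * a ^+ 2 + 2 * (complex.Re y * complex.Re g + complex.Im y * complex.Im g) * a)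
    - (- abs2 g * b ^+ 2 + 2 * (complex.Im y * complex.Re g - complex.Re y * complex.Im g) * b).
Proof. by case: y g => [y1 y2] [g1 g2]; rewrite /abs2 /=; ring. Qed.

Lemma exists_constellation (p e taumax : R) : 0 <= p -> 0 < e -> 0 <= taumax ->
  exists (A : finType) (q : A -> R) (sym : A -> R[i]) (v : R),
  [/\ 0 < v, (forall i, 0 <= q i) /\ \sum_i q i = 1,
      forall f : R[i] -> R, \sum_i q i * f (- sym i) = \sum_i q i * f (sym i),
      \sum_i q i * abs2 (sym i) = p &
      forall (theta : R) (g y : R[i]), 0 <= theta -> theta * abs2 g * p <= taumax ->
      \sum_i q i * expR (theta / (1 + v * (theta * abs2 g * p)) * abs2 y
                         - theta * abs2 (y - g * sym i)) <=
      expR e / (1 + v * (theta * abs2 g * p))].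
Proof.
move=> p0 e0 tm0.
have e20 : 0 < e / 2 by lra.
have [n [w [x [v [v0 [w0 w1] xN x2 xexp]]]]] :=
  exists_real_constellation e20 tm0.
pose r := Num.sqrt p; have r2 : r ^+ 2 = p by rewrite sqr_sqrtr.
exists ('I_n * 'I_n)%type, (fun i => w i.1 * w i.2),
  (fun i => (r * x i.1) +i* (r * x i.2)), v; split => //.
- split=> [i|]; first by rewrite mulr_ge0.
  rewrite -(pair_bigA _ (fun i j => w i * w j))/=.
  by rewrite -[RHS]w1; apply: eq_bigr => i _; rewrite -mulr_sumr w1 mulr1.
- move=> f; rewrite -(pair_bigA _ (fun i j => w i * w j * f (- (r * x i +i* (r * x j)))))/=.
  rewrite -(pair_bigA _ (fun i j => w i * w j * f (r * x i +i* (r * x j))))/=.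
  transitivity (\sum_i w i * \sum_j w j * f (- (r * x i) +i* (r * - x j))).
    apply: eq_bigr => i _; rewrite mulr_sumr; apply: eq_bigr => j _.
    by rewrite mulrA mulrN.
  transitivity (\sum_i w i * \sum_j w j * f (r * - x i +i* (r * x j))).
    apply: eq_bigr => i _; congr (_ * _).
    by have /= -> := xN (fun t => f (- (r * x i) +i* (r * t))); rewrite mulrN.
  have /= -> := xN (fun u => \sum_j w j * f (r * u +i* (r * x j))).
  apply: eq_bigr => i _; rewrite mulr_sumr; apply: eq_bigr => j _.
  by rewrite mulrA.
- rewrite -(pair_bigA _ (fun i j => w i * w j * abs2 (r * x i +i* (r * x j))))/=.
  transitivity (\sum_i (w i * x i ^+ 2 * p + w i * (p / 2))).
    apply: eq_bigr => i _.
    transitivity (\sum_j (w i * x i ^+ 2 * p * w j + w i * p * (w j * x j ^+ 2))).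
      by apply: eq_bigr => j _; rewrite /abs2 /= !exprMn r2; ring.
    by rewrite big_split/= -!mulr_sumr w1 x2; ring.
  by rewrite big_split/= -!mulr_suml w1 x2; lra.
move=> theta g y t0 tm.
set tau := theta * abs2 g * p in tm *.
have tau0 : 0 <= tau by rewrite !mulr_ge0// abs2_ge0.
have d0 : 0 < 1 + v * tau by rewrite ltr_pwDl// mulr_ge0// ltW.
pose a := 2 * theta * r * (complex.Re y * complex.Re g + complex.Im y * complex.Im g).
pose b := 2 * theta * r * (complex.Im y * complex.Re g - complex.Re y * complex.Im g).
(* This identity dictates the coefficient theta / (1 + v tau) of the metric: the two tilts
   contribute theta v tau |y|^2 / (1 + v tau) to the exponent, which cancels (k - theta) |y|^2, so
   the bound does not depend on [y]. *)
have ab : a ^+ 2 + b ^+ 2 = 4 * theta * tau * abs2 y.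
  by rewrite /a /b /tau /abs2 !exprMn r2; ring.
rewrite -(pair_bigA _ (fun i j => w i * w j * expR
  (theta / (1 + v * tau) * abs2 y - theta * abs2 (y - g * (r * x i +i* (r * x j))))))/=.
have tt : 0 <= tau <= taumax by rewrite tau0.
set k := theta / (1 + v * tau).
have -> : \sum_i \sum_j w i * w j *
    expR (k * abs2 y - theta * abs2 (y - g * (r * x i +i* (r * x j)))) =
  expR ((k - theta) * abs2 y) * ((\sum_i w i * expR (- tau * x i ^+ 2 + a * x i)) *
   (\sum_j w j * expR (- tau * x j ^+ 2 + b * x j))).
  rewrite mulr_suml mulr_sumr; apply: eq_bigr => i _.
  rewrite !mulr_sumr; apply: eq_bigr => j _.
  rewrite abs2_sub_mul.
  rewrite (_ : k * abs2 y - _ = (k - theta) * abs2 y +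
    ((- tau * x i ^+ 2 + a * x i) + (- tau * x j ^+ 2 + b * x j))).
    by rewrite !expRD; ring.
  by rewrite /tau /a /b !exprMn r2; ring.
apply: (@le_trans _ _ (expR ((k - theta) * abs2 y) *
  ((expR (e / 2) / Num.sqrt (1 + v * tau) * expR (v * a ^+ 2 / (4 * (1 + v * tau)))) *
   (expR (e / 2) / Num.sqrt (1 + v * tau) * expR (v * b ^+ 2 / (4 * (1 + v * tau))))))).
  rewrite ler_wpM2l ?expR_ge0// ler_pM ?xexp//;
    by apply: sumr_ge0 => i _; rewrite mulr_ge0 ?expR_ge0.
have ss : (Num.sqrt (1 + v * tau))^-1 * (Num.sqrt (1 + v * tau))^-1 = (1 + v * tau)^-1.
  by rewrite -invfM -expr2 sqr_sqrtr// ltW.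
rewrite (_ : _ * _ = expR (e / 2) * expR (e / 2) *
  ((Num.sqrt (1 + v * tau))^-1 * (Num.sqrt (1 + v * tau))^-1) *
  (expR ((k - theta) * abs2 y) *
   (expR (v * a ^+ 2 / (4 * (1 + v * tau))) * expR (v * b ^+ 2 / (4 * (1 + v * tau)))))); last by ring.
rewrite ss -!expRD (_ : _ + (_ + _) = 0).
  by rewrite expR0 mulr1 -splitr.
rewrite -mulrDl -mulrDr ab /k; field.
by rewrite gt_eqF.
Qed.

End constellation.

(** * Laws, independence and the weak law of large numbers *)

Section laws.
Context {R : realType} {d d1 : measure_display}.
Context {Omega : measurableType d} {T1 : measurableType d1}.
Variables (P : probability Omega R) (X : Omega -> T1) (mX : measurable_fun setT X).
Variable mu : probability T1 R.
Hypothesis PX : forall A, measurable A -> P (X @^-1` A) = mu A.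

Let mX_mixin := isMeasurableFun.Build _ _ _ _ _ mX.
Let mX_pack : {mfun Omega >-> T1} := HB.pack X mX_mixin.

Lemma ge0_integral_law (F : T1 -> \bar R) : measurable_fun setT F ->
  (forall x, 0 <= F x)%E -> (\int[P]_w F (X w) = \int[mu]_x F x)%E.
Proof.
move=> mF F0.
rewrite -(ge0_integral_distribution (P := P) mX_pack)//.
by apply: eq_measure_integral => A mA _; exact: PX.
Qed.

Lemma integrable_law (F : T1 -> \bar R) : mu.-integrable setT F ->
  P.-integrable setT (F \o X).
Proof.
move=> /integrableP[mF iF]; apply/integrableP; split.
  exact: measurableT_comp.
rewrite (ge0_integral_law (F := fun x => `|F x|%E))//.
exact: measurableT_comp.
Qed.

Lemma integral_law (F : T1 -> \bar R) : mu.-integrable setT F ->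
  (\int[P]_w F (X w) = \int[mu]_x F x)%E.
Proof.
move=> iF; have [mF _] := integrableP _ _ _ iF.
rewrite -(@integral_distribution _ _ _ _ _ P mX_pack F)//.
  by apply: eq_measure_integral => A mA _; exact: PX.
exact: integrable_law.
Qed.

End laws.

Section independence.
Context {R : realType} {d d1 d2 : measure_display}.
Context {Omega : measurableType d} {T1 : measurableType d1} {T2 : measurableType d2}.
Variables (P : probability Omega R) (X : Omega -> T1) (Y : Omega -> T2).
Hypotheses (mX : measurable_fun setT X) (mY : measurable_fun setT Y).
Variables (mu : probability T1 R) (nu : probability T2 R).
Hypothesis PXY : forall A B, measurable A -> measurable B ->
  P (X @^-1` A `&` Y @^-1` B) = (mu A * nu B)%E.

Let mXY : measurable_fun setT (fun w => (X w, Y w)).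
Proof. exact: measurable_fun_pair. Qed.

Let mXY_mixin := isMeasurableFun.Build _ _ _ _ _ mXY.
Let XY : {mfun Omega >-> (T1 * T2)%type} := HB.pack (fun w => (X w, Y w)) mXY_mixin.

Let PXYE (A : set (T1 * T2)) : measurable A ->
  P ((fun w => (X w, Y w)) @^-1` A) = (mu \x nu)%E A.
Proof.
move=> mA; apply/esym.
rewrite (@product_measure_unique _ _ _ _ _ mu nu (distribution P XY)) => [//|B C mB mC|//].
exact: PXY.
Qed.

(** The product rule on rectangles identifies the law of the pair with the product measure, so that
    Tonelli applies. *)
Lemma ge0_integral_indep (F : T1 * T2 -> \bar R) : measurable_fun setT F ->
  (forall x, 0 <= F x)%E ->
  (\int[P]_w F (X w, Y w) = \int[mu]_x \int[nu]_y F (x, y))%E.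
Proof.
move=> mF F0.
rewrite (ge0_integral_law (mu := [the probability _ _ of (mu \x nu)%E]) mXY)//.
by rewrite fubini_tonelli1.
Qed.

Lemma law_left A : measurable A -> P (X @^-1` A) = mu A.
Proof.
move=> mA; have := PXY mA (@measurableT _ _).
by rewrite preimage_setT setIT probability_setT mule1.
Qed.

Lemma Rintegral_indep (f : T1 -> R) (g : T2 -> R) (K : R) :
  measurable_fun setT f -> measurable_fun setT g ->
  (forall x, `|f x| <= K) -> (forall x, `|g x| <= K) ->
  (\int[P]_w (f (X w) * g (Y w)) = (\int[mu]_x f x) * (\int[nu]_y g y))%R.
Proof.
move=> mf mg fK gK.
pose h (z : T1 * T2) := f z.1 * g z.2.
have mh : measurable_fun setT h.
  by apply: measurable_funM; apply: measurableT_comp.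
have ih : (mu \x nu)%E.-integrable setT (EFin \o h).
  apply: measurable_bounded_integrable => //.
    rewrite [ltLHS](_ : _ = 1%E) ?ltry//.
    exact: (@probability_setT _ _ _ [the probability _ _ of (mu \x nu)%E]).
  exists (K * K); split; first exact: num_real.
  move=> M KM z _ /=; rewrite normrM (le_trans _ (ltW KM))//.
  by rewrite ler_pM.
have ifg (d' : measure_display) (T : measurableType d') (m : probability T R) (k : T -> R) : measurable_fun setT k ->
    (forall x, `|k x| <= K) -> m.-integrable setT (EFin \o k).
  move=> mk kK; apply: measurable_bounded_integrable => //.
    by rewrite [ltLHS](_ : _ = 1%E) ?ltry//; exact: probability_setT.
  exists K; split; first exact: num_real.
  by move=> M KM z _ /=; rewrite (le_trans _ (ltW KM)).
rewrite /Rintegral (integral_law (mu := [the probability _ _ of (mu \x nu)%E]) mXY PXYE (F := EFin \o h))//.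
rewrite -fubini1//.
transitivity (fine (\int[mu]_x ((\int[nu]_y g y)%:E * (f x)%:E))%E).
  congr fine; apply: eq_integral => x _; rewrite /fubini_F /h/=.
  under eq_integral do rewrite EFinM.
  rewrite integralZl//; last exact: ifg.
  by rewrite muleC /Rintegral fineK//; apply: integrable_fin_num => //; exact: ifg.
rewrite integralZl//; last exact: ifg.
have e : (\int[mu]_x (f x)%:E)%E = (Rintegral mu setT f)%:E.
  by rewrite /Rintegral fineK//; apply: integrable_fin_num => //; exact: ifg.
by rewrite e -EFinM/= mulrC.
Qed.

End independence.

Section probability_integrals.
Import HBSimple.
Context {R : realType} {d : measure_display} {T : measurableType d}.
Variable mu : probability T R.

Lemma integrable_bounded (f : T -> R) (K : R) : measurable_fun setT f ->
  (forall x, `|f x| <= K) -> mu.-integrable setT (EFin \o f).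
Proof.
move=> mf fK; apply: measurable_bounded_integrable => //.
  by rewrite [ltLHS](_ : _ = 1%E) ?ltry//; exact: probability_setT.
exists K; split; first exact: num_real.
by move=> M KM z _ /=; rewrite (le_trans _ (ltW KM)).
Qed.

Lemma Rintegral_sum (I : Type) (s : seq I) (f : I -> T -> R) :
  (forall i, mu.-integrable setT (EFin \o f i)) ->
  \int[mu]_x (\sum_(i <- s) f i x) = \sum_(i <- s) \int[mu]_x f i x.
Proof.
move=> fi; rewrite /Rintegral; under eq_integral do rewrite -sumEFin.
rewrite (integral_sum measurableT (f := fun i x => (f i x)%:E))//.
rewrite (eq_bigr (fun i => (Rintegral mu setT (f i))%:E)) ?sumEFin//= => i _.
by rewrite /Rintegral fineK//; apply: integrable_fin_num => //; exact: fi.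
Qed.

(** The common form of the Markov, Chebyshev and union bounds used below: [F] dominates the
    indicator of [E]. *)
Lemma prob_le_Rintegral (E : set T) (F : T -> R) : measurable E ->
  mu.-integrable setT (EFin \o F) -> (forall x, 0 <= F x) ->
  (forall x, E x -> 1 <= F x) -> fine (mu E) <= \int[mu]_x F x.
Proof.
move=> mE iF F0 F1.
have -> : fine (mu E) = \int[mu]_x \1_E x.
  by rewrite /Rintegral integral_indic// setIT.
apply: le_Rintegral => //.
  apply: (@integrable_bounded _ 1); first exact: measurable_indic.
  by move=> x; rewrite indicE ger0_norm// lern1 leq_b1.
move=> x _; rewrite indicE; case: (boolP (x \in E)) => [/set_mem /F1//|_].
exact: F0.
Qed.

Lemma integrable_sumR (I : Type) (s : seq I) (f : I -> T -> R) :
  (forall i, mu.-integrable setT (EFin \o f i)) ->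
  mu.-integrable setT (EFin \o (fun x => \sum_(i <- s) f i x)).
Proof.
move=> fi; rewrite (_ : _ \o _ = fun x => (\sum_(i <- s) (EFin \o f i) x)%E).
  exact: integrable_sum.
by apply/funext => x /=; rewrite sumEFin.
Qed.

Lemma integrableZR (k : R) (f : T -> R) : mu.-integrable setT (EFin \o f) ->
  mu.-integrable setT (EFin \o (fun x => k * f x)).
Proof.
move=> fi; rewrite (_ : _ \o _ = fun x => (k%:E * (EFin \o f) x)%E).
  exact: integrableZl.
by apply/funext => x /=; rewrite EFinM.
Qed.

Lemma Rintegral_cst1 (k : R) : \int[mu]_x k = k.
Proof.
rewrite Rintegral_cst//= (_ : mu _ = 1%E) ?mulr1//.
exact: probability_setT.
Qed.

Lemma exists_bounded_approx (f : T -> R) (e : R) : 0 < e ->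
  mu.-integrable setT (EFin \o f) ->
  exists (g : T -> R) (K : R), [/\ measurable_fun setT g, forall x, `|g x| <= K &
    \int[mu]_x `|f x - g x| <= e].
Proof.
move=> e0 fi.
have [g [gi _ gf]] := approximation_sfun_integrable measurableT fi.
have /gf [N _ /(_ N (leqnn N))/= gN] : nbhs (0%E : \bar R) [set x | (x < e%:E)%E].
  by apply: open_ereal_lt'; rewrite lte_fin.
have [K [_ gK]] := simple_bounded (g N).
(* Boundedness is stated for every constant strictly above [K], whence [K + 1]. *)
exists (g N), (K + 1); split => //.
  by move=> x; apply: gK => //; rewrite ltrDl.
have ri : mu.-integrable setT (EFin \o (fun x => `|f x - g N x|)).
  have -> : EFin \o (fun x => `|f x - g N x|) =
      abse \o ((EFin \o f) \- (EFin \o g N))%E by apply/funext => x.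
  by apply: integrable_abse; apply: integrableB => //; exact: gi.
rewrite -lee_fin /Rintegral fineK; first exact: ltW.
exact: integrable_fin_num.
Qed.

End probability_integrals.

(** * The weak law of large numbers over codewords and blocks *)

Section weak_law.
Context {R : realType} {d d' : measure_display}.
Context {Omega : measurableType d} {T : measurableType d'}.
Variables (P : probability Omega R) (mu : probability T R).
Variables (Z : nat -> Omega -> T).
Hypotheses (mZ : forall b, measurable_fun setT (Z b)).
Hypothesis PZ : forall b b' A B, b != b' -> measurable A -> measurable B ->
  P (Z b @^-1` A `&` Z b' @^-1` B) = (mu A * mu B)%E.
Variables (W : finType) (q : W -> R).
Hypothesis (q0 : forall x, 0 <= q x) (q1 : \sum_x q x = 1).

Lemma pairwise_law b A : measurable A -> P (Z b @^-1` A) = mu A.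
Proof.
apply: (law_left (P := P) (X := Z b) (Y := Z b.+1) (nu := mu)) => B C mB mC.
by rewrite PZ// ltn_eqF.
Qed.

Lemma Rintegral_pairwise b (f : T -> R) : mu.-integrable setT (EFin \o f) ->
  \int[P]_w f (Z b w) = \int[mu]_x f x.
Proof.
by move=> fi; rewrite /Rintegral (integral_law (mZ b) (@pairwise_law b) fi).
Qed.

Lemma integrable_pairwise b (f : T -> R) : mu.-integrable setT (EFin \o f) ->
  P.-integrable setT (EFin \o (fun w => f (Z b w))).
Proof. exact: (integrable_law (mZ b) (@pairwise_law b)). Qed.

(** [h] is centred only after averaging over both the input and the channel, so the expectation is
    taken over both at once. For two distinct blocks it then factors into the square of the
    vanishing mean, and only the n diagonal terms remain. *)
Lemma second_moment_sum_le n (h : W -> T -> R) (K : R) :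
  (forall x, measurable_fun setT (h x)) -> (forall x z, `|h x z| <= K) ->
  \sum_x q x * (\int[mu]_z h x z) = 0 ->
  \sum_(c : {ffun 'I_n -> W}) iid_weight q c *
    (\int[P]_w (\sum_(b < n) h (c b) (Z b w)) ^+ 2) <= n%:R * K ^+ 2.
Proof.
move=> mh hK h0.
have ih (x x' : W) b b' :
    P.-integrable setT (EFin \o (fun w => h x (Z b w) * h x' (Z b' w))).
  apply: (@integrable_bounded _ _ _ _ _ (K * K)).
    by apply: measurable_funM; apply: measurableT_comp.
  by move=> w; rewrite normrM ler_pM.
have K0 (x : W) (w : T) : 0 <= K by apply: le_trans (hK x w).
under eq_bigr => c _.
  have -> : \int[P]_w (\sum_(b < n) h (c b) (Z b w)) ^+ 2 =
      \sum_(b < n) \sum_(b' < n) \int[P]_w (h (c b) (Z b w) * h (c b') (Z b' w)).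
    transitivity (\sum_(b < n) \int[P]_w (\sum_(b' < n) h (c b) (Z b w) * h (c b') (Z b' w))).
      rewrite -Rintegral_sum; last by move=> b; exact: integrable_sumR.
      apply: eq_Rintegral => w _; rewrite expr2 mulr_suml.
      by apply: eq_bigr => b _; rewrite mulr_sumr.
    by apply: eq_bigr => b _; rewrite Rintegral_sum.
  over.
under eq_bigr do rewrite mulr_sumr.
rewrite exchange_big/= -[n in leRHS]card_ord -sum1_card natr_sum mulr_suml.
apply: ler_sum => b _; rewrite mul1r.
under eq_bigr do rewrite mulr_sumr.
rewrite exchange_big/= (bigD1 b)//= [X in _ + X]big1 ?addr0.
  apply: (@le_trans _ _ (\sum_(c : {ffun 'I_n -> W}) iid_weight q c * K ^+ 2)).
    apply: iid_le => // c; rewrite -[leRHS](@Rintegral_cst1 _ _ _ P).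
    apply: le_Rintegral => //.
      apply: (@integrable_bounded _ _ _ _ _ `|K ^+ 2|) => //.
    move=> w _; rewrite -expr2 -[leLHS]ger0_norm ?sqr_ge0// normrX.
    by rewrite lerXn2r ?nnegrE// (K0 (c b) (Z b w)).
  by rewrite (iid_sum_const _ q1).
move=> b' b'b.
rewrite (iid_sum2 q1 (fun x x' => \int[P]_w (h x (Z b w) * h x' (Z b' w)))) 1?eq_sym//.
rewrite -[LHS](_ : \sum_x (q x * \int[mu]_z h x z) * (\sum_x' q x' * \int[mu]_z h x' z) = _).
  by rewrite -mulr_suml h0 mul0r.
apply: eq_bigr => x _; rewrite mulr_sumr; apply: eq_bigr => x' _.
rewrite (Rintegral_indep (mZ b) (mZ b') (mu := mu) (nu := mu) _ (mh x) (mh x') (hK x) (hK x')).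
  by rewrite mulrACA.
by move=> B C mB mC; rewrite PZ// eq_sym.
Qed.

Lemma measurable_lt_sum n (f : W -> T -> R) (r : R) (c : 'I_n -> W) :
  (forall x, measurable_fun setT (f x)) ->
  measurable [set w | \sum_(b < n) f (c b) (Z b w) < r].
Proof.
move=> mf.
pose F w := \sum_(b < n) f (c b) (Z b w).
have mF : measurable_fun setT F.
  by apply: measurable_sum => b; apply: measurableT_comp.
have := measurable_fun_ltr mF (measurable_cst r) measurableT (Y := [set true]).
move=> /(_ Logic.I); rewrite setTI; congr measurable; apply/seteqP; split => w /=; case: ltP.
Qed.

(* Truncation (here: approximation in L1 by bounded functions) reduces to the
   second-moment bound, so pairwise independence suffices. *)
Lemma weak_law (f : W -> T -> R) (dl e : R) : 0 < dl -> 0 < e ->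
  (forall x, measurable_fun setT (f x)) ->
  (forall x, mu.-integrable setT (EFin \o f x)) ->
  exists n0, forall n, (n0 <= n)%N ->
  \sum_(c : {ffun 'I_n -> W}) iid_weight q c *
    fine (P [set w | (\sum_(b < n) f (c b) (Z b w) <
       n%:R * ((\sum_x q x * \int[mu]_z f x z) - dl))%R]) <= e.
Proof.
move=> dl0 e0 mf fi; set m := \sum_x _.
(* The first bound keeps the shift of the mean caused by truncation below [dl / 4], the second one
   the Markov term 2 e1 / dl below e / 2. *)
pose e1 := Num.min (dl / 4) (e * dl / 4).
have e10 : 0 < e1 by rewrite lt_min !divr_gt0 ?mulr_gt0.
have [g gP] := choice (fun x => exists_bounded_approx e10 (fi x)).
have [K0 K0P] := choice gP.
have mg x : measurable_fun setT (g x) by have [] := K0P x.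
have gK x z : `|g x z| <= K0 x by have [] := K0P x.
have fg x : \int[mu]_z `|f x z - g x z| <= e1 by have [] := K0P x.
have gi x : mu.-integrable setT (EFin \o g x).
  exact: (@integrable_bounded _ _ _ _ _ (K0 x)).
pose r x z := `|f x z - g x z|.
have ri x : mu.-integrable setT (EFin \o r x).
  have -> : EFin \o r x = abse \o ((EFin \o f x) \- (EFin \o g x))%E by apply/funext => z.
  by apply: integrable_abse; apply: integrableB.
pose m' := \sum_x q x * \int[mu]_z g x z.
have mm' : m - m' <= e1.
  rewrite /m /m' -sumrB -[leRHS]mul1r -q1 mulr_suml; apply: ler_sum => x _.
  rewrite -mulrBr ler_wpM2l// (le_trans _ (fg x))// -RintegralB//.
  apply: le_Rintegral => //; last by move=> z _; exact: ler_norm.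
    by rewrite (_ : _ \o _ = ((EFin \o f x) \- (EFin \o g x))%E) ?integrableB.
  exact: ri.
pose h x z := g x z - m'.
pose K := (\sum_y `|K0 y|) + `|m'|.
have hK x z : `|h x z| <= K.
  rewrite (le_trans (ler_normB _ _))// lerD2r (le_trans (gK x z))//.
  rewrite (le_trans (ler_norm _))// (bigD1 x)//= lerDl.
  exact: sumr_ge0.
have mh x : measurable_fun setT (h x) by exact: measurable_funB.
have h0 : \sum_x q x * \int[mu]_z h x z = 0.
  transitivity (m' - m'); last exact: subrr.
  rewrite -[X in _ - X]mul1r -q1 mulr_suml -sumrB; apply: eq_bigr => x _.
  rewrite -mulrBr RintegralB// ?Rintegral_cst1//.
  exact: (@integrable_bounded _ _ _ _ _ `|m'|).
exists (Num.truncn (32 * K ^+ 2 / (dl ^+ 2 * e))).+1 => n nn.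
have n0 : (0 < n)%N by exact: leq_trans nn.
have nR : 0 < n%:R :> R by rewrite ltr0n.
have nK : 32 * K ^+ 2 <= n%:R * (dl ^+ 2 * e).
  rewrite -ler_pdivrMr ?mulr_gt0 ?exprn_gt0//.
  rewrite ltW// (lt_le_trans (truncnS_gt _))// ler_nat//.
(* A deficit of n dl leaves 3 n dl / 4 after the shift of the mean. Either the truncation error
   reaches n dl / 2 (Markov, factor [k2]) or the centred bounded sum is at most - n dl / 4
   (Chebyshev, factor [k1]). *)
pose k1 := 16 / (n%:R * dl) ^+ 2; pose k2 := 2 / (n%:R * dl).
have nd0 : 0 < n%:R * dl by rewrite mulr_gt0.
have k10 : 0 <= k1 by rewrite divr_ge0 ?sqr_ge0.
have k20 : 0 <= k2 by rewrite divr_ge0// ltW.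
have step (c : {ffun 'I_n -> W}) :
  fine (P [set w | (\sum_(b < n) f (c b) (Z b w) < n%:R * (m - dl))%R]) <=
  k1 * (\int[P]_w (\sum_(b < n) h (c b) (Z b w)) ^+ 2) +
  k2 * \sum_(b < n) \int[mu]_z r (c b) z.
  have i1 : P.-integrable setT (EFin \o (fun w => (\sum_(b < n) h (c b) (Z b w)) ^+ 2)).
    apply: (@integrable_bounded _ _ _ _ _ ((n%:R * K) ^+ 2)).
      apply: measurable_funX; apply: measurable_sum => b.
      exact: measurableT_comp.
    move=> w; rewrite normrX lerXn2r ?nnegrE//.
      by rewrite mulr_ge0// (le_trans _ (hK (c (Ordinal n0)) (Z 0 w))).
    rewrite (le_trans (ler_norm_sum _ _ _))// -[n in leRHS]card_ord -sum1_card.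
    by rewrite natr_sum mulr_suml; apply: ler_sum => b _; rewrite mul1r.
  have i2 : P.-integrable setT (EFin \o (fun w => \sum_(b < n) r (c b) (Z b w))).
    by apply: integrable_sumR => b; exact: integrable_pairwise.
  have -> : k1 * (\int[P]_w (\sum_(b < n) h (c b) (Z b w)) ^+ 2) +
      k2 * (\sum_(b < n) \int[mu]_z r (c b) z) =
      \int[P]_w (k1 * (\sum_(b < n) h (c b) (Z b w)) ^+ 2 +
        k2 * \sum_(b < n) r (c b) (Z b w)).
    rewrite RintegralD//; try exact: integrableZR.
    rewrite !RintegralZl//; congr (_ + _ * _).
    rewrite Rintegral_sum; last by move=> b; exact: integrable_pairwise.
    by apply: eq_bigr => b _; rewrite Rintegral_pairwise.
  apply: prob_le_Rintegral.
  - exact: measurable_lt_sum.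
  - rewrite (_ : _ \o _ = (EFin \o (fun w => (k1 * (\sum_(b < n) h (c b) (Z b w)) ^+ 2)%R)) \+
      (EFin \o (fun w => (k2 * (\sum_(b < n) r (c b) (Z b w)))%R)))%E.
      by apply: integrableD => //; exact: integrableZR.
    by apply/funext.
  - move=> w; apply: addr_ge0; first by rewrite mulr_ge0// sqr_ge0.
    by rewrite mulr_ge0//; apply: sumr_ge0 => b _; exact: normr_ge0.
  move=> w /= fw.
  set a := \sum_(b < n) h _ _; set s := \sum_(b < n) r _ _.
  have s0 : 0 <= s by apply: sumr_ge0 => b _; rewrite normr_ge0.
  have afs : a + n%:R * m' - s <= \sum_(b < n) f (c b) (Z b w).
    rewrite -[n in n%:R]card_ord -sum1_card natr_sum mulr_suml -big_split/= -sumrB.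
    apply: ler_sum => b _; rewrite mul1r /h subrK lerBlDr addrC -lerBlDr.
    by rewrite /r distrC ler_norm.
  have e14 : e1 <= dl / 4 by rewrite ge_min lexx.
  have nm : n%:R * (m - m') <= n%:R * (dl / 4) by rewrite ler_pM2l// (le_trans mm').
  have key : a - s < - (3 / 4) * (n%:R * dl) by lra.
  have [hs|hs] := leP (n%:R * dl / 2) s.
    apply: (@le_trans _ _ (k2 * s)); last by rewrite lerDr mulr_ge0 ?sqr_ge0.
    rewrite /k2 mulrAC ler_pdivlMr//; lra.
  apply: (@le_trans _ _ (k1 * a ^+ 2)); last by rewrite lerDl mulr_ge0.
  have ha : n%:R * dl / 4 <= - a by lra.
  rewrite /k1 mulrAC ler_pdivlMr ?exprn_gt0// mul1r.
  have : (n%:R * dl / 4) ^+ 2 <= (- a) ^+ 2.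
    by rewrite lerXn2r ?nnegrE ?divr_ge0 ?(ltW nd0)//; lra.
  by rewrite sqrrN exprMn; lra.
apply: (le_trans (iid_le q0 step)).
under eq_bigr do rewrite mulrDr mulrCA [X in _ + X]mulrCA.
rewrite big_split/= -!mulr_sumr.
have t1 := second_moment_sum_le n mh hK h0.
have t2 : \sum_(c : {ffun 'I_n -> W}) iid_weight q c * (\sum_(b < n) \int[mu]_z r (c b) z) <= n%:R * e1.
  apply: (@le_trans _ _ (\sum_(c : {ffun 'I_n -> W}) iid_weight q c * (n%:R * e1))).
    apply: iid_le => // c; rewrite -[n in leRHS]card_ord -sum1_card natr_sum mulr_suml.
    by apply: ler_sum => b _; rewrite mul1r fg.
  by rewrite iid_sum_const.
apply: (le_trans (lerD (ler_wpM2l k10 t1) (ler_wpM2l k20 t2))).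
have e14 : e1 <= e * dl / 4 by rewrite ge_min lexx orbT.
have -> : k2 * (n%:R * e1) = 2 * e1 / dl by rewrite /k2; field; rewrite !gt_eqF.
have -> : k1 * (n%:R * K ^+ 2) = 16 * K ^+ 2 / (n%:R * dl ^+ 2).
  by rewrite /k1; field; rewrite !gt_eqF.
have t3 : 2 * e1 / dl <= e / 2 by rewrite ler_pdivrMr//; lra.
have t4 : 16 * K ^+ 2 / (n%:R * dl ^+ 2) <= e / 2.
  by rewrite ler_pdivrMr ?mulr_gt0 ?exprn_gt0//; lra.
lra.
Qed.

End weak_law.

(** * Random coding with a threshold decoder *)

Section random_coding.
Context {R : realType} {d d' : measure_display}.
Context {Omega : measurableType d} {T : measurableType d'}.
Variables (P : probability Omega R) (mu : probability T R).
Variables (Z : nat -> Omega -> T).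
Hypotheses (mZ : forall b, measurable_fun setT (Z b)).
Hypothesis PZ : forall b b' A B, b != b' -> measurable A -> measurable B ->
  P (Z b @^-1` A `&` Z b' @^-1` B) = (mu A * mu B)%E.
Variables (W : finType) (q : W -> R).
Hypothesis (q0 : forall x, 0 <= q x) (q1 : \sum_x q x = 1).
Variables (Y : Type) (out : W -> T -> Y) (met : W -> Y -> R) (rho : R).
Hypothesis mmet : forall x x', measurable_fun setT (fun z => met x' (out x z)).
Hypothesis imet : forall x, mu.-integrable setT (EFin \o (fun z => met x (out x z))).
Hypothesis met_exp : forall y, \sum_x q x * expR (met x y) <= expR (- rho).

Let m := \sum_x q x * \int[mu]_z met x (out x z).

(* [c] is sent, [c'] is tried by the decoder. *)
Definition score n (c c' : {ffun 'I_n -> W}) (w : Omega) : R :=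
  \sum_(b < n) met (c' b) (out (c b) (Z b w)).

Definition confused n (t : R) M (C : 'I_M -> {ffun 'I_n -> W}) (i : 'I_M) : set Omega :=
  [set w | score (C i) (C i) w < t \/
           exists2 i', i' != i & t <= score (C i) (C i') w].

Lemma measurable_score n (c c' : {ffun 'I_n -> W}) :
  measurable_fun setT (score c c').
Proof. by apply: measurable_sum => b; exact: (measurableT_comp (mmet (c b) (c' b)) (mZ b)). Qed.

Lemma measurable_lt_set (f g : Omega -> R) : measurable_fun setT f -> measurable_fun setT g ->
  measurable [set w | f w < g w].
Proof.
move=> mf mg.
have := measurable_fun_ltr mf mg measurableT (Y := [set true]).
by move=> /(_ Logic.I); rewrite setTI; congr measurable; apply/seteqP; split => w /=; case: ltP.
Qed.

Lemma measurable_score_lt n (c c' : {ffun 'I_n -> W}) t :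
  measurable [set w | score c c' w < t].
Proof. by apply: measurable_lt_set => //; exact: measurable_score. Qed.

Lemma measurable_score_ge n (c c' : {ffun 'I_n -> W}) t :
  measurable [set w | t <= score c c' w].
Proof.
rewrite (_ : mkset _ = ~` [set w | score c c' w < t]).
  by apply: measurableC; exact: measurable_score_lt.
by apply/seteqP; split => w /=; rewrite leNgt => /negP.
Qed.

Lemma measurable_confused n t M (C : 'I_M -> {ffun 'I_n -> W}) i :
  measurable (confused t C i).
Proof.
have -> : confused t C i = [set w | score (C i) (C i) w < t] `|`
    \bigcup_(i' in [set i' | i' != i]) [set w | t <= score (C i) (C i') w].
  by apply/seteqP; split => w /= [?|[i' ? ?]]; [left|right; exists i'|left|right; exists i'].
apply: measurableU; first exact: measurable_score_lt.
apply: fin_bigcup_measurable; first exact: finite_finset.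
by move=> i' _; exact: measurable_score_ge.
Qed.

Lemma integrable_indic_prob (A : set Omega) : measurable A ->
  P.-integrable setT (EFin \o (\1_A : Omega -> R)).
Proof.
move=> mA; apply: (@integrable_bounded _ _ _ _ _ 1); first exact: measurable_indic.
by move=> x; rewrite indicE ger0_norm// lern1 leq_b1.
Qed.

Lemma Rintegral_indic_prob (A : set Omega) : measurable A ->
  \int[P]_x \1_A x = fine (P A).
Proof. by move=> mA; rewrite /Rintegral integral_indic// setIT. Qed.

Lemma prob_confused_le n t M (C : 'I_M -> {ffun 'I_n -> W}) i :
  fine (P (confused t C i)) <= fine (P [set w | score (C i) (C i) w < t]) +
    \sum_(i' < M | i' != i) fine (P [set w | t <= score (C i) (C i') w]).
Proof.
pose B i' : set Omega := [set w | t <= score (C i) (C i') w].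
pose A : set Omega := [set w | score (C i) (C i) w < t].
have mA : measurable A by exact: measurable_score_lt.
have mB i' : measurable (B i') by exact: measurable_score_ge.
have -> : fine (P A) + \sum_(i' < M | i' != i) fine (P (B i')) =
    \int[P]_w (\1_A w + \sum_(i' < M | i' != i) \1_(B i') w).
  rewrite RintegralD//; first last.
  - under eq_fun do rewrite -big_filter.
    by apply: integrable_sumR => i'; exact: integrable_indic_prob.
  - exact: integrable_indic_prob.
  rewrite Rintegral_indic_prob//; congr (_ + _).
  rewrite -big_filter; under [in RHS]eq_Rintegral do rewrite -big_filter.
  rewrite Rintegral_sum; last by move=> i'; exact: integrable_indic_prob.
  by apply: eq_bigr => i' _; rewrite Rintegral_indic_prob.
apply: prob_le_Rintegral.
- exact: measurable_confused.
- rewrite (_ : _ \o _ = ((EFin \o \1_A) \+ (EFin \o (fun w =>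
     (\sum_(i' < M | i' != i) \1_(B i') w)%R)))%E); last by apply/funext.
  apply: integrableD => //; first exact: integrable_indic_prob.
  under eq_fun do rewrite -big_filter.
  by apply: integrable_sumR => i'; exact: integrable_indic_prob.
- by move=> w; rewrite addr_ge0// sumr_ge0.
move=> w [Aw|[i' i'i Bw]].
  by rewrite indicE mem_set// lerDl sumr_ge0.
rewrite (bigD1 i')//= [\1_(B i') w]indicE mem_set//= addrCA lerDl addr_ge0//.
by rewrite sumr_ge0.
Qed.

(** Chernoff bound with exponent 1: the indicator is at most exp (score - t), whose average factors
    over the blocks. The outputs [y] are arbitrary, so their law never enters. *)
Lemma codeword_tail n (t : R) (y : 'I_n -> Y) :
  \sum_(c : {ffun 'I_n -> W}) iid_weight q c * (t <= \sum_b met (c b) (y b))%R%:R <=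
  expR (- (t + n%:R * rho)).
Proof.
apply: (@le_trans _ _ (\sum_(c : {ffun 'I_n -> W}) iid_weight q c *
    (expR (- t) * \prod_b expR (met (c b) (y b))))).
  apply: iid_le => // c; rewrite -expR_sum -expRD.
  case: (leP t _) => [h|_] /=; last by rewrite expR_ge0.
  by rewrite -[leLHS]expR0 ler_expR; lra.
under eq_bigr do rewrite mulrCA.
rewrite -mulr_sumr (iid_sum_prod q (fun b x => expR (met x (y b)))).
rewrite opprD expRD ler_wpM2l ?expR_ge0//.
have -> : - (n%:R * rho) = \sum_(b < n) - rho.
  by rewrite sumr_const card_ord mulNrn mulr_natl.
rewrite expR_sum; apply: ler_prod => b _.
by rewrite met_exp andbT sumr_ge0// => x _; rewrite mulr_ge0 ?expR_ge0.
Qed.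

(** A false codeword is drawn independently of the one sent; with the latter and the outcome [w]
    fixed, the outputs are fixed too and [codeword_tail] applies pointwise. *)
Lemma false_score_le n (t : R) M (i i' : 'I_M) : i' != i ->
  \sum_(C : {ffun 'I_M -> {ffun 'I_n -> W}}) iid_weight (iid_weight q) C *
    fine (P [set w | t <= score (C i) (C i') w]) <= expR (- (t + n%:R * rho)).
Proof.
move=> i'i; have Q0 := @iid_weight_ge0 _ 'I_n _ _ q0; have Q1 := iid_sum 'I_n q1.
rewrite (iid_sum2 Q1 (fun c c' => fine (P [set w | t <= score c c' w]))) 1?eq_sym//.
rewrite -[leRHS]mul1r -[X in _ <= X * _]Q1 mulr_suml; apply: ler_sum => c _.
under eq_bigr do rewrite -mulrA.
rewrite -mulr_sumr ler_wpM2l//.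
pose E c' : set Omega := [set w | t <= score c c' w].
have mE c' : measurable (E c') by exact: measurable_score_ge.
have -> : \sum_(c' : {ffun 'I_n -> W}) iid_weight q c' * fine (P (E c')) =
    \int[P]_w (\sum_(c' : {ffun 'I_n -> W}) iid_weight q c' * \1_(E c') w).
  rewrite Rintegral_sum; last first.
    by move=> c'; apply: integrableZR; exact: integrable_indic_prob.
  apply: eq_bigr => c' _; rewrite RintegralZl//; last exact: integrable_indic_prob.
  by rewrite Rintegral_indic_prob.
rewrite -[leRHS](@Rintegral_cst1 _ _ _ P).
apply: le_Rintegral => //.
- by apply: integrable_sumR => c'; apply: integrableZR; exact: integrable_indic_prob.
- exact: (@integrable_bounded _ _ _ _ _ `|expR (- (t + n%:R * rho))|).
move=> w _; apply: le_trans (codeword_tail t (fun b => out (c b) (Z b w))).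
rewrite le_eqVlt; apply/orP; left; apply/eqP; apply: eq_bigr => c' _.
rewrite indicE; congr (_ * (nat_of_bool _)%:R).
by apply/idP/idP; rewrite inE.
Qed.

(** One [dl] separates the threshold from the mean score of the codeword sent. The other leaves the
    union bound over the false codewords at exp (- n dl). *)
Lemma random_codebook_error (dl e : R) : 0 < dl -> 0 < e ->
  exists n0, forall n M, (n0 <= n)%N -> M%:R <= expR (n%:R * (m + rho - 2 * dl)) ->
  forall i : 'I_M,
  \sum_(C : {ffun 'I_M -> {ffun 'I_n -> W}}) iid_weight (iid_weight q) C *
    fine (P (confused (n%:R * (m - dl)) C i)) <= e.
Proof.
move=> dl0 e0; have e20 : 0 < e / 2 by lra.
have [n1 n1P] := weak_law mZ PZ q0 q1 dl0 e20 (fun x => mmet x x) imet.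
(* The second bound gives n dl >= 2 / e, hence exp (- n dl) <= 1 / (1 + n dl) <= e / 2. *)
exists (maxn n1 (Num.truncn (2 / (e * dl))).+1) => n M; rewrite geq_max => /andP[nn1 nn2] Mn i.
have Q0 := @iid_weight_ge0 _ 'I_n _ _ q0; have Q1 := iid_sum 'I_n q1.
have n2 : 2 / (e * dl) <= n%:R.
  by rewrite ltW// (lt_le_trans (truncnS_gt _))// ler_nat.
set t := n%:R * _.
apply: (le_trans (iid_le Q0 (fun C : {ffun 'I_M -> {ffun 'I_n -> W}} => prob_confused_le t C i))).
under eq_bigr do rewrite mulrDr mulr_sumr.
rewrite big_split/= exchange_big/=.
rewrite (iid_sum1 Q1 i (fun c => fine (P [set w | score c c w < t]))).
rewrite [leRHS]splitr lerD//; first exact: n1P.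
apply: (@le_trans _ _ (\sum_(i' < M | i' != i) expR (- (t + n%:R * rho)))).
  by apply: ler_sum => i' i'i; exact: false_score_le.
apply: (@le_trans _ _ (M%:R * expR (- (t + n%:R * rho)))).
  have -> : M%:R * expR (- (t + n%:R * rho)) = \sum_(i' < M) expR (- (t + n%:R * rho)).
    by rewrite sumr_const card_ord mulr_natl.
  by rewrite [leRHS](bigID (fun i' => i' != i))/= lerDl sumr_ge0.
apply: (le_trans (ler_wpM2r (expR_ge0 _) Mn)); rewrite -expRD.
have -> : n%:R * (m + rho - 2 * dl) - (t + n%:R * rho) = - (n%:R * dl) by rewrite /t; ring.
have nd : 2 / e <= n%:R * dl.
  by rewrite -ler_pdivrMr//; move: n2; rewrite invfM mulrA.
rewrite expRN -[leRHS]invrK lef_pV2 ?posrE ?invr_gt0 ?expR_gt0//.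
rewrite invf_div (le_trans nd)// (le_trans _ (expR_ge1Dx _))//; lra.
Qed.

(** Error and power have to be good for the same codebook, so one functional measures both. Here
    [u s] is the power spent in slot [s] of a block. *)
Lemma exists_codebook (S : finType) (u : S -> W -> R) (p dl e eta : R) :
  0 < p -> 0 < dl -> 0 < e -> 0 < eta ->
  (forall s, \sum_x q x * u s x = p) ->
  exists (n0 : nat) (k : R), forall n M, (n0 <= n)%N ->
    k * n%:R <= M%:R -> (0 < M)%N ->
    M%:R <= expR (n%:R * (m + rho - 2 * dl)) ->
  exists C : {ffun 'I_M -> {ffun 'I_n -> W}},
    \sum_i fine (P (confused (n%:R * (m - dl)) C i)) <= e * M%:R /\
    forall s b, \sum_i u s (C i b) <= (1 + eta) * (M%:R * p).
Proof.
move=> p0 dl0 e0 eta0 up.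
have e20 : 0 < e / 2 by lra.
have [n0 n0P] := random_codebook_error dl0 e20.
pose V := \sum_s \sum_x q x * (u s x - p) ^+ 2.
have V0 : 0 <= V.
  by apply: sumr_ge0 => s _; apply: sumr_ge0 => x _; rewrite mulr_ge0// sqr_ge0.
(* The variances of the powers in all n blocks add up to n M V. Comparing with the square of the
   tolerated deviation M p eta, M must grow at least linearly in n. *)
exists n0, (2 * V / (p * eta) ^+ 2) => n M nn kM M0 MR.
have MR0 : 0 < M%:R :> R by rewrite ltr0n.
set t := n%:R * (m - dl).
have Q0 := @iid_weight_ge0 _ 'I_n _ _ q0; have Q1 := iid_sum 'I_n q1.
pose D := (M%:R * (p * eta)) ^+ 2.
have D0 : 0 < D by rewrite exprn_gt0// !mulr_gt0.
(* The weight e / D makes the second summand exceed [e] as soon as the power of a single slot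
   exceeds its mean by more than M p eta; the first summand is the average error. *)
pose F (C : {ffun 'I_M -> {ffun 'I_n -> W}}) :=
  (\sum_i fine (P (confused t C i))) / M%:R +
  e / D * \sum_(b < n) \sum_s (\sum_i (u s (C i b) - p)) ^+ 2.
have [C FC] : exists C, F C <= e.
  apply: (iid_exists_le Q0 Q1).
  rewrite /F; under eq_bigr do rewrite mulrDr mulrA mulrCA.
  rewrite big_split/= -mulr_suml -mulr_sumr [leRHS]splitr lerD//.
    under eq_bigr do rewrite mulr_sumr.
    rewrite exchange_big/= ler_pdivrMr//.
    have -> : e / 2 * M%:R = \sum_(i < M) e / 2.
      by rewrite sumr_const card_ord mulr_natr.
    by apply: ler_sum => i _; exact: n0P.
  under eq_bigr do rewrite mulr_sumr.
  rewrite exchange_big/=.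
  have -> : \sum_(b < n) \sum_(C : {ffun 'I_M -> {ffun 'I_n -> W}})
      iid_weight (iid_weight q) C * \sum_s (\sum_i (u s (C i b) - p)) ^+ 2 =
      n%:R * (M%:R * V).
    have -> : n%:R * (M%:R * V) = \sum_(b < n) M%:R * V.
      by rewrite sumr_const card_ord mulr_natl.
    apply: eq_bigr => b _.
    under eq_bigr do rewrite mulr_sumr.
    rewrite exchange_big/= mulr_sumr; apply: eq_bigr => s _.
    rewrite (@iid_second_moment _ _ _ _ Q1 (fun c => u s (c b) - p)); last first.
      rewrite (iid_sum1 q1 b (fun x => u s x - p)).
      under eq_bigr do rewrite mulrBr.
      by rewrite sumrB up -mulr_suml q1 mul1r subrr.
    by rewrite (iid_sum1 q1 b (fun x => (u s x - p) ^+ 2)) card_ord.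
  move: kM; rewrite mulrAC ler_pdivrMr ?exprn_gt0 ?mulr_gt0// => kM.
  rewrite mulrAC ler_pdivrMr// /D.
  have : e / 2 * M%:R * (2 * V * n%:R) <= e / 2 * M%:R * (M%:R * (p * eta) ^+ 2).
    by rewrite ler_pM2l ?mulr_gt0.
  rewrite exprMn; lra.
exists C.
have G0 : 0 <= \sum_(b < n) \sum_s (\sum_i (u s (C i b) - p)) ^+ 2.
  by apply: sumr_ge0 => b _; apply: sumr_ge0 => s _; exact: sqr_ge0.
have E0 : 0 <= \sum_i fine (P (confused t C i)).
  by apply: sumr_ge0 => i _; exact: fine_ge0.
have eD : 0 < e / D by rewrite divr_gt0.
split.
  rewrite -ler_pdivrMr// (le_trans _ FC)// lerDl mulr_ge0// ltW//.
move=> s b.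
have : e / D * (\sum_i (u s (C i b) - p)) ^+ 2 <= e.
  apply: le_trans FC; apply: (@le_trans _ _ (e / D * \sum_(b < n) \sum_s (\sum_i (u s (C i b) - p)) ^+ 2)).
    rewrite ler_pM2l// (bigD1 b)//= (bigD1 s)//= -addrA lerDl addr_ge0//.
      by apply: sumr_ge0 => s' _; exact: sqr_ge0.
    by apply: sumr_ge0 => b' _; apply: sumr_ge0 => s' _; exact: sqr_ge0.
  by rewrite lerDr divr_ge0// ltW.
rewrite mulrAC ler_pdivrMr// ler_pM2l// /D => h.
have : \sum_i (u s (C i b) - p) <= M%:R * (p * eta).
  rewrite leNgt; apply/negP => h'; move: h; apply/negP; rewrite -ltNge.
  by rewrite ltr_pXn2r// ?nnegrE ?ltW// ?(lt_trans _ h')// !mulr_gt0.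
rewrite sumrB sumr_const card_ord -mulr_natl; lra.
Qed.

End random_coding.

(** * Coordinate spaces and Gaussian kernels *)

Section generating_system.
Context {R : realType} {d d1 : measure_display}.
Context {Omega : measurableType d} {T1 : measurableType d1}.
Variables (P : probability Omega R) (X : Omega -> T1).
Hypothesis (mX : measurable_fun setT X).
Variables (mu : probability T1 R).

Lemma measurable_preimage A : measurable A -> measurable (X @^-1` A).
Proof. by move=> mA; rewrite -[X in measurable X]setTI; exact: mX. Qed.

(** Uniqueness of finite measures on a generating pi-system, for A |-> P (X in A, B) and the
    multiple p of [mu]. *)
Lemma indep_generated_left (G : set (set T1)) (B : set Omega) (p : \bar R) :
  @measurable _ T1 = <<s G >> -> setI_closed G -> G setT ->
  measurable B -> P B = p ->
  (forall A, G A -> P (X @^-1` A `&` B) = (mu A * p)%E) ->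
  forall A, measurable A -> P (X @^-1` A `&` B) = (mu A * p)%E.
Proof.
move=> sG GI GT mB PB PG A mA.
have p0 : (0 <= p)%E by rewrite -PB.
have pfin : p \is a fin_num by rewrite -PB fin_num_measure.
pose r : {nonneg R} := NngNum (fine_ge0 p0).
pose m1 := measure_function_pushforward__canonical__measure_function_Measure (mrestr P mB) mX.
pose m2 : {measure set T1 -> \bar R} := [the measure _ _ of mscale r mu].
have m2E C : m2 C = (mu C * p)%E by rewrite /m2/= /mscale/= fineK// muleC.
rewrite -m2E -[LHS]/(m1 A).
apply: (@measure_unique _ R T1 G (fun=> setT)) => //.
- by apply/seteqP; split => // x _; exists 0%N.
- by move=> C GC; rewrite m2E -PG.
- move=> _; rewrite /m1/= /pushforward /mrestr preimage_setT setTI PB.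
  by rewrite -ge0_fin_numE.
Qed.

End generating_system.

Lemma indep_generated {R : realType} {d d1 d2 : measure_display}
  {Omega : measurableType d} {T1 : measurableType d1} {T2 : measurableType d2}
  (P : probability Omega R) (X : Omega -> T1) (Y : Omega -> T2)
  (mX : measurable_fun setT X) (mY : measurable_fun setT Y)
  (mu : probability T1 R) (nu : probability T2 R)
  (G1 : set (set T1)) (G2 : set (set T2)) :
  @measurable _ T1 = <<s G1 >> -> setI_closed G1 -> G1 setT ->
  @measurable _ T2 = <<s G2 >> -> setI_closed G2 -> G2 setT ->
  (forall A B, G1 A -> G2 B -> P (X @^-1` A `&` Y @^-1` B) = (mu A * nu B)%E) ->
  forall A B, measurable A -> measurable B ->
    P (X @^-1` A `&` Y @^-1` B) = (mu A * nu B)%E.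
Proof.
move=> sG1 GI1 GT1 sG2 GI2 GT2 PG A B mA mB.
have mG2 C : G2 C -> measurable C by rewrite sG2; exact: sub_sigma_algebra.
have PY C : G2 C -> P (Y @^-1` C) = nu C.
  move=> GC; have := PG _ _ GT1 GC.
  by rewrite preimage_setT setTI probability_setT mul1e.
have step1 C D : measurable C -> G2 D -> P (X @^-1` C `&` Y @^-1` D) = (mu C * nu D)%E.
  move=> mC GD; apply: (indep_generated_left mX sG1 GI1 GT1) => //.
  - by apply: measurable_preimage => //; exact: mG2.
  - exact: PY.
  - by move=> C' GC'; exact: PG.
have PXA : P (X @^-1` A) = mu A.
  have := step1 _ _ mA GT2.
  by rewrite preimage_setT setIT probability_setT mule1.
rewrite setIC muleC; apply: (indep_generated_left mY sG2 GI2 GT2) => //.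
  exact: measurable_preimage.
by move=> C GC; rewrite setIC step1// muleC.
Qed.

(** * Finite powers of R^2 *)

Section coordinate_space.
Context {R : realType}.
Local Notation RR := (measurableTypeR R * measurableTypeR R)%type.

(** A tuple underneath, for its product sigma-algebra; [crd] and [mkc] hide the enumeration of
    [I]. *)
Definition cspace (I : finType) := #|I|.-tuple RR.
Definition crd (I : finType) (z : cspace I) (i : I) : RR := tnth z (enum_rank i).
Definition mkc (I : finType) (f : I -> RR) : cspace I := [tuple f (enum_val k) | k < #|I|].

Lemma crd_mkc (I : finType) (f : I -> RR) i : crd (mkc f) i = f i.
Proof. by rewrite /crd tnth_mktuple enum_rankK. Qed.

Variable I : finType.

Definition cyl (A : I -> set RR) : set (cspace I) := [set z | forall i, A i (crd z i)].

Definition cylinders : set (set (cspace I)) :=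
  [set U | exists2 A : I -> set RR, forall i, measurable (A i) & U = cyl A].

Lemma measurable_crd i : measurable_fun setT (fun z : cspace I => crd z i).
Proof. exact: measurable_tnth. Qed.

Lemma measurable_mkc d (T : measurableType d) (f : T -> I -> RR) :
  (forall i, measurable_fun setT (f ^~ i)) ->
  measurable_fun setT (fun w => mkc (f w)).
Proof.
move=> mf; apply/measurable_fun_tnthP => k.
rewrite (_ : _ \o _ = f ^~ (enum_val k)) //.
by apply/funext => w /=; rewrite tnth_mktuple.
Qed.

Lemma cylE (A : I -> set RR) : cyl A = \bigcap_(i in [set: I]) ((fun z => crd z i) @^-1` A i).
Proof. by apply/seteqP; split => z /= h i => [_|]; exact: h. Qed.

Lemma measurable_cyl (A : I -> set RR) : (forall i, measurable (A i)) -> measurable (cyl A).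
Proof.
move=> mA; rewrite cylE; apply: fin_bigcap_measurable; first exact: finite_finset.
by move=> i _; rewrite -[X in measurable X]setTI; apply: measurable_crd.
Qed.

Lemma cylindersT : cylinders setT.
Proof. by exists (fun=> setT) => //; apply/seteqP; split. Qed.

Lemma cylinders_setI : setI_closed cylinders.
Proof.
move=> _ _ [A mA ->] [B mB ->]; exists (fun i => A i `&` B i).
  by move=> i; exact: measurableI.
by apply/seteqP; split => z; [move=> [a b] i; split|move=> ab; split=> i; have [] := ab i].
Qed.

Lemma measurable_cspaceE : @measurable _ (cspace I) = <<s cylinders >>.
Proof.
apply/seteqP; split; last first.
  apply: smallest_sub; first exact: sigma_algebra_measurable.
  by move=> _ [A mA ->]; exact: measurable_cyl.
apply: smallest_sub; first exact: smallest_sigma_algebra.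
rewrite -bigcup_seq => U [k _ [B mB <-]]; apply: sub_sigma_algebra.
exists (fun i => if i == enum_val k then B else setT).
  by move=> i; case: ifP.
rewrite setTI; apply/seteqP; split => z /=.
  by move=> Bz i; case: eqP => // ->; rewrite /crd enum_valK.
by move=> /(_ (enum_val k)); rewrite eqxx /crd enum_valK.
Qed.

End coordinate_space.

(** * Gaussian laws as kernels in the variance *)

Section gauss_kernel.
Context {R : realType}.
Local Notation RR := (measurableTypeR R * measurableTypeR R)%type.

Lemma measurable_sqrtr : measurable_fun setT (@Num.sqrt R).
Proof. by apply: continuous_measurable_fun; exact: sqrt_continuous. Qed.

(** The distortion variance depends on the channels, so probabilities under the Gaussian law must be
    measurable in the variance before being integrated over the channels. *)
Lemma measurable_gauss (A : set (measurableTypeR R)) : measurable A ->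
  measurable_fun setT (fun v : R => gauss v A).
Proof.
move=> mA.
(* The normal density at variance p.1, its inverses written as exp (- ln _) so that joint
   measurability follows by composition; for a positive variance the logarithms are genuine. *)
pose h (p : RR) : \bar R :=
  (expR (- ln (Num.sqrt (p.1 * (pi *+ 2)))) * expR (- (p.2 ^+ 2 * expR (- ln (p.1 *+ 2)))) *
   \1_A p.2)%:E.
have h0 p : (0 <= h p)%E by rewrite lee_fin !mulr_ge0 ?expR_ge0.
have mh : measurable_fun setT h.
  apply/measurable_EFinP; apply: measurable_funM; last first.
    by apply: measurableT_comp => //; exact: measurable_indic.
  apply: measurable_funM; apply: measurableT_comp => //; apply: measurable_funN.
    apply: measurableT_comp; first exact: measurable_ln.
    apply: measurableT_comp; first exact: measurable_sqrtr.
    by apply: measurable_funM.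
  apply: measurable_funM; first exact: measurable_funX.
  apply: measurableT_comp => //; apply: measurable_funN.
  apply: measurableT_comp; first exact: measurable_ln.
  by under eq_fun do rewrite -mulr_natr; apply: measurable_funM.
(* For v < 0 the square root is 0, so the value is constant in v. *)
have E v : gauss v A = if 0 < v then (\int[lebesgue_measure]_x h (v, x))%E else
    if v == 0 then \d_(0 : measurableTypeR R) A else normal_prob 0 0 A.
  rewrite /gauss; case: ltP => v0; last first.
    by case: eqP => // vn0; rewrite ler0_sqrtr.
  rewrite (gt_eqF v0) /= /normal_prob integral_mkcond; apply: eq_integral => x _.
  rewrite /h /patch indicE; case: ifPn => xA; last by rewrite mulr0.
  have p0 : 0 < pi *+ 2 :> R by rewrite mulrn_wgt0// pi_gt0.
  rewrite mulr1 normal_pdfE ?gt_eqF ?sqrtr_gt0// /normal_peak /normal_fun subr0.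
  have s0 : Num.sqrt (v * (pi *+ 2)) \is Num.pos by rewrite posrE sqrtr_gt0 mulr_gt0.
  have v2 : v *+ 2 \is Num.pos by rewrite posrE mulrn_wgt0.
  rewrite sqr_sqrtr ?ltW// !expRN (lnK s0) (lnK v2)/=.
  by rewrite [v * (pi *+ 2)]mulrnAr mulNr expRN.
under eq_fun do rewrite E.
apply: measurable_fun_ifT.
- exact: measurable_fun_ltr.
- exact: (measurable_fun_fubini_tonelli_F (m2 := lebesgue_measure)).
by apply: measurable_fun_ifT => //; exact: measurable_fun_eqr.
Qed.

Definition cgauss_prob (v : R) : probability RR R :=
  [the probability _ _ of (gauss (v / 2) \x gauss (v / 2))%E].

Lemma cgaussX v (A B : set (measurableTypeR R)) : measurable A -> measurable B ->
  cgauss v (A `*` B) = (gauss (v / 2) A * gauss (v / 2) B)%E.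
Proof. by move=> mA mB; rewrite /cgauss [LHS]product_measure1E. Qed.

Lemma measurable_cgauss (A : set RR) : measurable A ->
  measurable_fun setT (fun v : R => cgauss v A).
Proof.
pose G : set (set RR) := [set B `*` C | B in measurable & C in measurable].
have sG : @measurable _ RR = <<s G >> by rewrite measurable_prod_measurableType.
rewrite [X in X A]sG.
apply: (dynkin_induction (P := fun A => measurable_fun setT (fun v : R => cgauss v A)) sG).
- move=> _ _ [B mB [C mC <-]] [B' mB' [C' mC' <-]]; exists (B `&` B').
    exact: measurableI.
  by exists (C `&` C'); [exact: measurableI|rewrite setXI].
- have E (v : R) : cgauss v setT = 1%E by exact: (probability_setT (cgauss_prob v)).
  by under eq_fun do rewrite E; exact: measurable_cst.
- move=> _ [B mB [C mC <-]]; under eq_fun do rewrite cgaussX//.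
  have m2 : measurable_fun setT (fun v : R => v / 2) by exact: measurable_funM.
  by apply: emeasurable_funM; apply: (measurableT_comp (measurable_gauss _) m2).
- move=> S mS mf.
  have E (v : R) : cgauss v (~` S) = (1 - cgauss v S)%E.
    exact: (probability_setC (cgauss_prob v) mS).
  by under eq_fun do rewrite E; exact: emeasurable_funB.
- move=> F mF tF mf.
  have E (v : R) : cgauss v (\bigcup_k F k) = (\sum_(0 <= k <oo) cgauss v (F k))%E.
    apply: (measure_semi_bigcup (cgauss_prob v)) => //.
    exact: bigcup_measurable.
  under eq_fun do rewrite E.
  by apply: ge0_emeasurable_sum => // k v _ _; exact: (measure_ge0 (cgauss_prob v)).
Qed.

End gauss_kernel.

Section density.
Context {R : realType} {d : measure_display} {T : measurableType d}.
Variables (nu mu : {measure set T -> \bar R}) (g : T -> R).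
Hypotheses (mg : measurable_fun setT g) (g0 : forall x, 0 <= g x).
Hypothesis nuE : forall A, measurable A -> nu A = (\int[mu]_(x in A) (g x)%:E)%E.
Import HBNNSimple.

Lemma ge0_integral_density (f : T -> \bar R) : measurable_fun setT f ->
  (forall x, (0 <= f x)%E) -> (\int[nu]_x f x = \int[mu]_x (f x * (g x)%:E))%E.
Proof.
move=> mf f0; have mge : measurable_fun setT (EFin \o g) by exact/measurable_EFinP.
pose f_ := nnsfun_approx measurableT mf.
have fcvg x : (f_ n x)%:E @[n --> \oo] --> f x.
  by apply: cvg_nnsfun_approx => //.
transitivity (limn (fun n => (\int[nu]_x (f_ n x)%:E)%E)).
  rewrite -monotone_convergence//.
  - by apply: eq_integral => y _; apply/esym/cvg_lim.
  - by move=> n; exact/measurable_EFinP/measurable_funP.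
  - by move=> n y _; rewrite lee_fin.
  - by move=> y _ m n mn; rewrite lee_fin; exact/lefP/nd_nnsfun_approx.
transitivity (limn (fun n => (\int[mu]_x ((f_ n x)%:E * (g x)%:E))%E)); last first.
  rewrite -monotone_convergence//.
  - apply: eq_integral => y _; apply/cvg_lim => //.
    by apply: cvgeZr.
  - move=> n; apply: emeasurable_funM; last exact: mge.
    exact/measurable_EFinP/measurable_funP.
  - by move=> n y _; rewrite mule_ge0// lee_fin.
  - move=> y _ m n mn; rewrite lee_wpmul2r ?lee_fin//; exact/lefP/nd_nnsfun_approx.
congr (limn _); apply/funext => n.
have mn r : measurable (f_ n @^-1` [set r]).
  by rewrite -(setTI (_ @^-1` _)); exact: measurable_funP.
transitivity (\sum_(k \in range (f_ n)) (k%:E * nu (f_ n @^-1` [set k])))%E.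
  under eq_integral do rewrite fimfunE -fsumEFin//.
  rewrite ge0_integral_fsum//; last 2 first.
  - by move=> y; exact/measurable_EFinP/measurable_funM.
  - by move=> y x _; rewrite nnfun_muleindic_ge0.
  apply: eq_fsbigr => r _; rewrite integralZl_indic_nnsfun// integral_indic//=.
  by rewrite setIT.
under [RHS]eq_integral.
  move=> x _; rewrite fimfunE -fsumEFin//.
  rewrite ge0_mule_fsuml//; last by move=> r; rewrite nnfun_muleindic_ge0.
  over.
rewrite ge0_integral_fsum//; last 2 first.
- move=> y; apply: emeasurable_funM; last exact: mge.
  exact/measurable_EFinP/measurable_funM.
- by move=> y x _; apply: mule_ge0; [rewrite nnfun_muleindic_ge0|rewrite lee_fin].
apply: eq_fsbigr => r /set_mem[x _ <-].
rewrite nuE// integral_mkcond -ge0_integralZl//; last 3 first.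
- by rewrite -measurable_restrictT//; exact: measurable_funTS.
- by move=> y _; apply: erestrict_ge0 => z _; rewrite lee_fin.
- by rewrite lee_fin.
apply: eq_integral => y _; rewrite /patch indicE.
by case: ifPn => // _; rewrite !(mulr1, mulr0, mule0, mul0e).
Qed.
End density.

(** * Moments and symmetry of Gaussian laws *)

Section gauss_moments.
Context {R : realType}.
Local Notation RR := (measurableTypeR R * measurableTypeR R)%type.
Local Notation lambda := (@lebesgue_measure R).

Lemma gauss_density (v : R) : 0 < v -> forall A : set (measurableTypeR R), measurable A ->
  gauss v A = (\int[lambda]_(x in A) (normal_pdf 0 (Num.sqrt v) x)%:E)%E.
Proof. by move=> v0 A mA; rewrite /gauss gt_eqF. Qed.

Lemma gauss_exp_moment (v u : R) : 0 < v -> 0 < u < 1 ->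
  (\int[gauss v]_x (expR (u / (2 * v) * x ^+ 2))%:E = ((Num.sqrt (1 - u))^-1)%:E)%E.
Proof.
move=> v0 /andP[u0 u1].
rewrite (@ge0_integral_density _ _ (measurableTypeR R) (gauss v) lambda _ (measurable_normal_pdf 0 (Num.sqrt v)) (normal_pdf_ge0 0 _) (gauss_density v0)); last 2 first.
- apply/measurable_EFinP; apply: measurableT_comp => //.
  by apply: measurable_funM => //; exact: measurable_funX.
- by move=> x; rewrite lee_fin expR_ge0.
pose a := (2 * v)^-1.
have a0 : 0 < a by rewrite invr_gt0 mulr_gt0.
have sd : gauss_sd a = Num.sqrt v.
  rewrite /gauss_sd /a invfM mulrA divff// mul1r sqrtrV ?ltW// invrK//.
have s0 : 0 < Num.sqrt (pi / a) by rewrite sqrtr_gt0 divr_gt0// pi_gt0.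
have au0 : 0 < a * (1 - u) by rewrite mulr_gt0// subr_gt0.
transitivity (\int[lambda]_x ((Num.sqrt (pi / a))^-1%:E * (expR (- (a * (1 - u) * (x - 0) ^+ 2)))%:E))%E.
  apply: eq_integral => x _; rewrite -!EFinM; congr EFin.
  have -> : normal_pdf 0 (Num.sqrt v) x = (Num.sqrt (pi / a))^-1 * expR (- (a * (x - 0) ^+ 2)).
    by rewrite (expR_normal_pdf _ _ a0) sd mulKf// gt_eqF.
  rewrite mulrCA -expRD; congr (_ * expR _).
  by rewrite /a subr0; field; rewrite gt_eqF.
rewrite ge0_integralZl//=; last first.
  apply/measurable_EFinP; apply: measurableT_comp => //; apply: measurable_funN.
  by apply: measurable_funM => //; apply: measurable_funX; exact: measurable_funB.
rewrite integral_expR_sqr// (probability_setT (normal_prob 0 (gauss_sd (a * (1 - u))))) mule1.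
rewrite -EFinM; congr EFin.
have -> : pi / (a * (1 - u)) = pi / a * (1 - u)^-1 by rewrite invfM mulrA.
have u10 : 0 <= 1 - u by rewrite subr_ge0 ltW.
have pa0 : 0 <= pi / a :> R by rewrite divr_ge0 ?pi_ge0// ltW.
by rewrite (sqrtrM _ pa0) (sqrtrV u10) mulKf// gt_eqF.
Qed.

(* E[1 + c x^2] <= E[exp (c x^2)], and the right-hand side is explicit; let c
   tend to 0. *)
Lemma gauss_second_moment (v : R) : 0 <= v ->
  (\int[gauss v]_x (x ^+ 2)%:E <= v%:E)%E.
Proof.
rewrite le_eqVlt => /predU1P[<-|v0].
  rewrite /gauss eqxx integral_dirac//=; last first.
    by apply/measurable_EFinP; exact: measurable_funX.
  by rewrite diracT mul1e expr0n.
have mX : measurable_fun setT (fun x : measurableTypeR R => (x ^+ 2)%:E).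
  by apply/measurable_EFinP; exact: measurable_funX.
set M := (\int[_]_x _)%E.
have M0 : (0 <= M)%E by apply: integral_ge0 => x _; rewrite lee_fin sqr_ge0.
have key u : 0 < u <= 1 / 2 -> (M <= (v * (1 + 2 * u))%:E)%E.
  move=> /andP[u0 u2].
  have u01 : 0 < u < 1 by rewrite u0; lra.
  have c0 : 0 < u / (2 * v) by rewrite divr_gt0// mulr_gt0.
  have H0 : ((u / (2 * v))%:E * M + 1 <= ((Num.sqrt (1 - u))^-1)%:E)%E.
    rewrite -(gauss_exp_moment v0 u01) /M -ge0_integralZl//; last 2 first.
    - by move=> x _; rewrite lee_fin sqr_ge0.
    - by rewrite lee_fin ltW.
    have -> : (1 = \int[gauss v]_x (1%:E))%E by rewrite integral_cst//= mul1e probability_setT.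
    rewrite -ge0_integralD//; last 2 first.
    - by move=> x _; rewrite mule_ge0 ?lee_fin ?sqr_ge0// ltW.
    - exact: measurable_funeM.
    apply: ge0_le_integral => //.
    - by move=> x _; rewrite adde_ge0// mule_ge0 ?lee_fin ?sqr_ge0// ltW.
    - by apply: emeasurable_funD => //; exact: measurable_funeM.
    - apply/measurable_EFinP; apply: measurableT_comp => //.
      by apply: measurable_funM => //; exact: measurable_funX.
    move=> x _; rewrite -EFinM -EFinD lee_fin addrC; exact: expR_ge1Dx.
  (* Only the term u / 2 matters: divided by the coefficient u / (2 v) it gives v, while u^2 gives 2
     u v, which vanishes with u. *)
  have hs : (Num.sqrt (1 - u))^-1 <= 1 + u / 2 + u ^+ 2.
    have s0 : 0 < Num.sqrt (1 - u) by rewrite sqrtr_gt0; lra.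
    rewrite -[leLHS]mul1r ler_pdivrMr//.
    have w0 : 0 <= 1 + u / 2 + u ^+ 2 by rewrite addr_ge0 ?sqr_ge0//; lra.
    rewrite -(@ler_pXn2r _ 2)// ?nnegrE ?mulr_ge0 ?sqrtr_ge0// exprMn sqr_sqrtr; last lra.
    rewrite expr1n -subr_ge0.
    have -> : (1 + u / 2 + u ^+ 2) ^+ 2 * (1 - u) - 1 =
      u ^+ 2 * (5 / 4 * (1 - u) - u ^+ 3) by field.
    rewrite mulr_ge0 ?sqr_ge0// subr_ge0.
    apply: (@le_trans _ _ (u * 1)); last by lra.
    by rewrite exprS ler_pM2l// exprn_ile1//; lra.
  (* Finiteness of the second moment comes out of the same inequality. *)
  have Mfin : M != +oo%E.
    apply/eqP => Moo; move: H0; rewrite Moo gt0_muley ?lte_fin// addye//; by [].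
  move: M0 Mfin H0; case: (M) => [m| |]// _ _; rewrite -EFinM -EFinD !lee_fin => H.
  have H1 : u / (2 * v) * m <= u / 2 + u ^+ 2 by lra.
  have : m <= (u / 2 + u ^+ 2) / (u / (2 * v)) by rewrite ler_pdivlMr// mulrC.
  suff -> : (u / 2 + u ^+ 2) / (u / (2 * v)) = v * (1 + 2 * u) by [].
  by field; rewrite !gt_eqF.
apply/lee_addgt0Pr => e e0.
pose u := Num.min (1 / 2) (e / (2 * v)).
have u0 : 0 < u by rewrite lt_min !divr_gt0 ?mulr_gt0.
have u2 : u <= 1 / 2 by rewrite ge_min lexx.
apply: (le_trans (key u _)); first by rewrite u0.
rewrite -EFinD lee_fin mulrDr mulr1 lerD2l.
have : u <= e / (2 * v) by rewrite ge_min lexx orbT.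
rewrite ler_pdivlMr ?mulr_gt0//; lra.
Qed.

Lemma gaussN (v : R) (A : set (measurableTypeR R)) : 0 <= v -> measurable A ->
  gauss v (-%R @^-1` A) = gauss v A.
Proof.
move=> v_ge0 mA; have mN : measurable_fun setT (-%R : measurableTypeR R -> measurableTypeR R).
  exact: measurable_funN.
have mNA : measurable (-%R @^-1` A) by rewrite -[X in measurable X]setTI; exact: mN.
rewrite /gauss; case: ifPn => v0.
  rewrite -[LHS]/(\d_(0 : measurableTypeR R) (-%R @^-1` A)).
  rewrite -[RHS]/(\d_(0 : measurableTypeR R) A).
  rewrite !diracE (_ : (_ \in -%R @^-1` A) = ((0 : measurableTypeR R) \in A))//.
  by apply/idP/idP; rewrite !inE/= oppr0.
have mf : measurable_fun setT (fun x => (normal_pdf 0 (Num.sqrt v) x)%:E).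
  by apply/measurable_EFinP; exact: measurable_normal_pdf.
have even x : normal_pdf 0 (Num.sqrt v) (- x) = normal_pdf 0 (Num.sqrt v) x.
  by rewrite normal_pdfE ?gt_eqF ?sqrtr_gt0 ?lt_def ?v0// /normal_fun !subr0 sqrrN.
rewrite /= /normal_prob.
transitivity (\int[pushforward lambda (-%R : measurableTypeR R -> measurableTypeR R)]_(x in A) (normal_pdf 0 (Num.sqrt v) x)%:E)%E.
  rewrite ge0_integral_pushforward//; last first.
    by move=> x _; rewrite lee_fin normal_pdf_ge0.
    exact: measurable_funTS.
  by apply: eq_integral => x _ /=; rewrite even.
by apply: eq_measure_integral => B mB _; exact: lebesgue_measureN.
Qed.

End gauss_moments.

Section cgauss_moments.
Context {R : realType}.
Local Notation RR := (measurableTypeR R * measurableTypeR R)%type.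

Definition oppRR (z : RR) : RR := (- z.1, - z.2).

Lemma measurable_oppRR : measurable_fun setT oppRR.
Proof.
by apply: measurable_fun_pair; apply: measurableT_comp => //; exact: measurable_funN.
Qed.

Lemma cgauss_ge0_integralN (v : R) (F : RR -> \bar R) : 0 <= v -> measurable_fun setT F ->
  (forall z, (0 <= F z)%E) ->
  (\int[cgauss_prob v]_z F (oppRR z) = \int[cgauss_prob v]_z F z)%E.
Proof.
move=> v0 mF F0; have v20 : 0 <= v / 2 by rewrite divr_ge0.
have mN : measurable_fun setT (-%R : measurableTypeR R -> measurableTypeR R).
  exact: measurable_funN.
rewrite /cgauss_prob /= fubini_tonelli1//; last exact: measurableT_comp measurable_oppRR.
rewrite fubini_tonelli1// /fubini_F /oppRR/=.
transitivity (\int[gauss (v / 2)]_x (\int[gauss (v / 2)]_y F ((- x)%R, y)))%E.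
  apply: eq_integral => x _.
  have H := @ge0_integral_law R _ _ (measurableTypeR R) (measurableTypeR R)
    (gauss (v / 2)) -%R mN (gauss (v / 2)) (fun A mA => gaussN v20 mA)
    (fun y => F ((- x)%R, y)).
  rewrite H//; exact: measurableT_comp.
have H := @ge0_integral_law R _ _ (measurableTypeR R) (measurableTypeR R)
    (gauss (v / 2)) -%R mN (gauss (v / 2)) (fun A mA => gaussN v20 mA)
    (fun x => (\int[gauss (v / 2)]_y F (x, y))%E).
rewrite H//; first exact: measurable_fun_fubini_tonelli_F.
by move=> x; exact: integral_ge0.
Qed.

Lemma integral_cst_prob d (T : measurableType d) (mu : probability T R) (k : \bar R) :
  (\int[mu]_x k)%E = k.
Proof.
rewrite -[LHS]/(\int[mu]_x cst k x)%E integral_cst// [X in (_ * X)%E](_ : _ = 1%E) ?mule1//.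
exact: probability_setT.
Qed.

Lemma cgauss_second_moment (v : R) : 0 <= v ->
  (\int[cgauss_prob v]_z (z.1 ^+ 2 + z.2 ^+ 2)%:E <= v%:E)%E.
Proof.
move=> v0; have v20 : 0 <= v / 2 by rewrite divr_ge0.
have m1 : measurable_fun setT (fun x : measurableTypeR R => (x ^+ 2)%:E).
  by apply/measurable_EFinP; exact: measurable_funX.
rewrite /cgauss_prob /= fubini_tonelli1//; last 2 first.
- apply/measurable_EFinP; apply: measurable_funD; apply: measurable_funX => //.
- by move=> z; rewrite lee_fin addr_ge0 ?sqr_ge0.
rewrite /fubini_F/=.
under eq_integral => x _.
  under eq_integral do rewrite EFinD.
  rewrite ge0_integralD//; [|by move=> y _; rewrite lee_fin sqr_ge0..].
  rewrite integral_cst_prob; over.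
rewrite ge0_integralD//; last 2 first.
- by move=> x _; rewrite lee_fin sqr_ge0.
- by move=> x _; apply: integral_ge0 => y _; rewrite lee_fin sqr_ge0.
rewrite integral_cst_prob.
by rewrite [leRHS](_ : _ = (v / 2)%:E + (v / 2)%:E)%E ?leeD ?gauss_second_moment// -EFinD -splitr.
Qed.

End cgauss_moments.

(** * Independence of the coherence blocks *)

Lemma generated_bigcap (T : Type) (G : set (set T)) (J : finType) (A : J -> set T) :
  (forall a, <<s G >> (A a)) -> <<s G >> (\bigcap_(a in [set: J]) A a).
Proof.
move=> GA; have [s0 sC sU] := smallest_sigma_algebra setT G.
(* The axioms of a sigma-algebra speak of complements and countable unions; the finite family is
   spread over the naturals by [insub] and padded with [set0]. *)
have -> : \bigcap_(a in [set: J]) A a = setT `\` \bigcup_n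
    (if insub n is Some i then setT `\` A (enum_val (i : 'I_#|J|)) else set0).
  apply/seteqP; split => x /=.
    move=> h; split=> // -[n _]; case: insubP => // i _ _ [_]; apply; exact: h.
  move=> [_ h] a _; apply: contrapT => nA; apply: h; exists (enum_rank a) => //.
  by rewrite valK enum_rankK.
by apply: (sC); apply: sU => n; case: insubP => [i _ _|_] //; exact: (sC).
Qed.

Section finite_families.
Context {R : realType} {d : measure_display} {Omega : measurableType d}.
Variable P : probability Omega R.

Lemma bigcap_enum_val (J : finType) (A : J -> set Omega) :
  \bigcap_(a in [set: 'I_#|J|]) A (enum_val a) = \bigcap_(a in [set: J]) A a.
Proof.
apply/seteqP; split => w h a _; last exact: h.
by rewrite -(enum_rankK a); exact: h.
Qed.

Lemma prode_enum_val (J : finType) (F : J -> \bar R) :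
  (\prod_(a < #|J|) F (enum_val a) = \prod_(a : J) F a)%E.
Proof. by rewrite -(big_enum_val F); apply: eq_bigl. Qed.

Lemma mutually_independent_fin (I : Type) (D : set I) (F : I -> set (set Omega))
    (J : finType) (s : J -> I) (A : J -> set Omega) :
  mutually_independent P D F -> injective s ->
  (forall a, D (s a) /\ F (s a) (A a)) ->
  P (\bigcap_(a in [set: J]) A a) = (\prod_(a : J) P (A a))%E.
Proof.
move=> mi sI sA.
have := mi #|J| (fun a => s (enum_val a)) (fun a => A (enum_val a)).
rewrite bigcap_enum_val (prode_enum_val (fun a => P (A a))); apply => //.
by move=> a b /sI /enum_val_inj.
Qed.

Lemma bigcap_bool (J : finType) (A A' : J -> set Omega) :
  \bigcap_(a in [set: bool * J]) (if a.1 then A a.2 else A' a.2) =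
  (\bigcap_(a in [set: J]) A a) `&` (\bigcap_(a in [set: J]) A' a).
Proof.
apply/seteqP; split => w.
  by move=> h; split => a _; [exact: (h (true, a))|exact: (h (false, a))].
by move=> [h h'] [[] a] _; [exact: h|exact: h'].
Qed.

Lemma prode_bool (J : finType) (F F' : J -> \bar R) :
  (\prod_(a : bool * J) (if a.1 then F a.2 else F' a.2) =
   (\prod_(a : J) F a) * (\prod_(a : J) F' a))%E.
Proof.
by rewrite -(pair_bigA _ (fun (b : bool) a => if b then F a else F' a))/= big_bool.
Qed.

Lemma emeasurable_prode d' (T : measurableType d') (J : Type) (s : seq J)
    (F : J -> T -> \bar R) : (forall a, measurable_fun setT (F a)) ->
  measurable_fun setT (fun x => (\prod_(a <- s) F a x)%E).
Proof.
move=> mF; elim: s => [|a s IH].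
  by under eq_fun do rewrite big_nil; exact: measurable_cst.
by under eq_fun do rewrite big_cons; exact: emeasurable_funM.
Qed.

Lemma prode_ge0' (J : Type) (s : seq J) (F : J -> \bar R) :
  (forall a, (0 <= F a)%E) -> (0 <= \prod_(a <- s) F a)%E.
Proof.
by move=> F0; elim/big_rec : _ => // a x _ x0; exact: mule_ge0.
Qed.

(** The sources of the two blocks form one injective family indexed by bool * J, so that mutual
    independence applies once; stationarity then moves each factor to block 0. *)
Lemma two_block_prob (I : Type) (D : set I) (F : I -> set (set Omega))
    (U : Type) (J : finType) (src : nat -> J -> I) (v : nat -> J -> Omega -> U)
    (mU : set (set U)) b b' (A A' : J -> set U) :
  mutually_independent P D F ->
  (forall b b' a a', src b a = src b' a' -> b = b' /\ a = a') ->
  (forall b a, D (src b a)) ->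
  (forall b a B, mU B -> F (src b a) (v b a @^-1` B)) ->
  (forall b a B, mU B -> P (v b a @^-1` B) = P (v 0%N a @^-1` B)) ->
  (forall a, mU (A a)) -> (forall a, mU (A' a)) -> b != b' ->
  P ((\bigcap_(a in [set: J]) (v b a @^-1` A a)) `&`
     (\bigcap_(a in [set: J]) (v b' a @^-1` A' a))) =
  ((\prod_(a : J) P (v 0%N a @^-1` A a)) * (\prod_(a : J) P (v 0%N a @^-1` A' a)))%E.
Proof.
move=> mi sI sD sF vP mA mA' bb'.
rewrite -bigcap_bool -prode_bool.
rewrite (mutually_independent_fin (s := fun a => src (if a.1 then b else b') a.2) mi).
- by apply: eq_bigr => -[[] a] _ /=; apply: vP.
- move=> [[] a] [[] a'] /= /sI[] => [_ ->//|bb|bb|_ ->//].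
    by rewrite bb eqxx in bb'.
  by rewrite bb eqxx in bb'.
- by move=> [[] a] /=; split => //; apply: sF.
Qed.

End finite_families.

Section block_coordinates.
Context {R : realType} {L K N B T : nat}.
Context {d : measure_display} {Omega : measurableType d}.
Variables (P : probability Omega R).
Variables (pr : uplink_params R L K) (X : uplink_rvs R L K N Omega).
Hypothesis ok : uplink_params_ok (B := B) (T := T) pr.
Hypothesis mod : uplink_model (B := B) (T := T) P pr X.
Hypothesis fp : full_power (T := T) P pr X.
Hypothesis T_gt0 : (0 < T)%N.
Variable j : 'I_L.
Local Notation RR := (measurableTypeR R * measurableTypeR R)%type.

Definition chan_idx : finType := ('I_L * 'I_K * 'I_N)%type.
Definition other_idx : finType :=
  (('I_N + 'I_N * 'I_T.-1) + ('I_L * 'I_K * 'I_(T - B) + 'I_N * 'I_T))%type.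
Definition dist_idx : finType := ('I_N * 'I_T)%type.
Definition block_idx : finType := ((chan_idx + other_idx) + dist_idx)%type.

Definition chan_src (b : nat) (c : chan_idx) : source L K N :=
  Channel b j c.1.1 c.1.2 c.2.

Definition other_src (b : nat) (o : other_idx) : source L K N :=
  match o with
  | inl (inl n) => FirstPhase L K b n
  | inl (inr (n, i)) => Innovation L K b n i.+1
  | inr (inl (l, m, i)) => Data N b l m (B + i).+1
  | inr (inr (n, i)) => Noise L K b n i.+1
  end.

Definition chan_val (b : nat) (c : chan_idx) (w : Omega) : RR :=
  reim (channel X b j c.1.1 c.1.2 w c.2 0).

(** Real sources occupy the first component, so that all coordinates of a block live in the same
    space R^2. *)
Definition other_val (b : nat) (o : other_idx) (w : Omega) : RR :=
  match o with
  | inl (inl n) => (phase X b j n 1 w, 0)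
  | inl (inr (n, i)) => (innovation X b j n i.+1 w, 0)
  | inr (inl (l, m, i)) => reim (symbol X b l m (B + i).+1 w)
  | inr (inr (n, i)) => reim (noise X b j i.+1 w n 0)
  end.

Definition dist_val (b : nat) (a : dist_idx) (w : Omega) : RR :=
  reim (distortion X b j a.2.+1 w a.1 0).

Definition block_val (b : nat) (i : block_idx) (w : Omega) : RR :=
  match i with
  | inl (inl c) => chan_val b c w
  | inl (inr o) => other_val b o w
  | inr a => dist_val b a w
  end.

Definition chan_vec b w : cspace (R := R) chan_idx := mkc (fun c => chan_val b c w).
Definition block_vec b w : cspace (R := R) block_idx := mkc (fun i => block_val b i w).

Let leBT : (B <= T)%N. Proof. exact: pilot_len_le ok. Qed.

Lemma other_src_in_range b o : in_range (B := B) (T := T) (other_src b o) /\ ~ is_channel (other_src b o).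
Proof.
move: o => [[n|[n i]]|[[[l m] i]|[n i]]] //=; split => //=.
- by have := ltn_ord i; lia.
- by have := ltn_ord i; lia.
Qed.

Lemma chan_val_meas b c : measurable_fun setT (chan_val b c).
Proof. exact: (channel_meas mod b j c.1.1 c.1.2 c.2). Qed.

Lemma other_val_meas b o : measurable_fun setT (other_val b o).
Proof.
move: o => [[n|[n i]]|[[[l m] i]|[n i]]] /=.
- apply: measurable_fun_pair => //; apply: (phase_meas mod); lia.
- have iT := ltn_ord i; apply: measurable_fun_pair => //.
  by apply: measurable_funB; apply: (phase_meas mod); lia.
- by have iT := ltn_ord i; apply: (symbol_meas mod); lia.
- by have iT := ltn_ord i; apply: (noise_meas mod); lia.
Qed.

Lemma dist_val_meas b a : measurable_fun setT (dist_val b a).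
Proof. by have aT := ltn_ord a.2; apply: (distortion_meas mod); lia. Qed.

Lemma block_val_meas b i : measurable_fun setT (block_val b i).
Proof.
move: i => [[c|o]|a]; [exact: chan_val_meas|exact: other_val_meas|exact: dist_val_meas].
Qed.

Lemma chan_vec_meas b : measurable_fun setT (chan_vec b).
Proof. by apply: measurable_mkc => c; exact: chan_val_meas. Qed.

Lemma block_vec_meas b : measurable_fun setT (block_vec b).
Proof. by apply: measurable_mkc => i; exact: block_val_meas. Qed.

Lemma chan_val_events b c (A : set RR) : measurable A ->
  source_events X j (chan_src b c) (chan_val b c @^-1` A).
Proof. by move=> mA; exists A. Qed.

Lemma measurable_real_slice (A : set RR) : measurable A ->
  measurable ((fun x : measurableTypeR R => (x, 0) : RR) @^-1` A).
Proof. by move=> mA; apply: measurable_preimage => //; exact: measurable_fun_pair. Qed.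

Lemma real_slice (f : Omega -> measurableTypeR R) (A : set RR) : measurable A ->
  revents f ((fun w => (f w, 0) : RR) @^-1` A).
Proof.
move=> mA; exists ((fun x : measurableTypeR R => (x, 0) : RR) @^-1` A) => //.
exact: measurable_real_slice.
Qed.

Lemma other_val_events b o (A : set RR) : measurable A ->
  source_events X j (other_src b o) (other_val b o @^-1` A).
Proof.
move=> mA; move: o => [[n|[n i]]|[[[l m] i]|[n i]]] /=.
- exact: real_slice.
- exact: real_slice.
- by exists A.
- by exists A.
Qed.

Lemma chan_val_law b c (A : set RR) : measurable A ->
  P (chan_val b c @^-1` A) = P (chan_val 0%N c @^-1` A).
Proof. by move=> mA; rewrite !(channel_law mod). Qed.

Lemma other_val_law b o (A : set RR) : measurable A ->
  P (other_val b o @^-1` A) = P (other_val 0%N o @^-1` A).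
Proof.
move=> mA; move: o => [[n|[n i]]|[[[l m] i]|[n i]]] /=.
- exact: (first_phase_law mod b j n (measurable_real_slice mA)).
- have iT := ltn_ord i.
  have it : (1 <= i.+1 < T)%N by lia.
  exact: etrans (innovation_law mod b j n it (measurable_real_slice mA))
    (esym (innovation_law mod 0 j n it (measurable_real_slice mA))).
- have iT := ltn_ord i.
  have it : (B < (B + i).+1 <= T)%N by lia.
  have it' : (1 <= (B + i).+1 <= T)%N by lia.
  have := data_law mod b l m it mA; have := data_law mod 0 l m it mA.
  by rewrite !(fp _ _ _ it') => <-.
- have iT := ltn_ord i.
  have it : (1 <= i.+1 <= T)%N by lia.
  exact: etrans (noise_law mod b j n it mA) (esym (noise_law mod 0 j n it mA)).
Qed.


Lemma chan_src_inj b b' c c' : chan_src b c = chan_src b' c' -> b = b' /\ c = c'.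
Proof. by case: c c' => [[l m] n] [[l' m'] n'] [-> -> -> ->]. Qed.

Lemma other_src_inj b b' o o' : other_src b o = other_src b' o' -> b = b' /\ o = o'.
Proof.
move: o o' => [[n|[n i]]|[[[l m] i]|[n i]]] [[n'|[n' i']]|[[[l' m'] i']|[n' i']]] //=.
- by move=> [-> ->].
- by move=> [-> -> /val_inj ->].
- by move=> [-> -> -> ii]; split => //; congr (inr (inl (_, _))); apply: val_inj => /=; lia.
- by move=> [-> -> /val_inj ->].
Qed.

Lemma chan_vec_cyl b (A : chan_idx -> set RR) :
  chan_vec b @^-1` cyl A = \bigcap_(c in [set: chan_idx]) (chan_val b c @^-1` A c).
Proof.
apply/seteqP; split => w h c; first by move=> _; have := h c; rewrite crd_mkc.
by rewrite crd_mkc; exact: h.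
Qed.

Lemma block_vec_cyl b (A : block_idx -> set RR) :
  block_vec b @^-1` cyl A =
  ((\bigcap_(c in [set: chan_idx]) (chan_val b c @^-1` A (inl (inl c)))) `&`
   (\bigcap_(o in [set: other_idx]) (other_val b o @^-1` A (inl (inr o))))) `&`
   (\bigcap_(a in [set: dist_idx]) (dist_val b a @^-1` A (inr a))).
Proof.
apply/seteqP; split => w.
  by move=> h; split; [split|] => i _; [have := h (inl (inl i))|have := h (inl (inr i))|have := h (inr i)]; rewrite crd_mkc.
by move=> [[h1 h2] h3] [[c|o]|a]; rewrite crd_mkc; [exact: h1|exact: h2|exact: h3].
Qed.

Lemma chan_vec_prob2 b b' (A A' : chan_idx -> set RR) :
  (forall c, measurable (A c)) -> (forall c, measurable (A' c)) -> b != b' ->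
  P (chan_vec b @^-1` cyl A `&` chan_vec b' @^-1` cyl A') =
  ((\prod_(c : chan_idx) P (chan_val 0 c @^-1` A c)) *
   (\prod_(c : chan_idx) P (chan_val 0 c @^-1` A' c)))%E.
Proof.
move=> mA mA' bb'; rewrite !chan_vec_cyl.
apply: (@two_block_prob _ _ _ _ _ _ _ RR _ chan_src chan_val measurable _ _ _ _ (sources_indep (j := j) mod)) => //.
- exact: chan_src_inj.
- by move=> *; exact: chan_val_events.
- by move=> *; exact: chan_val_law.
Qed.

Lemma other_val_prob2 b b' (A A' : other_idx -> set RR) :
  (forall c, measurable (A c)) -> (forall c, measurable (A' c)) -> b != b' ->
  P ((\bigcap_(o in [set: other_idx]) (other_val b o @^-1` A o)) `&`
     (\bigcap_(o in [set: other_idx]) (other_val b' o @^-1` A' o))) =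
  ((\prod_(o : other_idx) P (other_val 0 o @^-1` A o)) *
   (\prod_(o : other_idx) P (other_val 0 o @^-1` A' o)))%E.
Proof.
move=> mA mA' bb'.
apply: (@two_block_prob _ _ _ _ _ _ _ RR _ other_src other_val measurable _ _ _ _ (sources_indep (j := j) mod)) => //.
- exact: other_src_inj.
- by move=> b'' o; have [] := other_src_in_range b'' o.
- by move=> *; exact: other_val_events.
- by move=> *; exact: other_val_law.
Qed.

Let chan_vec0_mixin := isMeasurableFun.Build _ _ _ _ _ (chan_vec_meas 0).
Let chan_vec0 : {mfun Omega >-> cspace (R := R) chan_idx} := HB.pack (chan_vec 0) chan_vec0_mixin.
Definition chan_law : probability (cspace (R := R) chan_idx) R :=
  [the probability _ _ of distribution P chan_vec0].

Lemma chan_vec_indep b b' A A' : b != b' -> measurable A -> measurable A' ->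
  P (chan_vec b @^-1` A `&` chan_vec b' @^-1` A') = (chan_law A * chan_law A')%E.
Proof.
move=> bb'; move: A A'.
apply: (indep_generated (chan_vec_meas b) (chan_vec_meas b')
  (measurable_cspaceE _) (@cylinders_setI _ _) (@cylindersT _ _)
  (measurable_cspaceE _) (@cylinders_setI _ _) (@cylindersT _ _)).
have law0 A : (forall c, measurable (A c)) ->
    chan_law (cyl A) = (\prod_(c : chan_idx) P (chan_val 0 c @^-1` A c))%E.
  move=> mA; rewrite -[LHS]/(P (chan_vec 0 @^-1` cyl A)).
  (* The law of one block is read off the two-block formula with the second block unconstrained. *)
  have := @chan_vec_prob2 0 1 A (fun=> setT) mA (fun=> measurableT) isT.
  rewrite (_ : chan_vec 1 @^-1` _ = setT) ?setIT; last by apply/seteqP; split.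
  move=> ->; rewrite [X in (_ * X)%E]big1 ?mule1// => c _.
  by rewrite preimage_setT probability_setT.
by move=> _ _ [A mA ->] [A' mA' ->]; rewrite chan_vec_prob2// !law0.
Qed.


Definition dvar (n : 'I_N) (h : cspace (R := R) chan_idx) : R :=
  kappa pr ^+ 2 * \sum_(l < L) \sum_(m < K)
    pmax pr l m * ((crd h (l, m, n)).1 ^+ 2 + (crd h (l, m, n)).2 ^+ 2).

Lemma distortion_varE b n t w : (1 <= t <= T)%N ->
  distortion_var P pr X b j n t w = dvar n (chan_vec b w).
Proof.
move=> tT; congr (_ * _); apply: eq_bigr => l _; apply: eq_bigr => m _.
by rewrite (fp _ _ _ tT) crd_mkc.
Qed.

Lemma measurable_dvar n : measurable_fun setT (dvar n).
Proof.
apply: measurable_funM => //; apply: measurable_sum => l; apply: measurable_sum => m.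
apply: measurable_funM => //; apply: measurable_funD; apply: measurable_funX;
  by apply: measurableT_comp; [|exact: measurable_crd].
Qed.

Definition dist_factor (A : dist_idx -> set RR) (h : cspace (R := R) chan_idx) : \bar R :=
  (\prod_(a : dist_idx) cgauss (dvar a.1 h) (A a))%E.

Lemma cgauss_ge0 (x : R) (A : set RR) : (0 <= cgauss x A)%E.
Proof. exact: (measure_ge0 (cgauss_prob x)). Qed.

Lemma dist_factor_ge0 A h : (0 <= dist_factor A h)%E.
Proof. by apply: prode_ge0' => a; exact: cgauss_ge0. Qed.

Lemma measurable_dist_factor A : (forall a, measurable (A a)) ->
  measurable_fun setT (dist_factor A).
Proof.
move=> mA; apply: emeasurable_prode => a.
exact: (measurableT_comp (measurable_cgauss (mA a)) (measurable_dvar a.1)).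
Qed.

Definition chan_part (A : block_idx -> set RR) : set (cspace (R := R) chan_idx) :=
  cyl (fun c => A (inl (inl c))).

(** Given the channels [h], the probability that channels and distortion lie in their sides of the
    rectangle. *)
Definition chan_dens (A : block_idx -> set RR) (h : cspace (R := R) chan_idx) : \bar R :=
  ((\1_(chan_part A) h)%:E * dist_factor (fun a => A (inr a)) h)%E.

Lemma chan_dens_ge0 A h : (0 <= chan_dens A h)%E.
Proof. by rewrite mule_ge0 ?dist_factor_ge0// lee_fin. Qed.

Lemma measurable_chan_dens A : (forall i, measurable (A i)) ->
  measurable_fun setT (chan_dens A).
Proof.
move=> mA; apply: emeasurable_funM; last exact: measurable_dist_factor.
by apply/measurable_EFinP; apply: measurable_indic; exact: measurable_cyl.
Qed.

(** The value that [distortion_law] gives to a rectangle of one block: the sources other than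
    channels split off as a product, the distortion is averaged over the channels. *)
Definition rect_prob (A : block_idx -> set RR) : \bar R :=
  ((\prod_(o : other_idx) P (other_val 0 o @^-1` A (inl (inr o)))) *
   \int[chan_law]_h chan_dens A h)%E.

Lemma generated_chan b (A : block_idx -> set RR) : (forall i, measurable (A i)) ->
  generated X j (@is_channel L K N)
    (\bigcap_(c in [set: chan_idx]) (chan_val b c @^-1` A (inl (inl c)))).
Proof.
move=> mA; apply: generated_bigcap => c; apply: sub_sigma_algebra.
by exists (chan_src b c) => //; exact: chan_val_events.
Qed.

Lemma generated_other b (A : block_idx -> set RR) : (forall i, measurable (A i)) ->
  generated X j (in_range (B := B) (T := T) `\` @is_channel L K N)
    (\bigcap_(o in [set: other_idx]) (other_val b o @^-1` A (inl (inr o)))).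
Proof.
move=> mA; apply: generated_bigcap => o; apply: sub_sigma_algebra.
by exists (other_src b o); [exact: other_src_in_range|exact: other_val_events].
Qed.

(** [distortion_law] is applied to both blocks at once. Its integrand is a function of the channels
    of [b] times a function of those of [b'], and these are independent. *)
Lemma block_vec_rect b b' (A A' : block_idx -> set RR) :
  (forall i, measurable (A i)) -> (forall i, measurable (A' i)) -> b != b' ->
  P (block_vec b @^-1` cyl A `&` block_vec b' @^-1` cyl A') =
  (rect_prob A * rect_prob A')%E.
Proof.
move=> mA mA' bb'; rewrite !block_vec_cyl.
set E1 := \bigcap_(c in _) (chan_val b c @^-1` _).
set F1 := \bigcap_(o in _) (other_val b o @^-1` _).
set D1 := \bigcap_(a in _) (dist_val b a @^-1` _).
set E2 := \bigcap_(c in _) (chan_val b' c @^-1` _).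
set F2 := \bigcap_(o in _) (other_val b' o @^-1` _).
set D2 := \bigcap_(a in _) (dist_val b' a @^-1` _).
(* Grouped by kind rather than by block: channel events, other sources, distortion, as
   [distortion_law] expects. *)
have -> : (E1 `&` F1 `&` D1) `&` (E2 `&` F2 `&` D2) =
    ((E1 `&` E2) `&` (F1 `&` F2)) `&` (D1 `&` D2).
  by rewrite setIACA [E1 `&` F1 `&` _]setIACA.
pose s0 (a : bool * dist_idx) : nat * 'I_N * nat :=
  ((if a.1 then b else b'), a.2.1, (a.2.2).+1).
pose A0 (a : bool * dist_idx) := if a.1 then A (inr a.2) else A' (inr a.2).
have s0I : injective s0.
  move=> [[] [n i]] [[] [n' i']] [] => [-> /val_inj ->//|bb _ _|bb _ _|-> /val_inj ->//].
    by rewrite bb eqxx in bb'.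
  by rewrite bb eqxx in bb'.
have s0E (a : bool * dist_idx) : (1 <= (s0 a).2 <= T)%N by have := ltn_ord a.2.2.
have -> : D1 `&` D2 = \bigcap_(a in [set: 'I_#|{: bool * dist_idx}|])
   [set w | A0 (enum_val a) (reim (distortion X (s0 (enum_val a)).1.1 j (s0 (enum_val a)).2 w (s0 (enum_val a)).1.2 0))].
  rewrite (bigcap_enum_val (fun a => [set w | A0 a (reim (distortion X (s0 a).1.1 j (s0 a).2 w (s0 a).1.2 0))])).
  rewrite -bigcap_bool; apply: eq_bigcapr => -[[] a] _ //.
have gE : generated X j (@is_channel L K N) (E1 `&` E2).
  apply: (@measurableI _ (g_sigma_algebraType _)); exact: generated_chan.
have gF : generated X j (in_range (B := B) (T := T) `\` @is_channel L K N) (F1 `&` F2).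
  apply: (@measurableI _ (g_sigma_algebraType _)); exact: generated_other.
have sI : injective (fun a : 'I_#|{: bool * dist_idx}| => s0 (enum_val a)).
  by move=> a a' /s0I /enum_val_inj.
have mA0 a : measurable (A0 a) by rewrite /A0; case: ifP.
rewrite (distortion_law mod (j := j) (A := fun a => A0 (enum_val a)) sI _ gE gF); last first.
  by move=> a; split; [exact: s0E|exact: mA0].
rewrite other_val_prob2//.
have -> : (\int[P]_(w in E1 `&` E2) \prod_(a < #|{: bool * dist_idx}|)
    cgauss (distortion_var P pr X (s0 (enum_val a)).1.1 j (s0 (enum_val a)).1.2 (s0 (enum_val a)).2 w) (A0 (enum_val a)) =
    \int[P]_w (chan_dens A (chan_vec b w) * chan_dens A' (chan_vec b' w)))%E.
  rewrite integral_mkcond; apply: eq_integral => w _.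
  have iE b0 (A1 : block_idx -> set RR) : \1_(chan_part A1) (chan_vec b0 w) =
      \1_(\bigcap_(c in [set: chan_idx]) (chan_val b0 c @^-1` A1 (inl (inl c)))) w :> R.
    by rewrite !indicE -chan_vec_cyl; congr (nat_of_bool _)%:R; apply/idP/idP; rewrite !inE.
  rewrite /chan_dens !iE -/E1 -/E2 muleACA -EFinM.
  have -> : \1_E1 w * \1_E2 w = \1_(E1 `&` E2) w :> R by rewrite indicI.
  rewrite patchE indicE.
  case: ifPn => wE; last by rewrite mul0e.
  rewrite mul1e (prode_enum_val (fun a => cgauss (distortion_var P pr X (s0 a).1.1 j (s0 a).1.2 (s0 a).2 w) (A0 a))).
  rewrite /dist_factor -prode_bool; apply: eq_bigr => -[[] a] _ /=.
    by rewrite distortion_varE// (s0E (true, a)).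
  by rewrite distortion_varE// (s0E (false, a)).
rewrite (ge0_integral_indep (chan_vec_meas b) (chan_vec_meas b')
  (fun C D mC mD => chan_vec_indep bb' mC mD)
  (F := fun hh => (chan_dens A hh.1 * chan_dens A' hh.2)%E)); last 2 first.
- apply: emeasurable_funM; apply: measurableT_comp => //; exact: measurable_chan_dens.
- by move=> hh; rewrite mule_ge0 ?chan_dens_ge0.
under eq_integral => h _.
  rewrite /= ge0_integralZl//; last 3 first.
  - exact: measurable_chan_dens.
  - by move=> h' _; exact: chan_dens_ge0.
  - exact: chan_dens_ge0.
  over.
rewrite ge0_integralZr//; last 3 first.
- exact: measurable_chan_dens.
- by move=> h' _; exact: chan_dens_ge0.
- by apply: integral_ge0 => h' _; exact: chan_dens_ge0.
by rewrite muleACA.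
Qed.

Lemma rect_probT : rect_prob (fun=> setT) = 1%E.
Proof.
rewrite /rect_prob big1 ?mul1e; last first.
  by move=> o _; rewrite preimage_setT probability_setT.
rewrite -[RHS](integral_cst_prob chan_law); apply: eq_integral => h _.
rewrite /chan_dens indicE mem_set ?mul1e//.
by rewrite /dist_factor big1// => a _; exact: (probability_setT (cgauss_prob _)).
Qed.

Let block_vec0_mixin := isMeasurableFun.Build _ _ _ _ _ (block_vec_meas 0).
Let block_vec0 : {mfun Omega >-> cspace (R := R) block_idx} := HB.pack (block_vec 0) block_vec0_mixin.
Definition block_law : probability (cspace (R := R) block_idx) R :=
  [the probability _ _ of distribution P block_vec0].

Lemma block_law_cyl A : (forall i, measurable (A i)) -> block_law (cyl A) = rect_prob A.
Proof.
move=> mA; rewrite -[LHS]/(P (block_vec 0 @^-1` cyl A)).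
have := @block_vec_rect 0 1 A (fun=> setT) mA (fun=> measurableT) isT.
rewrite (_ : block_vec 1 @^-1` _ = setT) ?setIT; last by apply/seteqP; split.
by move=> ->; rewrite rect_probT mule1.
Qed.

Lemma block_vec_indep b b' A A' : b != b' -> measurable A -> measurable A' ->
  P (block_vec b @^-1` A `&` block_vec b' @^-1` A') = (block_law A * block_law A')%E.
Proof.
move=> bb'; move: A A'.
apply: (indep_generated (block_vec_meas b) (block_vec_meas b')
  (measurable_cspaceE _) (@cylinders_setI _ _) (@cylindersT _ _)
  (measurable_cspaceE _) (@cylinders_setI _ _) (@cylindersT _ _)).
by move=> _ _ [A mA ->] [A' mA' ->]; rewrite block_vec_rect// !block_law_cyl.
Qed.

End block_coordinates.

(** * Data symbols and receiver noise against the rest of their block *)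

Section coordinate_independence.
Context {R : realType} {L K N B T : nat}.
Context {d : measure_display} {Omega : measurableType d}.
Variables (P : probability Omega R).
Variables (pr : uplink_params R L K) (X : uplink_rvs R L K N Omega).
Hypothesis ok : uplink_params_ok (B := B) (T := T) pr.
Hypothesis mod : uplink_model (B := B) (T := T) P pr X.
Hypothesis fp : full_power (T := T) P pr X.
Hypothesis T_gt0 : (0 < T)%N.
Variable j : 'I_L.
Local Notation RR := (measurableTypeR R * measurableTypeR R)%type.
Local Notation Idx := (@block_idx L K N B T).
Local Notation ZZ := (cspace (R := R) Idx).
Local Notation mu := (block_law ok mod T_gt0 j).

(* The coordinates entering the output of a slot linearly: data symbols and
   receiver noise. *)
Definition free_idx : finType := ('I_L * 'I_K * 'I_(T - B) + 'I_N * 'I_T)%type.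

Definition free_crd (s : free_idx) : Idx := inl (inr (inr s)).

Definition free_var (s : free_idx) : R :=
  match s with inl (l, m, _) => pmax pr l m | inr _ => sigma2 pr * xi pr end.

Lemma free_law s (A : set RR) : measurable A ->
  P (other_val X j 0 (inr s) @^-1` A) = cgauss (free_var s) A.
Proof.
have BT := pilot_len_le ok.
move=> mA; case: s => [[[l m] i]|[n i]]; have iT := ltn_ord i.
  have it : (B < (B + i).+1 <= T)%N by lia.
  have it' : (1 <= (B + i).+1 <= T)%N by lia.
  by have := data_law mod 0 l m it mA; rewrite (fp _ _ _ it').
have it : (1 <= i.+1 <= T)%N by lia.
exact: (noise_law mod 0 j n it mA).
Qed.

(* All the coordinates but [s], kept in the same space. *)
Definition kill (s : free_idx) (z : ZZ) : ZZ :=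
  mkc (fun i => if i == free_crd s then (0, 0) else crd z i).

Lemma crd_kill s z i : crd (kill s z) i = if i == free_crd s then (0, 0) else crd z i.
Proof. by rewrite crd_mkc. Qed.

Lemma measurable_kill s : measurable_fun setT (kill s).
Proof.
by apply: measurable_mkc => i; case: eqP => _ //; exact: measurable_crd.
Qed.

Let kill_mixin s := isMeasurableFun.Build _ _ _ _ _ (measurable_kill s).
Let kill_pack s : {mfun ZZ >-> ZZ} := HB.pack (kill s) (kill_mixin s).
Definition kill_law s : probability ZZ R :=
  [the probability _ _ of distribution mu (kill_pack s)].

Definition upd (A : Idx -> set RR) s (C : set RR) (i : Idx) : set RR :=
  if i == free_crd s then C else A i.

Lemma upd_meas (A : Idx -> set RR) s C : (forall i, measurable (A i)) -> measurable C ->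
  forall i, measurable (upd A s C i).
Proof. by move=> mA mC i; rewrite /upd; case: ifP. Qed.

(** A data or noise coordinate contributes one factor of the product and does not occur in the
    integral over the channels. Hence it is independent of everything else in its block, distortion
    included. *)
Lemma rect_prob_upd (A : Idx -> set RR) s C : measurable C ->
  rect_prob mod j (upd A s C) =
  (cgauss (free_var s) C * rect_prob mod j (upd A s setT))%E.
Proof.
move=> mC; rewrite /rect_prob muleA; congr (_ * _)%E.
rewrite (bigD1 (inr s))//= [in RHS](bigD1 (inr s))//= muleA.
congr (_ * _)%E.
  rewrite /upd eqxx free_law// preimage_setT probability_setT mule1//.
apply: eq_bigr => o os; congr (P (_ @^-1` _)); rewrite /upd.
by case: eqP => // -[oo]; rewrite oo eqxx in os.
Qed.

Lemma free_kill_indep s (A : set RR) (C : set ZZ) : measurable A -> measurable C ->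
  mu ((fun z : ZZ => crd z (free_crd s)) @^-1` A `&` kill s @^-1` C) =
  (cgauss_prob (free_var s) A * kill_law s C)%E.
Proof.
move: A C.
have mRR : @measurable _ RR = <<s @measurable _ RR >>.
  by rewrite sigma_algebra_id//; exact: sigma_algebra_measurable.
apply: (indep_generated (measurable_crd (I := Idx) (R := R) (free_crd s)) (measurable_kill s)
  mRR (@measurableI _ RR) measurableT
  (measurable_cspaceE _) (@cylinders_setI _ _) (@cylindersT _ _)).
move=> A _ mA [C mC ->].
rewrite -[X in (_ * X)%E]/(mu (kill s @^-1` cyl C)).
(* The killed coordinate is frozen at (0, 0): a cylinder for [kill s] is either empty or leaves
   coordinate [s] unconstrained. *)
have [C0|C0] := pselect (C (free_crd s) (0, 0)); last first.
  have -> : kill s @^-1` cyl C = set0.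
    by apply/seteqP; split => z //= /(_ (free_crd s)); rewrite crd_kill eqxx.
  by rewrite setI0 !measure0 mule0.
have -> : kill s @^-1` cyl C = cyl (upd C s setT).
  apply/seteqP; split => z h i; have := h i; rewrite /upd crd_kill; case: eqP => // ->//.
have -> : (fun z : ZZ => crd z (free_crd s)) @^-1` A `&` cyl (upd C s setT) = cyl (upd C s A).
  apply/seteqP; split => z.
    by move=> [h1 h2] i; have := h2 i; rewrite /upd; case: eqP => // ->.
  move=> h; split => [|i]; first by have := h (free_crd s); rewrite /upd eqxx.
  by have := h i; rewrite /upd; case: eqP.
transitivity (rect_prob mod j (upd C s A)).
  by apply: block_law_cyl => //; exact: upd_meas.
rewrite rect_prob_upd//; congr (_ * _)%E; apply/esym.
by apply: block_law_cyl => //; exact: upd_meas.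
Qed.

End coordinate_independence.

(** * A slot as a function of the coordinates of its block *)

Section canonical_block.
Context {R : realType} {L K N B T : nat}.
Local Notation RR := (measurableTypeR R * measurableTypeR R)%type.
Local Notation Idx := (@block_idx L K N B T).
Local Notation ZZ := (cspace (R := R) Idx).

Definition cplx (x : RR) : R[i] := x.1 +i* x.2.

Lemma cplx_reim z : cplx (reim z) = z. Proof. by case: z. Qed.

Definition chan_crd l m n : Idx := inl (inl (l, m, n)).
Definition start_crd n : Idx := inl (inr (inl (inl n))).
Definition innov_crd n i : Idx := inl (inr (inl (inr (n, i)))).
Definition data_crd l m i : Idx := inl (inr (inr (inl (l, m, i)))).
Definition noise_crd n i : Idx := inl (inr (inr (inr (n, i)))).
Definition dist_crd n i : Idx := inr (n, i).

(* The model of one block, read off its coordinates; only channel uses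
   1, ..., T are meaningful. *)
Definition block_rvs (pr : uplink_params R L K) : uplink_rvs R L K N ZZ := UplinkRvs
  (fun _ _ l m z => \col_n cplx (crd z (chan_crd l m n)))
  (fun _ _ n t z => (crd z (start_crd n)).1 +
     \sum_(i < T.-1 | (i.+1 < t)%N) (crd z (innov_crd n i)).1)
  (fun _ l m t z => if (t <= B)%N then pilot pr l m t else
     if insub (t - B.+1)%N is Some i then cplx (crd z (data_crd l m i)) else 0)
  (fun _ _ t z => \col_n
     if insub t.-1 is Some i then cplx (crd z (dist_crd n i)) else 0)
  (fun _ _ t z => \col_n
     if insub t.-1 is Some i then cplx (crd z (noise_crd n i)) else 0).

Context {d : measure_display} {Omega : measurableType d}.
Variables (P : probability Omega R).
Variables (pr : uplink_params R L K) (X : uplink_rvs R L K N Omega).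
Hypothesis mod : uplink_model (B := B) (T := T) P pr X.
Variable j : 'I_L.
Local Notation Zb := (block_vec (B := B) (T := T) X j).
Local Notation C := (block_rvs pr).

Lemma channel_canon b l m w : channel X b j l m w = channel C 0 j l m (Zb b w).
Proof.
by apply/matrixP => n i; rewrite ord1 mxE crd_mkc /= cplx_reim.
Qed.

Lemma phase_canon b n t w : (1 <= t <= T)%N ->
  phase X b j n t w = phase C 0 j n t (Zb b w).
Proof.
move=> /andP[t1 tT]; rewrite /= crd_mkc /=.
under eq_bigr do rewrite crd_mkc /=.
case: t t1 tT => // t _ tT.
have tT' : (t <= T.-1)%N by lia.
have E : \sum_(i < T.-1 | (i.+1 < t.+1)%N) innovation X b j n i.+1 w =
    \sum_(0 <= i < t) (phase X b j n i.+2 w - phase X b j n i.+1 w).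
  rewrite big_mkord (big_ord_widen _ (fun i => phase X b j n i.+2 w - phase X b j n i.+1 w) tT').
  by apply: eq_bigl => i; rewrite ltnS.
rewrite E (telescope_sumr (fun i => phase X b j n i.+1 w))//.
by rewrite addrC subrK.
Qed.

Lemma symbol_canon b l m t w : (1 <= t <= T)%N ->
  symbol X b l m t w = symbol C 0 l m t (Zb b w).
Proof.
move=> /andP[t1 tT] /=; case: (leqP t B) => tB.
  by rewrite (symbol_pilot mod)// t1.
case: insubP => [i _ it|]; last by rewrite -ltnNge; lia.
by rewrite crd_mkc /= cplx_reim; congr (symbol X b l m _ w); rewrite it; lia.
Qed.

Lemma distortion_canon b t w : (1 <= t <= T)%N ->
  distortion X b j t w = distortion C 0 j t (Zb b w).
Proof.
move=> /andP[t1 tT]; apply/matrixP => n i; rewrite ord1 mxE.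
case: insubP => [i' _ it|]; last by lia.
by rewrite crd_mkc /dist_val /= cplx_reim it prednK.
Qed.

Lemma noise_canon b t w : (1 <= t <= T)%N ->
  noise X b j t w = noise C 0 j t (Zb b w).
Proof.
move=> /andP[t1 tT]; apply/matrixP => n i; rewrite ord1 mxE.
case: insubP => [i' _ it|]; last by lia.
by rewrite crd_mkc /= cplx_reim it prednK.
Qed.

Lemma phase_mx_canon b t w : (1 <= t <= T)%N ->
  phase_mx X b j t w = phase_mx C 0 j t (Zb b w).
Proof.
move=> tT; rewrite /phase_mx; congr diag_mx; apply/rowP => n.
by rewrite !mxE phase_canon.
Qed.

Lemma channel_mx_canon b l w : channel_mx X b j l w = channel_mx C 0 j l (Zb b w).
Proof. by apply/matrixP => n m; rewrite [LHS]mxE [RHS]mxE channel_canon. Qed.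

Lemma received_from_canon (x y : 'I_L -> 'cV[R[i]]_K) b t w : (1 <= t <= T)%N -> x =1 y ->
  received_from X x b j t w = received_from C y 0 j t (Zb b w).
Proof.
move=> tT xy; have E : \sum_(l < L) channel_mx X b j l w *m x l =
    \sum_(l < L) channel_mx C 0 j l (Zb b w) *m y l.
  by apply: eq_bigr => l _; rewrite channel_mx_canon xy.
by rewrite /received_from E (phase_mx_canon _ _ tT) (distortion_canon _ _ tT) (noise_canon _ _ tT).
Qed.

Lemma pilot_obs_canon b w : (B <= T)%N ->
  pilot_obs (B := B) X b j w = pilot_obs (B := B) C 0 j (Zb b w).
Proof.
move=> BT; apply/matrixP => n s; rewrite [LHS]mxE [RHS]mxE; have sB := ltn_ord s.
rewrite /received (received_from_canon (y := symbols C 0 s.+1 (Zb b w)))//; first lia.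
by move=> l; apply/matrixP => m i; rewrite !mxE symbol_canon//; lia.
Qed.

Lemma filter_rv_canon (v : nat -> 'M[R[i]]_(N, B) -> 'cV[R[i]]_N) b t w : (B <= T)%N ->
  filter_rv X v j b t w = filter_rv C v j 0 t (Zb b w).
Proof. by move=> BT; rewrite /filter_rv pilot_obs_canon. Qed.

Lemma eff_channel_canon b l m t w : (1 <= t <= T)%N ->
  eff_channel X b j l m t w = eff_channel C 0 j l m t (Zb b w).
Proof. by move=> tT; rewrite /eff_channel phase_mx_canon// channel_canon. Qed.

Lemma filtered_channel_canon (v : nat -> 'M[R[i]]_(N, B) -> 'cV[R[i]]_N) l m t w : (B <= T)%N -> (1 <= t <= T)%N ->
  filtered_channel X v j l m t w = filtered_channel C v j l m t (Zb 0 w).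
Proof.
by move=> BT tT; rewrite /filtered_channel filter_rv_canon// eff_channel_canon.
Qed.

Lemma filtered_distortion_canon (v : nat -> 'M[R[i]]_(N, B) -> 'cV[R[i]]_N) t w : (B <= T)%N -> (1 <= t <= T)%N ->
  filtered_distortion X v j t w = filtered_distortion C v j t (Zb 0 w).
Proof.
by move=> BT tT; rewrite /filtered_distortion filter_rv_canon// distortion_canon.
Qed.

Definition slot_output (v : nat -> 'M[R[i]]_(N, B) -> 'cV[R[i]]_N) (k : 'I_K) (x : R[i]) t (z : ZZ) : R[i] :=
  hdot (filter_rv C v j 0 t z) (received_from C (coded_symbols C j k x 0 t z) 0 j t z).

(** Each block runs through one and the same function of its coordinates. This is what reduces
    coding over blocks to a fixed memoryless channel. *)
Lemma slot_output_canon v k x b t w : (B <= T)%N -> (1 <= t <= T)%N ->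
  hdot (filter_rv X v j b t w) (received_from X (coded_symbols X j k x b t w) b j t w) =
  slot_output v k x t (Zb b w).
Proof.
move=> BT tT; rewrite /slot_output filter_rv_canon//; congr hdot.
apply: received_from_canon => // l; apply/matrixP => m i; rewrite !mxE.
by rewrite symbol_canon.
Qed.

End canonical_block.

(** * Measurability of complex-valued functions *)

Section complex_measurability.
Context {R : realType} {d : measure_display} {T : measurableType d}.
Implicit Types f g : T -> R[i].

Lemma cmeasurableP f : cmeasurable f <->
  measurable_fun setT (fun z => complex.Re (f z)) /\ measurable_fun setT (fun z => complex.Im (f z)).
Proof.
split=> [mf|[m1 m2]]; last exact: measurable_fun_pair.
by split; [exact: (measurableT_comp measurable_fst mf)|exact: (measurableT_comp measurable_snd mf)].
Qed.

Lemma cmeasurable_cst (c : R[i]) : cmeasurable (fun _ : T => c).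
Proof. by apply/cmeasurableP; split; exact: measurable_cst. Qed.

Lemma cmeasurableD f g : cmeasurable f -> cmeasurable g ->
  cmeasurable (fun z => f z + g z).
Proof.
move=> /cmeasurableP[f1 f2] /cmeasurableP[g1 g2]; apply/cmeasurableP; split.
- by rewrite (_ : (fun z => _) = (fun z => complex.Re (f z) + complex.Re (g z))); [exact: measurable_funD|apply/funext => z; case: (f z) (g z) => ? ? [? ?]].
- by rewrite (_ : (fun z => _) = (fun z => complex.Im (f z) + complex.Im (g z))); [exact: measurable_funD|apply/funext => z; case: (f z) (g z) => ? ? [? ?]].
Qed.

Lemma cmeasurableM f g : cmeasurable f -> cmeasurable g ->
  cmeasurable (fun z => f z * g z).
Proof.
move=> /cmeasurableP[f1 f2] /cmeasurableP[g1 g2]; apply/cmeasurableP; split.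
- rewrite (_ : (fun z => _) = (fun z => complex.Re (f z) * complex.Re (g z) - complex.Im (f z) * complex.Im (g z))).
    by apply: measurable_funB; exact: measurable_funM.
  by apply/funext => z; case: (f z) (g z) => ? ? [? ?].
- rewrite (_ : (fun z => _) = (fun z => complex.Re (f z) * complex.Im (g z) + complex.Im (f z) * complex.Re (g z))).
    by apply: measurable_funD; exact: measurable_funM.
  by apply/funext => z; case: (f z) (g z) => ? ? [? ?].
Qed.

Lemma cmeasurable_conj f : cmeasurable f -> cmeasurable (fun z => conjc (f z)).
Proof.
move=> /cmeasurableP[f1 f2]; apply/cmeasurableP; split.
- by rewrite (_ : (fun z => _) = (fun z => complex.Re (f z)))//; apply/funext => z; case: (f z).
- rewrite (_ : (fun z => _) = (fun z => - complex.Im (f z))); first exact: measurable_funN.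
  by apply/funext => z; case: (f z).
Qed.

Lemma cmeasurable_sum (I : Type) (s : seq I) (p : pred I) (f : I -> T -> R[i]) :
  (forall i, cmeasurable (f i)) -> cmeasurable (fun z => \sum_(i <- s | p i) f i z).
Proof.
move=> mf; elim: s => [|a s IH].
  by under eq_fun do rewrite big_nil; exact: cmeasurable_cst.
under eq_fun do rewrite big_cons; case: (p a) => //.
exact: cmeasurableD.
Qed.

Lemma measurable_abs2 f : cmeasurable f -> measurable_fun setT (fun z => abs2 (f z)).
Proof.
by move=> /cmeasurableP[f1 f2]; apply: measurable_funD; exact: measurable_funX.
Qed.

Lemma cmeasurable_expi (g : T -> R) : measurable_fun setT g ->
  cmeasurable (fun z => expi (g z)).
Proof.
move=> mg; apply/cmeasurableP; split; apply: measurableT_comp => //.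
- by apply: continuous_measurable_fun; exact: continuous_cos.
- by apply: continuous_measurable_fun; exact: continuous_sin.
Qed.

Lemma cmeasurable_cplx (g : T -> measurableTypeR R * measurableTypeR R) :
  measurable_fun setT g -> cmeasurable (fun z => cplx (g z)).
Proof.
by move=> mg; rewrite /cmeasurable (_ : _ \o _ = g)//; apply/funext => z /=; case: (g z).
Qed.

Lemma mx_events_preimage m n (f : T -> 'M[R[i]]_(m, n)) U :
  (forall a b, cmeasurable (fun z => f z a b)) -> mx_events U -> measurable (f @^-1` U).
Proof.
move=> mf; suff : @mx_events R m n `<=` [set U | measurable (f @^-1` U)] by apply.
apply: smallest_sub.
  split => /=.
  - by rewrite preimage_set0.
  - by move=> A mA; rewrite setTD preimage_setC; exact: measurableC.
  - by move=> A mA; rewrite preimage_bigcup; exact: bigcup_measurable.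
move=> _ [a [b [A [mA ->]]]] /=.
exact: (measurable_preimage (mf a b)).
Qed.

Lemma hdotE N (v y : 'cV[R[i]]_N) : hdot v y = \sum_a conjc (v a 0) * y a 0.
Proof. by rewrite /hdot mxE; apply: eq_bigr => a _; rewrite !mxE. Qed.

Lemma hdotDr N (v y y' : 'cV[R[i]]_N) : hdot v (y + y') = hdot v y + hdot v y'.
Proof. by rewrite !hdotE -big_split; apply: eq_bigr => a _; rewrite mxE mulrDr. Qed.

Lemma cmeasurable_hdot N (v y : T -> 'cV[R[i]]_N) :
  (forall a, cmeasurable (fun z => v z a 0)) -> (forall a, cmeasurable (fun z => y z a 0)) ->
  cmeasurable (fun z => hdot (v z) (y z)).
Proof.
move=> mv my; under eq_fun do rewrite hdotE.
by apply: cmeasurable_sum => a; apply: cmeasurableM => //; exact: cmeasurable_conj.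
Qed.

End complex_measurability.

Lemma hdot_received_from {R : realType} {L K N : nat} {d : measure_display} {Omega : measurableType d}
    (X : uplink_rvs R L K N Omega) (f : 'cV[R[i]]_N) (x : 'I_L -> 'cV[R[i]]_K) b j t w :
  hdot f (received_from X x b j t w) =
  \sum_(l < L) \sum_(m < K) hdot f (eff_channel X b j l m t w) * x l m 0
  + hdot f (distortion X b j t w) + hdot f (noise X b j t w).
Proof.
rewrite /received_from !hdotDr; congr (_ + _ + _).
rewrite hdotE.
under [RHS]eq_bigr do under eq_bigr do rewrite hdotE mulr_suml.
under [RHS]eq_bigr do rewrite exchange_big/=.
rewrite [RHS]exchange_big/=; apply: eq_bigr => a _.
rewrite mul_diag_mx mxE summxE mulrA mulr_sumr; apply: eq_bigr => l _.
rewrite [X in _ * X]mxE mulr_sumr; apply: eq_bigr => m _.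
by rewrite /eff_channel /phase_mx mul_diag_mx !mxE !mulrA.
Qed.

(** Stated over an arbitrary [zmodType] to serve twice: for the output of a slot in R[i], and for
    the denominator of the SINR in R. *)
Lemma split_own_term (V : zmodType) (L K N : nat) (j : 'I_L) (k : 'I_K)
    (s : 'I_L -> 'I_K -> V) (g : 'I_N -> V) (F : 'I_L * 'I_K + 'I_N -> V) (e o : V) :
  s j k = o -> (forall l m, (l, m) != (j, k) -> s l m = F (inl (l, m))) ->
  (forall n, g n = F (inr n)) ->
  \sum_l \sum_m s l m + e + \sum_n g n = o + (e + \sum_(a | a != inl (j, k)) F a).
Proof.
move=> so sF gF; rewrite pair_bigA/= (bigD1 (j, k))//= so big_sumType/=.
rewrite (eq_bigr (fun lm => F (inl lm))); last by move=> [l m] lm; exact: sF.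
rewrite (eq_bigr (fun n => F (inr n)) (P := xpredT)); last by move=> n _; exact: gF.
by rewrite -!addrA; congr (_ + _); rewrite addrCA.
Qed.

Section canonical_outputs.
Context {R : realType} {L K N B T : nat}.
Local Notation RR := (measurableTypeR R * measurableTypeR R)%type.
Local Notation Idx := (@block_idx L K N B T).
Local Notation ZZ := (cspace (R := R) Idx).
Local Notation free_idx := (@free_idx L K N B T).
Variables (pr : uplink_params R L K).
Variable v : nat -> 'M[R[i]]_(N, B) -> 'cV[R[i]]_N.
Hypothesis mv : filter_meas (T := T) v.
Hypothesis BT : (B <= T)%N.
Variables (j : 'I_L) (k : 'I_K).
Local Notation C := (block_rvs (N := N) (B := B) (T := T) pr).

Lemma cmeasurable_crd (i : Idx) : cmeasurable (fun z : ZZ => cplx (crd z i)).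
Proof. by apply: cmeasurable_cplx; exact: measurable_crd. Qed.

Lemma cmeasurable_channel l m n : cmeasurable (fun z : ZZ => channel C 0 j l m z n 0).
Proof. by under eq_fun do rewrite mxE; exact: cmeasurable_crd. Qed.

Lemma measurable_phase n t : measurable_fun setT (fun z : ZZ => phase C 0 j n t z).
Proof.
have mc (i : Idx) : measurable_fun setT (fun z : ZZ => (crd z i).1).
  exact: (measurableT_comp measurable_fst (measurable_crd i)).
apply: measurable_funD; first exact: mc.
rewrite (_ : (fun z => _) = fun z : ZZ => \sum_(i <- [seq i : 'I_T.-1 <- index_enum _ | (i.+1 < t)%N])
    (crd z (innov_crd n i : Idx)).1).
  by apply: measurable_sum => i; exact: mc.
by apply/funext => z; rewrite big_filter.
Qed.

Lemma cmeasurable_symbol l m t : cmeasurable (fun z : ZZ => symbol C 0 l m t z).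
Proof.
rewrite /=; case: (leqP t B) => _; first exact: cmeasurable_cst.
by case: (insub (t - B.+1)%N : option 'I_(T - B)) => [i|];
  [exact: cmeasurable_crd|exact: cmeasurable_cst].
Qed.

Lemma cmeasurable_distortion n t : cmeasurable (fun z : ZZ => distortion C 0 j t z n 0).
Proof.
under eq_fun do rewrite mxE.
by case: (insub t.-1 : option 'I_T) => [i|];
  [exact: cmeasurable_crd|exact: cmeasurable_cst].
Qed.

Lemma cmeasurable_noise n t : cmeasurable (fun z : ZZ => noise C 0 j t z n 0).
Proof.
under eq_fun do rewrite mxE.
by case: (insub t.-1 : option 'I_T) => [i|];
  [exact: cmeasurable_crd|exact: cmeasurable_cst].
Qed.

Lemma cmeasurable_eff_channel l m t n :
  cmeasurable (fun z : ZZ => eff_channel C 0 j l m t z n 0).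
Proof.
under eq_fun do rewrite /eff_channel /phase_mx mul_diag_mx mxE [X in X * _]mxE.
apply: cmeasurableM; last exact: cmeasurable_channel.
by apply: cmeasurable_expi; exact: measurable_phase.
Qed.

(** Makes an entry of the pilot observation a filter output for a constant filter, so that facts
    about [hdot] cover the pilots as well. *)
Lemma hdot_delta n (y : 'cV[R[i]]_N) : hdot (\col_a (a == n)%:R) y = y n 0.
Proof.
rewrite hdotE (bigD1 n)//= big1 ?addr0; last first.
  by move=> a /negbTE an; rewrite mxE an conjc0 mul0r.
by rewrite mxE eqxx conjc1 mul1r.
Qed.

Lemma cmeasurable_received_from (f : ZZ -> 'cV[R[i]]_N) (x : ZZ -> 'I_L -> 'cV[R[i]]_K) t :
  (forall n, cmeasurable (fun z => f z n 0)) ->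
  (forall l m, cmeasurable (fun z => x z l m 0)) ->
  cmeasurable (fun z => hdot (f z) (received_from C (x z) 0 j t z)).
Proof.
move=> mf mx; under eq_fun do rewrite hdot_received_from.
apply: cmeasurableD; first apply: cmeasurableD.
- apply: cmeasurable_sum => l; apply: cmeasurable_sum => m.
  apply: cmeasurableM => //; apply: cmeasurable_hdot => // n.
  exact: cmeasurable_eff_channel.
- by apply: cmeasurable_hdot => // n; exact: cmeasurable_distortion.
- by apply: cmeasurable_hdot => // n; exact: cmeasurable_noise.
Qed.

Lemma cmeasurable_pilot_obs n s :
  cmeasurable (fun z : ZZ => pilot_obs (B := B) C 0 j z n s).
Proof.
under eq_fun do rewrite mxE -hdot_delta.
apply: cmeasurable_received_from => [a|l m].
  exact: cmeasurable_cst.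
by under eq_fun do rewrite mxE; exact: cmeasurable_symbol.
Qed.

Lemma cmeasurable_filter_rv n t : (B < t <= T)%N ->
  cmeasurable (fun z : ZZ => filter_rv C v j 0 t z n 0).
Proof.
move=> tT _ A mA; rewrite setTI.
have := mx_events_preimage (f := fun z : ZZ => pilot_obs (B := B) C 0 j z) cmeasurable_pilot_obs (mv n tT mA).
by [].
Qed.

Lemma cmeasurable_filtered_channel l m t : (B < t <= T)%N ->
  cmeasurable (fun z : ZZ => filtered_channel C v j l m t z).
Proof.
move=> tT; apply: cmeasurable_hdot => n.
  exact: cmeasurable_filter_rv.
exact: cmeasurable_eff_channel.
Qed.

Lemma cmeasurable_filtered_distortion t : (B < t <= T)%N ->
  cmeasurable (fun z : ZZ => filtered_distortion C v j t z).
Proof.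
move=> tT; apply: cmeasurable_hdot => n.
  exact: cmeasurable_filter_rv.
exact: cmeasurable_distortion.
Qed.

(* Coordinates on which the receive filter does not depend *)
Definition late (s : free_idx) : bool :=
  match s with inl _ => true | inr (_, i) => (B <= i)%N end.

Section kill_invariance.
Variables (s : free_idx) (z : ZZ).
Hypothesis late_s : late s.

Lemma channel_kill l m : channel C 0 j l m (kill s z) = channel C 0 j l m z.
Proof. by apply/matrixP => n i; rewrite !mxE crd_kill. Qed.

Lemma phase_kill n t : phase C 0 j n t (kill s z) = phase C 0 j n t z.
Proof.
by rewrite /= crd_kill; congr (_ + _); apply: eq_bigr => i _; rewrite crd_kill.
Qed.

Lemma distortion_kill t : distortion C 0 j t (kill s z) = distortion C 0 j t z.
Proof.
by apply/matrixP => n i; rewrite !mxE; case: insub => // i'; rewrite crd_kill.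
Qed.

Lemma noise_kill t : (0 < t <= B)%N -> noise C 0 j t (kill s z) = noise C 0 j t z.
Proof.
move=> tB; apply/matrixP => n i; rewrite !mxE; case: insubP => // i' _ it.
rewrite crd_kill; case: eqP => // -[ss].
by move: late_s; rewrite -ss /= it; lia.
Qed.

Lemma eff_channel_kill l m t : eff_channel C 0 j l m t (kill s z) = eff_channel C 0 j l m t z.
Proof.
rewrite /eff_channel channel_kill; congr (diag_mx _ *m _).
by apply/rowP => n; rewrite !mxE phase_kill.
Qed.

Lemma pilot_obs_kill : pilot_obs (B := B) C 0 j (kill s z) = pilot_obs (B := B) C 0 j z.
Proof.
apply/matrixP => n a; rewrite [LHS]mxE [RHS]mxE -!hdot_delta !hdot_received_from.
have aB := ltn_ord a; rewrite distortion_kill noise_kill; last by lia.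
congr (_ + _ + _); apply: eq_bigr => l _; apply: eq_bigr => m _.
by rewrite eff_channel_kill !mxE /= aB.
Qed.

Lemma filter_rv_kill t : filter_rv C v j 0 t (kill s z) = filter_rv C v j 0 t z.
Proof. by rewrite /filter_rv pilot_obs_kill. Qed.

Lemma filtered_channel_kill l m t :
  filtered_channel C v j l m t (kill s z) = filtered_channel C v j l m t z.
Proof. by rewrite /filtered_channel filter_rv_kill eff_channel_kill. Qed.

Lemma filtered_distortion_kill t :
  filtered_distortion C v j t (kill s z) = filtered_distortion C v j t z.
Proof. by rewrite /filtered_distortion filter_rv_kill distortion_kill. Qed.

End kill_invariance.

Section slot.
Variable i : 'I_(T - B).
Let t := (B + i).+1.

Lemma slot_ltT : (B + i < T)%N.
Proof. by have := ltn_ord i; lia. Qed.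

Lemma slot_lt : (B < t <= T)%N.
Proof. by have := ltn_ord i; rewrite /t; lia. Qed.

(* The output of the slot is the sum of [slot_coef a] times the coordinate
   [slot_src a], and of the filtered distortion. *)
Definition slot_src (a : 'I_L * 'I_K + 'I_N) : free_idx :=
  match a with
  | inl lm => inl (lm.1, lm.2, i)
  | inr n => inr (n, Ordinal slot_ltT)
  end.

Definition slot_coef (a : 'I_L * 'I_K + 'I_N) (z : ZZ) : R[i] :=
  match a with
  | inl lm => filtered_channel C v j lm.1 lm.2 t z
  | inr n => conjc (filter_rv C v j 0 t z n 0)
  end.

(** The own data coordinate [inl (j, k)] is left out because the codeword takes its place. The
    distortion stands apart because its law depends on the channels. *)
Definition interference (z : ZZ) : R[i] :=
  filtered_distortion C v j t z +
  \sum_(a | a != inl (j, k)) slot_coef a z * cplx (crd z (free_crd (slot_src a))).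

Lemma slot_src_inj : injective slot_src.
Proof. by move=> [[l m]|n] [[l' m']|n'] //= [] => [-> ->|->]. Qed.

Lemma late_slot_src a : late (slot_src a).
Proof. by case: a => //= n; rewrite leq_addr. Qed.

Lemma cmeasurable_slot_coef a : cmeasurable (slot_coef a).
Proof.
have tT := slot_lt; case: a => [lm|n] /=; first exact: cmeasurable_filtered_channel.
by apply: cmeasurable_conj; exact: cmeasurable_filter_rv.
Qed.

Lemma slot_coef_kill s z a : late s -> slot_coef a (kill s z) = slot_coef a z.
Proof.
move=> ls; case: a => [lm|n] /=; first exact: filtered_channel_kill.
by rewrite filter_rv_kill.
Qed.

Lemma slot_outputE x z :
  slot_output (T := T) pr j v k x t z =
  filtered_channel C v j j k t z * x + interference z.
Proof.
have iT := ltn_ord i.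
rewrite /slot_output hdot_received_from /interference.
have noiseE : hdot (filter_rv C v j 0 t z) (noise C 0 j t z) =
    \sum_n slot_coef (inr n) z * cplx (crd z (free_crd (slot_src (inr n)))).
  rewrite hdotE; apply: eq_bigr => n _; congr (_ * _); rewrite mxE.
  case: insubP => [i' _ it|]; last by rewrite /t /= slot_ltT.
  congr (cplx (crd z _)); rewrite /free_crd /noise_crd /=; congr (inl (inr (inr (inr (n, _))))).
  exact: val_inj.
have dataE l m : symbol C 0 l m t z = cplx (crd z (free_crd (slot_src (inl (l, m))))).
  rewrite /= ifN; last by rewrite -ltnNge /t; lia.
  case: insubP => [i' _ it|]; last by rewrite /t; lia.
  congr (cplx (crd z _)); rewrite /free_crd /data_crd /=; congr (inl (inr (inr (inl (l, m, _))))).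
  by apply: val_inj; rewrite it /t /=; lia.
rewrite noiseE; apply: split_own_term => [|l m lm|//].
  by rewrite mxE !eqxx.
rewrite mxE -dataE [X in if X then _ else _](_ : _ = false)//.
by apply: contraNF lm => /andP[/eqP-> /eqP->].
Qed.

Lemma cmeasurable_interference : cmeasurable interference.
Proof.
apply: cmeasurableD; first by apply: cmeasurable_filtered_distortion; exact: slot_lt.
apply: cmeasurable_sum => a; apply: cmeasurableM; first exact: cmeasurable_slot_coef.
exact: cmeasurable_crd.
Qed.

End slot.
End canonical_outputs.

(** * Second moments of sums with independent Gaussian coordinates *)

Section second_moments.
Context {R : realType} {L K N B T : nat}.
Local Notation RR := (measurableTypeR R * measurableTypeR R)%type.
Local Notation Idx := (@block_idx L K N B T).
Local Notation ZZ := (cspace (R := R) Idx).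
Local Notation free_idx := (@free_idx L K N B T).
Variables (mu : probability ZZ R) (nu : free_idx -> probability ZZ R) (fv : free_idx -> R).
Hypothesis fv0 : forall s, 0 <= fv s.
Hypothesis indep : forall s (A : set RR) (C : set ZZ), measurable A -> measurable C ->
  mu ((fun z : ZZ => crd z (free_crd s)) @^-1` A `&` kill s @^-1` C) =
  (cgauss_prob (fv s) A * nu s C)%E.

(** Averaging over x and - x removes the cross term pointwise, so the symmetry of the Gaussian law
    replaces a computation of first moments. *)
Lemma abs2_parallelogram (y a : R[i]) (x : RR) :
  abs2 (y + a * cplx x) + abs2 (y + a * cplx (oppRR x)) =
  2 * (abs2 y + abs2 a * (x.1 ^+ 2 + x.2 ^+ 2)).
Proof. by case: y a x => [y1 y2] [a1 a2] [x1 x2]; rewrite /abs2 /=; ring. Qed.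

Lemma cgauss_affine_second_moment (y a : R[i]) (p : R) : 0 <= p ->
  (\int[cgauss_prob p]_x (abs2 (y + a * cplx x))%:E <= (abs2 y)%:E + p%:E * (abs2 a)%:E)%E.
Proof.
move=> p0; pose f (x : RR) := (abs2 (y + a * cplx x))%:E.
have cx : cmeasurable (fun x : RR => cplx x) by apply: cmeasurable_cplx; exact: measurable_id.
have mf : measurable_fun setT f.
  apply/measurable_EFinP; apply: measurable_abs2; apply: cmeasurableD; first exact: cmeasurable_cst.
  by apply: cmeasurableM => //; exact: cmeasurable_cst.
have f0 x : (0 <= f x)%E by rewrite lee_fin abs2_ge0.
have m2 : measurable_fun setT (fun x : RR => (x.1 ^+ 2 + x.2 ^+ 2)%:E).
  apply/measurable_EFinP; apply: measurable_funD; exact: measurable_funX.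
have sq0 (x : RR) : (0 <= (x.1 ^+ 2 + x.2 ^+ 2)%:E)%E by rewrite lee_fin addr_ge0 ?sqr_ge0.
have E : (\int[cgauss_prob p]_x f x + \int[cgauss_prob p]_x f x =
    2%:E * ((abs2 y)%:E + (abs2 a)%:E * \int[cgauss_prob p]_x (x.1 ^+ 2 + x.2 ^+ 2)%:E))%E.
  rewrite -[X in (_ + X)%E](cgauss_ge0_integralN p0 mf f0) -ge0_integralD//; last first.
    exact: (measurableT_comp mf measurable_oppRR).
  transitivity (\int[cgauss_prob p]_x (2%:E * ((abs2 y)%:E + (abs2 a)%:E * (x.1 ^+ 2 + x.2 ^+ 2)%:E)))%E.
    apply: eq_integral => x _; rewrite /f -EFinD abs2_parallelogram.
    by [].
  rewrite ge0_integralZl//; last 2 first.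
  - by apply: emeasurable_funD => //; exact: measurable_funeM.
  - by move=> x _; rewrite adde_ge0 ?lee_fin ?abs2_ge0// mulr_ge0 ?abs2_ge0// addr_ge0 ?sqr_ge0.
  congr (_ * _)%E; rewrite ge0_integralD//; last 3 first.
  - by move=> x _; rewrite lee_fin abs2_ge0.
  - by move=> x _; rewrite mule_ge0 ?lee_fin ?abs2_ge0// addr_ge0 ?sqr_ge0.
  - exact: measurable_funeM.
  rewrite integral_cst_prob ge0_integralZl//.
  by rewrite lee_fin abs2_ge0.
have M := cgauss_second_moment p0.
have M0 : (0 <= \int[cgauss_prob p]_x (x.1 ^+ 2 + x.2 ^+ 2)%:E)%E by apply: integral_ge0.
have I0 : (0 <= \int[cgauss_prob p]_x f x)%E by apply: integral_ge0.
move: E M M0 I0; rewrite -/f.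
set I := (\int[_]_x f x)%E; set J := (\int[_]_x _)%E.
case: J => [J| |]; [|by rewrite leye_eq|by []].
case: I => [I| |]; [|by discriminate|by []].
move=> [E]; rewrite !lee_fin => M _ _.
have := ler_wpM2l (abs2_ge0 a) M; lra.
Qed.

(** [y] and [a] are functions of [kill s z], which is independent of coordinate [s]: integrate that
    coordinate first, with [y] and [a] fixed. They may depend on each other in any way. *)
Lemma free_add_second_moment s (y a : ZZ -> R[i]) :
  cmeasurable y -> cmeasurable a ->
  (forall z, y (kill s z) = y z) -> (forall z, a (kill s z) = a z) ->
  (\int[mu]_z (abs2 (y z + a z * cplx (crd z (free_crd s))))%:E <=
   \int[mu]_z (abs2 (y z))%:E + (fv s)%:E * \int[mu]_z (abs2 (a z))%:E)%E.
Proof.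
move=> my ma yk ak.
pose F (p : ZZ * RR) : \bar R := (abs2 (y p.1 + a p.1 * cplx p.2))%:E.
have mF : measurable_fun setT F.
  apply/measurable_EFinP; apply: measurable_abs2; apply: cmeasurableD.
    exact: (measurableT_comp my measurable_fst).
  apply: cmeasurableM; first exact: (measurableT_comp ma measurable_fst).
  by apply: cmeasurable_cplx; exact: measurable_snd.
have F0 p : (0 <= F p)%E by rewrite lee_fin abs2_ge0.
have ind (C : set ZZ) (A : set RR) : measurable C -> measurable A ->
    mu (kill s @^-1` C `&` (fun z : ZZ => crd z (free_crd s)) @^-1` A) =
    (nu s C * cgauss_prob (fv s) A)%E.
  by move=> mC mA; rewrite setIC indep// muleC.
have mk := @measurable_kill R L K N B T s.
have -> : (\int[mu]_z (abs2 (y z + a z * cplx (crd z (free_crd s))))%:E =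
   \int[mu]_z F (kill s z, crd z (free_crd s)))%E.
  by apply: eq_integral => z _; rewrite /F/= yk ak.
rewrite (ge0_integral_indep mk (measurable_crd (free_crd s)) ind mF F0).
have lawk C : measurable C -> mu (kill s @^-1` C) = nu s C.
  exact: (law_left (Y := fun z : ZZ => crd z (free_crd s)) (nu := cgauss_prob (fv s)) ind).
have my2 : measurable_fun setT (fun z => (abs2 (y z))%:E).
  by apply/measurable_EFinP; exact: measurable_abs2.
have ma2 : measurable_fun setT (fun z => (abs2 (a z))%:E).
  by apply/measurable_EFinP; exact: measurable_abs2.
have a20 z : (0 <= (abs2 (a z))%:E)%E by rewrite lee_fin abs2_ge0.
have y20 z : (0 <= (abs2 (y z))%:E)%E by rewrite lee_fin abs2_ge0.
have Iy : (\int[mu]_z (abs2 (y z))%:E = \int[nu s]_z (abs2 (y z))%:E)%E.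
  rewrite -(ge0_integral_law mk lawk my2 y20).
  by apply: eq_integral => z _; rewrite yk.
have Ia : (\int[mu]_z (abs2 (a z))%:E = \int[nu s]_z (abs2 (a z))%:E)%E.
  rewrite -(ge0_integral_law mk lawk ma2 a20).
  by apply: eq_integral => z _; rewrite ak.
rewrite Iy Ia -ge0_integralZl//; last by rewrite lee_fin.
rewrite -ge0_integralD//; last 2 first.
- by move=> z _; rewrite mule_ge0// lee_fin.
- exact: measurable_funeM.
apply: ge0_le_integral => //.
- by move=> z _; apply: integral_ge0.
- exact: (measurable_fun_fubini_tonelli_F (m2 := cgauss_prob (fv s))).
- by apply: emeasurable_funD => //; exact: measurable_funeM.
by move=> z _; exact: (cgauss_affine_second_moment (y z) (a z) (fv0 s)).
Qed.

(** One coordinate is added at a time. By injectivity of [idx] the coordinate added does not occur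
    in the partial sum, which therefore survives [kill] and plays the role of [y]. *)
Lemma free_sum_second_moment (J : eqType) (js : seq J) (idx : J -> free_idx)
    (y : ZZ -> R[i]) (a : J -> ZZ -> R[i]) :
  uniq js -> injective idx -> cmeasurable y -> (forall l, cmeasurable (a l)) ->
  (forall l z, y (kill (idx l) z) = y z) ->
  (forall l l' z, a l' (kill (idx l) z) = a l' z) ->
  (\int[mu]_z (abs2 (y z + \sum_(l <- js) a l z * cplx (crd z (free_crd (idx l)))))%:E <=
   \int[mu]_z (abs2 (y z))%:E + \sum_(l <- js) (fv (idx l))%:E * \int[mu]_z (abs2 (a l z))%:E)%E.
Proof.
move=> ujs idxI my ma yk ak; elim: js ujs => [|l js IH] /=.
  move=> _; rewrite big_nil adde0; under eq_integral do rewrite big_nil addr0.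
  exact: lexx.
move=> /andP[ljs /IH{}IH]; rewrite big_cons addeCA.
pose y' z := y z + \sum_(l <- js) a l z * cplx (crd z (free_crd (idx l))).
have my' : cmeasurable y'.
  apply: cmeasurableD => //; apply: cmeasurable_sum => l'; apply: cmeasurableM => //.
  by apply: cmeasurable_cplx; exact: measurable_crd.
have yk' z : y' (kill (idx l) z) = y' z.
  rewrite /y' yk big_seq [in RHS]big_seq; congr (_ + _); apply: eq_bigr => l' l'js.
  rewrite ak crd_kill ifN//; apply: contra ljs => /eqP[] /idxI <-.
  exact: l'js.
apply: (@le_trans _ _ (\int[mu]_z (abs2 (y' z))%:E + (fv (idx l))%:E * \int[mu]_z (abs2 (a l z))%:E)%E); last first.
  by rewrite addeC leeD.
have E z : y z + \sum_(l' <- l :: js) a l' z * cplx (crd z (free_crd (idx l'))) =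
    y' z + a l z * cplx (crd z (free_crd (idx l))).
  by rewrite big_cons addrCA; exact: addrC.
rewrite (eq_integral (fun z => (abs2 (y' z + a l z * cplx (crd z (free_crd (idx l)))))%:E)).
  exact: free_add_second_moment my' (ma l) yk' (ak l l).
by move=> z _; congr (EFin (abs2 _)); exact: E.
Qed.

End second_moments.

(** * The metric of a slot *)

Section slot_mean.
Context {R : realType} {d : measure_display} {T : measurableType d}.
Variable mu : probability T R.
Implicit Types f a w : T -> R[i].

Definition sq_integrable f : Prop := mu.-integrable setT (EFin \o (fun z => abs2 (f z))).

Lemma integrableDR (f g : T -> R) : mu.-integrable setT (EFin \o f) ->
  mu.-integrable setT (EFin \o g) -> mu.-integrable setT (EFin \o (fun z => f z + g z)).
Proof.
move=> fi gi; rewrite (_ : _ \o _ = ((EFin \o f) \+ (EFin \o g))%E); last by apply/funext.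
exact: integrableD.
Qed.

Lemma sq_integrableP f : cmeasurable f ->
  (\int[mu]_z (abs2 (f z))%:E < +oo)%E -> sq_integrable f.
Proof.
move=> mf fi; apply/integrableP; split.
  by apply/measurable_EFinP; exact: measurable_abs2.
rewrite (eq_integral (fun z => (abs2 (f z))%:E))// => z _ /=.
by rewrite ger0_norm// abs2_ge0.
Qed.

Lemma sq_integrable_cst (c : R[i]) : sq_integrable (fun=> c).
Proof. exact: (@integrable_bounded _ _ _ _ _ `|abs2 c|). Qed.

Lemma sq_integrableM f (c : R[i]) : sq_integrable f -> sq_integrable (fun z => c * f z).
Proof.
move=> fi; rewrite /sq_integrable (_ : _ \o _ = EFin \o (fun z => abs2 c * abs2 (f z))).
  exact: integrableZR.
apply/funext => z /=; congr EFin; case: c (f z) => c1 c2 [x y]; rewrite /abs2 /=; ring.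
Qed.

Lemma abs2D_le (x y : R[i]) : abs2 (x + y) <= 2 * (abs2 x + abs2 y).
Proof.
case: x y => [x1 x2] [y1 y2]; rewrite /abs2 /=.
have := sqr_ge0 (x1 - y1); have := sqr_ge0 (x2 - y2).
rewrite !sqrrB !sqrrD; lra.
Qed.

Lemma sq_integrableD f g : cmeasurable f -> cmeasurable g ->
  sq_integrable f -> sq_integrable g -> sq_integrable (fun z => f z + g z).
Proof.
move=> mf mg fi gi.
apply: (@le_integrable _ _ _ _ _ measurableT _ (EFin \o (fun z => 2 * (abs2 (f z) + abs2 (g z))))).
- by apply/measurable_EFinP; apply: measurable_abs2; exact: cmeasurableD.
- move=> z _ /=; rewrite lee_fin !ger0_norm ?abs2_ge0 ?abs2D_le//.
  by rewrite mulr_ge0// addr_ge0 ?abs2_ge0.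
by apply: integrableZR; exact: integrableDR.
Qed.

Lemma sq_integrable_Re_Im f : cmeasurable f -> sq_integrable f ->
  mu.-integrable setT (EFin \o (fun z => complex.Re (f z))) /\
  mu.-integrable setT (EFin \o (fun z => complex.Im (f z))).
Proof.
move=> /cmeasurableP[m1 m2] fi.
have dom (h : T -> R) : measurable_fun setT h -> (forall z, `|h z| <= 1 + abs2 (f z)) ->
    mu.-integrable setT (EFin \o h).
  move=> mh hf.
  apply: (@le_integrable _ _ _ _ _ measurableT _ (EFin \o (fun z => 1 + abs2 (f z)))).
  - exact/measurable_EFinP.
  - move=> z _ /=; rewrite lee_fin [leRHS]ger0_norm; first exact: hf.
    by apply: addr_ge0; [exact: ler01|exact: abs2_ge0].
  - apply: (@integrableDR (fun=> 1) (fun z => abs2 (f z))) fi.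
    exact: (@integrable_bounded _ _ _ _ _ `|1|).
have bound (x y : R) : `|x| <= 1 + (x ^+ 2 + y ^+ 2).
  have := sqr_ge0 (`|x| - 1); rewrite sqrrB real_normK ?num_real// => h.
  have := sqr_ge0 y; have := sqr_ge0 x; have := normr_ge0 x; lra.
split; apply: dom => // z; rewrite /abs2; first exact: bound.
by rewrite [complex.Re _ ^+ 2 + _]addrC; exact: bound.
Qed.

Lemma cexpE f : cexp mu f = (\int[mu]_z complex.Re (f z)) +i* (\int[mu]_z complex.Im (f z)).
Proof. by rewrite /cexp unlock. Qed.

Lemma second_moment_centered a : cmeasurable a -> sq_integrable a ->
  \int[mu]_z abs2 (a z - cexp mu a) = \int[mu]_z abs2 (a z) - abs2 (cexp mu a).
Proof.
move=> ma ai; have [i1 i2] := sq_integrable_Re_Im ma ai.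
rewrite cexpE; set g1 := \int[mu]_z complex.Re (a z); set g2 := \int[mu]_z complex.Im (a z).
pose F0 z := abs2 (a z); pose F1 z := - (2 * g1) * complex.Re (a z).
pose F2 z := - (2 * g2) * complex.Im (a z); pose F3 (z : T) := g1 ^+ 2 + g2 ^+ 2.
have E z : abs2 (a z - (g1 +i* g2)) = \sum_(i <- [:: F0; F1; F2; F3]) i z.
  rewrite !big_cons big_nil /F0 /F1 /F2 /F3.
  by case: (a z) => x y; rewrite /abs2 /=; ring.
under eq_Rintegral do rewrite E.
have iF3 : mu.-integrable setT (EFin \o F3).
  exact: (@integrable_bounded _ _ _ _ (cst (g1 ^+ 2 + g2 ^+ 2)) `|g1 ^+ 2 + g2 ^+ 2|).
have iF1 : mu.-integrable setT (EFin \o F1) by exact: integrableZR.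
have iF2 : mu.-integrable setT (EFin \o F2) by exact: integrableZR.
have -> : \int[mu]_z (\sum_(i <- [:: F0; F1; F2; F3]) i z) =
   (\int[mu]_z F0 z) + (\int[mu]_z F1 z) + (\int[mu]_z F2 z) + (\int[mu]_z F3 z).
  pose G (i : 'I_4) := nth F0 [:: F0; F1; F2; F3] i.
  have GI i : mu.-integrable setT (EFin \o G i).
    by case: i => -[|[|[|[|]]]].
  transitivity (\int[mu]_z (\sum_(i <- index_enum 'I_4) G i z)).
    apply: eq_Rintegral => z _; rewrite !big_cons big_nil.
    by rewrite !big_ord_recl big_ord0 /G /=.
  rewrite Rintegral_sum//= !big_ord_recl big_ord0 /G/= addr0 !addrA//.
rewrite /F1 /F2 !RintegralZl// -/g1 -/g2 Rintegral_cst1 /abs2 /=.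
ring.
Qed.

Section constellation_mean.
Variables (A0 : finType) (q : A0 -> R) (sym : A0 -> R[i]) (p : R).
Hypotheses (q1 : \sum_x q x = 1)
  (qN : forall f : R[i] -> R, \sum_x q x * f (- sym x) = \sum_x q x * f (sym x))
  (qp : \sum_x q x * abs2 (sym x) = p).

Lemma constellation_second_moment (b u : R[i]) :
  \sum_x q x * abs2 (b * sym x + u) = p * abs2 b + abs2 u.
Proof.
have H := qN (fun s => abs2 (b * s + u)).
have : \sum_x q x * abs2 (b * - sym x + u) + \sum_x q x * abs2 (b * sym x + u) =
    2 * (p * abs2 b + abs2 u).
  have -> : p * abs2 b + abs2 u = \sum_x (q x * abs2 (sym x) * abs2 b + q x * abs2 u).
    by rewrite big_split -!mulr_suml qp q1 mul1r.
  rewrite mulr_sumr -big_split; apply: eq_bigr => x _ /=.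
  by clear H; case: b u (sym x) => [b1 b2] [u1 u2] [x1 x2]; rewrite /abs2 /=; ring.
by rewrite H; lra.
Qed.

(** The cross term between [a] and [w] disappears at each point, through the sum over the symmetric
    constellation, so [a] and [w] may be correlated. *)
Lemma Rintegral_constellation a w : cmeasurable a -> cmeasurable w ->
  sq_integrable a -> sq_integrable w ->
  \sum_x q x * \int[mu]_z abs2 (a z * sym x + w z) =
  p * \int[mu]_z abs2 (a z) + \int[mu]_z abs2 (w z).
Proof.
move=> ma mw ai wi.
have iF x : mu.-integrable setT (EFin \o (fun z => abs2 (a z * sym x + w z))).
  apply: (@sq_integrableD (fun z => a z * sym x)) => //.
    by apply: cmeasurableM => //; exact: cmeasurable_cst.
  by have := sq_integrableM (sym x) ai; under eq_fun do rewrite mulrC.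
transitivity (\int[mu]_z (p * abs2 (a z) + abs2 (w z))).
  under [RHS]eq_Rintegral do rewrite -constellation_second_moment.
  rewrite Rintegral_sum; last by move=> x; exact: integrableZR.
  by apply: eq_bigr => x _; rewrite RintegralZl.
by rewrite RintegralD// ?RintegralZl//; exact: integrableZR.
Qed.

End constellation_mean.

Section metric.
Variables (A0 : finType) (q : A0 -> R) (sym : A0 -> R[i]) (p v D : R).
Hypotheses (q0 : forall x, 0 <= q x) (q1 : \sum_x q x = 1)
  (qN : forall f : R[i] -> R, \sum_x q x * f (- sym x) = \sum_x q x * f (sym x))
  (qp : \sum_x q x * abs2 (sym x) = p) (v0 : 0 < v) (p0 : 0 <= p).
Variables (a w : T -> R[i]).
Hypotheses (ma : cmeasurable a) (mw : cmeasurable w)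
  (ai : sq_integrable a) (wi : sq_integrable w)
  (wD : \int[mu]_z abs2 (w z) <= D).

(* Up to an additive constant, the log-likelihood ratio of CN(g x, 1/theta)
   against CN(0, 1/theta + v p |g|^2), where [v] accounts for the constellation
   being only approximately Gaussian. *)
Definition slot_metric (theta : R) (g : R[i]) (x : A0) (y : R[i]) : R :=
  theta / (1 + v * (theta * abs2 g * p)) * abs2 y - theta * abs2 (y - g * sym x).

Let g := cexp mu a.
Let N0 := p * (\int[mu]_z abs2 (a z)) - p * abs2 g + D.

Lemma sq_integrable_slot (b : T -> R[i]) (c : R[i]) : cmeasurable b -> sq_integrable b ->
  sq_integrable (fun z => b z * c + w z).
Proof.
move=> mb bi; apply: (@sq_integrableD (fun z => b z * c)) => //.
  by apply: cmeasurableM => //; exact: cmeasurable_cst.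
by have := sq_integrableM c bi; under eq_fun do rewrite mulrC.
Qed.

Let ac z := a z - g.

Let mac : cmeasurable ac.
Proof. by apply: cmeasurableD => //; exact: cmeasurable_cst. Qed.

Let aci : sq_integrable ac.
Proof.
by apply: sq_integrableD => //; [exact: cmeasurable_cst|exact: sq_integrable_cst].
Qed.

Let slot_metricE theta x z : slot_metric theta g x (a z * sym x + w z) =
  theta / (1 + v * (theta * abs2 g * p)) * abs2 (a z * sym x + w z) +
  - theta * abs2 (ac z * sym x + w z).
Proof.
rewrite /slot_metric mulNr; congr (_ - _ * abs2 _).
by rewrite /ac mulrBl addrAC.
Qed.

Lemma slot_metric_integrable theta x :
  mu.-integrable setT (EFin \o (fun z => slot_metric theta g x (a z * sym x + w z))).
Proof.
under eq_fun do rewrite /= slot_metricE.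
by apply: integrableDR; apply: integrableZR; exact: sq_integrable_slot.
Qed.

Lemma slot_metric_denom_ge0 : 0 <= N0.
Proof.
rewrite /N0 -mulrBr -second_moment_centered// addr_ge0 ?mulr_ge0//.
  by apply: Rintegral_ge0 => z _; exact: abs2_ge0.
by apply: le_trans wD; apply: Rintegral_ge0 => z _; exact: abs2_ge0.
Qed.

(** The power of [w] enters with coefficient theta / (1 + v s) - theta <= 0, so replacing it by the
    upper bound [D] lowers the mean. After that theta N0 = 1 and theta (p E|a|^2 + D) = 1 + s. *)
Lemma slot_metric_mean (theta := N0^-1) (s := theta * abs2 g * p) :
  (1 + s) / (1 + v * s) - 1 <=
  \sum_x q x * \int[mu]_z slot_metric theta g x (a z * sym x + w z).
Proof.
have N00 := slot_metric_denom_ge0.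
have th0 : 0 <= theta by rewrite invr_ge0.
have s0 : 0 <= s by rewrite !mulr_ge0 ?abs2_ge0.
have c1 : 1 <= 1 + v * s by rewrite lerDl mulr_ge0// ltW.
have c0 : 0 < 1 + v * s by rewrite (lt_le_trans _ c1).
pose theta' := theta / (1 + v * s).
have th'0 : 0 <= theta' by rewrite divr_ge0// ltW.
have th'th : theta' <= theta by rewrite ler_pdivrMr// ler_peMr.
have -> : \sum_x q x * \int[mu]_z slot_metric theta g x (a z * sym x + w z) =
    theta' * (p * \int[mu]_z abs2 (a z) + \int[mu]_z abs2 (w z)) -
    theta * (p * \int[mu]_z abs2 (ac z) + \int[mu]_z abs2 (w z)).
  rewrite -(Rintegral_constellation q1 qN qp ma mw ai wi).
  rewrite -(Rintegral_constellation q1 qN qp mac mw aci wi).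
  rewrite !mulr_sumr -sumrB; apply: eq_bigr => x _.
  under eq_Rintegral do rewrite slot_metricE.
  rewrite RintegralD//; last 2 first.
  - by apply: integrableZR; exact: sq_integrable_slot.
  - by apply: integrableZR; exact: sq_integrable_slot.
  rewrite !RintegralZl//; last 2 first.
  - exact: sq_integrable_slot.
  - exact: sq_integrable_slot.
  by rewrite -/s -/theta'; ring.
rewrite second_moment_centered// -/g.
set A := \int[mu]_z abs2 (a z); set W := \int[mu]_z abs2 (w z).
have wW : (theta - theta') * W <= (theta - theta') * D by rewrite ler_wpM2l// subr_ge0.
suff : (1 + s) / (1 + v * s) - 1 <= theta' * (p * A + D) - theta * N0.
  by rewrite /N0 -/A; move: wW; lra.
(* When N0 = 0 its inverse is 0 by convention; then theta = s = 0 and both sides vanish. *)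
have [N0z|N0nz] := eqVneq N0 0.
  have thz : theta = 0 by rewrite /theta N0z invr0.
  have sz : s = 0 by rewrite /s thz !mul0r.
  by rewrite /theta' thz sz !(mul0r, mulr0, addr0) divr1 subrr.
have E : theta * (p * A + D) = 1 + s.
  by rewrite -(mulVf N0nz) -/theta /s /N0 -/A; ring.
have -> : theta' * (p * A + D) = (1 + s) / (1 + v * s) by rewrite /theta' mulrAC E.
by rewrite /theta mulVf.
Qed.

End metric.

End slot_mean.

(** The inequality ln r <= r - 1 at r = (1 + s) / (1 + v s). *)
Lemma slot_rate_le {R : realType} (s v : R) : 0 <= s -> 0 < v ->
  ln (1 + s) <= (1 + s) / (1 + v * s) - 1 + ln (1 + v * s).
Proof.
move=> s0 v0; have s1 : 0 < 1 + s by lra.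
have c0 : 0 < 1 + v * s by rewrite ltr_pwDl// mulr_ge0// ltW.
set r := (1 + s) / (1 + v * s).
have r0 : 0 < r by rewrite divr_gt0.
have := le_ln1Dx (x := r - 1); rewrite addrCA subrr addr0 ltrBrDl addrN => /(_ r0).
by rewrite /r ln_div ?posrE//; lra.
Qed.

(** * The SINR in terms of the law of a block *)

Section moment_transfer.
Context {R : realType} {d d1 : measure_display}.
Context {Omega : measurableType d} {T1 : measurableType d1}.
Variables (P : probability Omega R) (Z : Omega -> T1) (mZ : measurable_fun setT Z).
Variable mu : probability T1 R.
Hypothesis PZ : forall A, measurable A -> P (Z @^-1` A) = mu A.

Lemma exp_abs2E (F : Omega -> R[i]) : exp_abs2 P F = (\int[P]_w (abs2 (F w))%:E)%E.
Proof. by rewrite /exp_abs2 unlock. Qed.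

Lemma exp_abs2_ge0 (F : Omega -> R[i]) : (0 <= exp_abs2 P F)%E.
Proof. by rewrite exp_abs2E integral_ge0// => w _; rewrite lee_fin abs2_ge0. Qed.

Lemma exp_abs2_law (F : Omega -> R[i]) (f : T1 -> R[i]) : cmeasurable f ->
  (forall w, F w = f (Z w)) -> exp_abs2 P F = (\int[mu]_z (abs2 (f z))%:E)%E.
Proof.
move=> mf Ff; rewrite exp_abs2E -(ge0_integral_law mZ PZ).
- by apply: eq_integral => w _; rewrite Ff.
- by apply/measurable_EFinP; exact: measurable_abs2.
- by move=> z; rewrite lee_fin abs2_ge0.
Qed.

Lemma sq_integrable_law (F : Omega -> R[i]) (f : T1 -> R[i]) : cmeasurable f ->
  (forall w, F w = f (Z w)) -> (exp_abs2 P F < +oo)%E -> sq_integrable mu f.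
Proof. by move=> mf Ff; rewrite (exp_abs2_law mf Ff); exact: sq_integrableP. Qed.

Lemma cexp_law (F : Omega -> R[i]) (f : T1 -> R[i]) : cmeasurable f ->
  (forall w, F w = f (Z w)) -> sq_integrable mu f -> cexp P F = cexp mu f.
Proof.
move=> mf Ff fi; have [i1 i2] := sq_integrable_Re_Im mf fi.
rewrite !cexpE /Rintegral -(integral_law mZ PZ i1) -(integral_law mZ PZ i2).
by congr (fine _ +i* fine _); apply: eq_integral => w _; rewrite Ff.
Qed.

Lemma sq_integrableE (f : T1 -> R[i]) : sq_integrable mu f ->
  (\int[mu]_z (abs2 (f z))%:E)%E = (\int[mu]_z abs2 (f z))%:E.
Proof. by move=> fi; rewrite /Rintegral fineK//; exact: integrable_fin_num fi. Qed.

(** The conjugates are there because conj (v_n) is the coefficient of the noise of antenna n in the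
    filter output. *)
Lemma exp_norm2_law N (F : Omega -> 'cV[R[i]]_N) (f : T1 -> 'cV[R[i]]_N) :
  (forall n, cmeasurable (fun z => f z n 0)) -> (forall w, F w = f (Z w)) ->
  ('E_P[fun w => norm2 (F w)] = \sum_(n < N) \int[mu]_z (abs2 (conjc (f z n 0)))%:E)%E.
Proof.
move=> mf Ff; rewrite unlock.
have m2 n : measurable_fun setT (fun z => (abs2 (f z n 0))%:E).
  by apply/measurable_EFinP; exact: measurable_abs2.
pose G z := (\sum_(n < N) (abs2 (f z n 0))%:E)%E.
transitivity (\int[P]_w G (Z w))%E.
  by apply: eq_integral => w _; rewrite Ff /norm2 /G sumEFin.
rewrite (ge0_integral_law mZ PZ (F := G)); last 2 first.
- by apply: emeasurable_sum => n; exact: m2.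
- by move=> z; apply: sume_ge0 => n _; rewrite lee_fin abs2_ge0.
rewrite /G.
rewrite ge0_integral_sum//; last first.
  by move=> n z _; rewrite lee_fin abs2_ge0.
apply: eq_bigr => n _; apply: eq_integral => z _; congr EFin.
by case: (f z n 0) => x y; rewrite /abs2 /= sqrrN.
Qed.

End moment_transfer.

Section interference_bound.
Context {R : realType} {L K N B T : nat}.
Local Notation RR := (measurableTypeR R * measurableTypeR R)%type.
Local Notation ZZ := (cspace (R := R) (@block_idx L K N B T)).
Local Notation free_idx := (@free_idx L K N B T).
Variables (pr : uplink_params R L K) (v : nat -> 'M[R[i]]_(N, B) -> 'cV[R[i]]_N).
Hypothesis mv : filter_meas (T := T) v.
Hypothesis BT : (B <= T)%N.
Variables (mu : probability ZZ R) (nu : free_idx -> probability ZZ R).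
Hypothesis fv0 : forall s : free_idx, 0 <= free_var pr s.
Hypothesis indep : forall s (A : set RR) (C : set ZZ), measurable A -> measurable C ->
  mu ((fun z : ZZ => crd z (free_crd s)) @^-1` A `&` kill s @^-1` C) =
  (cgauss_prob (free_var pr s) A * nu s C)%E.
Variables (j : 'I_L) (k : 'I_K) (i : 'I_(T - B)).

Lemma interference_second_moment :
  (\int[mu]_z (abs2 (interference pr v BT j k i z))%:E <=
   \int[mu]_z (abs2 (filtered_distortion (block_rvs pr) v j (B + i).+1 z))%:E +
   \sum_(a | a != inl (j, k)) (free_var pr (slot_src (N := N) BT i a))%:E *
     \int[mu]_z (abs2 (slot_coef pr v j i a z))%:E)%E.
Proof.
rewrite -[leRHS]/(_ + \sum_(a <- index_enum _ | _) _)%E -big_filter.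
rewrite (eq_integral (fun z => (abs2 (filtered_distortion (block_rvs pr) v j (B + i).+1 z +
    \sum_(a <- [seq a <- index_enum _ | a != inl (j, k)]) slot_coef pr v j i a z *
      cplx (crd z (free_crd (slot_src BT i a)))))%:E)).
  apply: (free_sum_second_moment fv0 indep).
  - by apply: filter_uniq; exact: index_enum_uniq.
  - exact: slot_src_inj.
  - by apply: cmeasurable_filtered_distortion => //; exact: slot_lt.
  - by move=> a; exact: cmeasurable_slot_coef.
  - by move=> a z; apply: filtered_distortion_kill => //; exact: late_slot_src.
  - by move=> a a' z; apply: slot_coef_kill => //; exact: late_slot_src.
by move=> z _; rewrite /interference big_filter.
Qed.

End interference_bound.

Section slot_SINR.
Context {R : realType} {L K N B T : nat}.
Context {d : measure_display} {Omega : measurableType d}.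
Variables (P : probability Omega R).
Variables (pr : uplink_params R L K) (X : uplink_rvs R L K N Omega).
Variable v : nat -> 'M[R[i]]_(N, B) -> 'cV[R[i]]_N.
Hypothesis ok : uplink_params_ok (B := B) (T := T) pr.
Hypothesis mod : uplink_model (B := B) (T := T) P pr X.
Hypothesis fp : full_power (T := T) P pr X.
Hypothesis mv : filter_meas (T := T) v.
Variables (j : 'I_L) (k : 'I_K).
Hypothesis fm : finite_moments (T := T) P X v j.
Hypothesis T_gt0 : (0 < T)%N.

Local Notation mu := (block_law ok mod T_gt0 j).
Local Notation C := (block_rvs (N := N) (B := B) (T := T) pr).
Local Notation Zb := (block_vec (B := B) (T := T) X j).

Lemma pmax_ge0 l m : 0 <= pmax pr l m.
Proof.
have T1 : (1 <= 1 <= T)%N by rewrite leqnn.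
by rewrite -lee_fin -(fp 0 l m T1) exp_abs2_ge0.
Qed.

Lemma free_var_ge0 (s : @free_idx L K N B T) : 0 <= free_var pr s.
Proof.
case: s => [[[l m] i]|n] /=; first exact: pmax_ge0.
by rewrite mulr_ge0// ?(ltW (sigma2_gt0 ok))// (le_trans ler01)// (xi_ge1 ok).
Qed.

Variable i : 'I_(T - B).
Let t := (B + i).+1.

Let BT := pilot_len_le ok.

(** Puts the SINR in the form required by the coding argument: gain of mean g, and a bound [D] on
    the power of the remaining output. *)
Lemma slot_SINR : exists D,
  [/\ sq_integrable mu (filtered_channel C v j j k t),
      sq_integrable mu (interference pr v BT j k i),
      \int[mu]_z abs2 (interference pr v BT j k i z) <= D &
      let g := cexp mu (filtered_channel C v j j k t) in
      SINR P pr X v j k t =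
      (pmax pr j k * (\int[mu]_z abs2 (filtered_channel C v j j k t z))
       - pmax pr j k * abs2 g + D)^-1 * abs2 g * pmax pr j k].
Proof.
have tT : (B < t <= T)%N := slot_lt BT i.
have t1T : (1 <= t <= T)%N by move: tT; lia.
have [fc fd fn] := fm tT.
have mZ := block_vec_meas ok mod T_gt0 j 0.
have PZ A : measurable A -> P (Zb 0 @^-1` A) = mu A by [].
have mc l m := cmeasurable_filtered_channel pr mv j l m tT.
have md := cmeasurable_filtered_distortion pr mv j tT.
have Ec l m w : filtered_channel X v j l m t w = filtered_channel C v j l m t (Zb 0 w).
  exact: (filtered_channel_canon mod).
have Ed w : filtered_distortion X v j t w = filtered_distortion C v j t (Zb 0 w).
  exact: (filtered_distortion_canon mod).
have mf n := cmeasurable_filter_rv pr mv j n tT.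
have Ef w : filter_rv X v j 0 t w = filter_rv C v j 0 t (Zb 0 w).
  exact: (filter_rv_canon mod).
pose e (a : 'I_L * 'I_K + 'I_N) := \int[mu]_z abs2 (slot_coef pr v j i a z).
have ic l m : sq_integrable mu (filtered_channel C v j l m t).
  exact: (sq_integrable_law mZ PZ (mc l m) (Ec l m) (fc l m)).
have id : sq_integrable mu (filtered_distortion C v j t).
  exact: (sq_integrable_law mZ PZ md Ed fd).
have ms a : cmeasurable (slot_coef pr v j i a) by exact: cmeasurable_slot_coef.
have En := exp_norm2_law mZ PZ mf Ef.
have is_ a : sq_integrable mu (slot_coef pr v j i a).
  case: a (ms a) => [[l m] _|n msn]; first exact: ic.
  (* Each filter entry inherits a finite second moment from the squared norm of the filter. *)
  apply: sq_integrableP => //; apply: le_lt_trans fn; rewrite En (bigD1 n)//=.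
  rewrite leeDl// sume_ge0// => n' _; apply: integral_ge0 => z _.
  by rewrite lee_fin abs2_ge0.
pose dd := \int[mu]_z abs2 (filtered_distortion C v j t z).
exists (dd + \sum_(a | a != inl (j, k)) free_var pr (slot_src (N := N) BT i a) * e a).
have mi := cmeasurable_interference pr mv BT j k i.
have := interference_second_moment mv BT free_var_ge0 (free_kill_indep ok mod fp T_gt0 j) j k i.
rewrite (sq_integrableE id); under eq_bigr do rewrite (sq_integrableE (is_ _)) -EFinM.
rewrite sumEFin -EFinD -/dd => le_int.
have ii : sq_integrable mu (interference pr v BT j k i).
  by apply: sq_integrableP => //; apply: (le_lt_trans le_int); rewrite ltry.
split => //; first by rewrite -lee_fin -sq_integrableE.
rewrite /SINR (cexp_law mZ PZ (mc j k) (Ec j k) (ic j k)).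
set g := cexp mu _; rewrite [LHS]mulrC -[RHS]mulrA (mulrC (abs2 g)); congr (_^-1 * _).
rewrite (exp_abs2_law mZ PZ md Ed) (sq_integrableE id) En.
under eq_bigr do under eq_bigr do rewrite (exp_abs2_law mZ PZ (mc _ _) (Ec _ _)) (sq_integrableE (ic _ _)).
have -> : (\sum_(n < N) \int[mu]_z (abs2 (conjc (filter_rv C v j 0 t z n 0)))%:E)%E =
    (\sum_(n < N) e (inr n))%:E.
  by rewrite -sumEFin; apply: eq_bigr => n _; exact: (sq_integrableE (is_ (inr n))).
rewrite /= mulr_sumr.
have S := @split_own_term R L K N j k
  (fun l m => pmax pr l m * \int[mu]_z abs2 (filtered_channel C v j l m t z))
  (fun n => sigma2 pr * xi pr * e (inr n))
  (fun a => free_var pr (slot_src (N := N) BT i a) * e a) dd _ erefl (fun _ _ _ => erefl) (fun _ => erefl).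
have ac (s g' x y r u : R) : s + x + y = r + u -> s - g' + x + y = r - g' + u.
  by move=> h; rewrite [s - g']addrC -!addrA [in LHS](addrA s) h addrCA.
by apply: ac; exact: S.
Qed.

End slot_SINR.

(** * Codes *)

Section decoders.
Context {R : realType}.

(** exp x >= (1 + x / 2)^2 already grows quadratically, and [a] is the point from which (n r)^2 >= 4
    (|k| + |c|) n. *)
Lemma expR_ge_affine (r k c : R) : 0 < r ->
  exists n0, forall n, (n0 <= n)%N -> k * n%:R + c <= expR (n%:R * r).
Proof.
move=> r0; pose a := 4 * (`|k| + `|c|) / r ^+ 2.
have r20 : 0 < r ^+ 2 by rewrite exprn_gt0.
have a0 : 0 <= a by rewrite divr_ge0 ?(ltW r20)// mulr_ge0// addr_ge0.
exists (Num.truncn a).+1 => n an.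
have n1 : 1 <= n%:R :> R by rewrite ler1n (leq_trans _ an).
have n0 : 0 <= n%:R :> R by rewrite ler0n.
have na : a <= n%:R.
  by rewrite ltW// (lt_le_trans (truncnS_gt _))// ler_nat.
have nr0 : 0 <= n%:R * r by rewrite mulr_ge0// ltW.
have E : (n%:R * r) ^+ 2 <= 4 * expR (n%:R * r).
  have -> : expR (n%:R * r) = expR (n%:R * r / 2) ^+ 2.
    by rewrite -expRM_natl; congr expR; lra.
  have h := expR_ge1Dx (n%:R * r / 2).
  have h0 : 0 <= n%:R * r / 2 by lra.
  have : (n%:R * r / 2) ^+ 2 <= expR (n%:R * r / 2) ^+ 2 by rewrite ler_sqr ?nnegrE ?expR_ge0//; lra.
  by rewrite expr_div_n; lra.
have kn : k * n%:R <= `|k| * n%:R by rewrite ler_wpM2r// ler_norm.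
have cn : c <= `|c| * n%:R by rewrite (le_trans (ler_norm _))// ler_peMr.
have : (`|k| + `|c|) * n%:R * 4 <= (n%:R * r) ^+ 2.
  rewrite exprMn; move: na; rewrite /a ler_pdivrMr// => na.
  by rewrite [leLHS](_ : _ = n%:R * (4 * (`|k| + `|c|))) ?[n%:R ^+ 2 * _]mulrC; last ring; rewrite expr2 mulrCA mulrC; nra.
lra.
Qed.

(* [mx_events] is a bare class of sets: measurability of decoders is proved on
   the isomorphic measurable space [cspace]. *)
Lemma mx_events_mkc m n (A : set (cspace (R := R) ('I_m * 'I_n)%type)) :
  measurable A ->
  mx_events ((fun y : 'M[R[i]]_(m, n) => mkc (fun i => reim (y i.1 i.2))) @^-1` A).
Proof.
set f := fun y : 'M[R[i]]_(m, n) => _.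
have S := smallest_sigma_algebra setT [set U | exists a b (A : set (measurableTypeR R * measurableTypeR R)),
         measurable A /\ U = [set Z : 'M[R[i]]_(m, n) | A (reim (Z a b))]].
have [s0 sC sU] := S.
rewrite measurable_cspaceE => H.
suff : <<s cylinders (I := 'I_m * 'I_n)%type >> `<=` [set A | mx_events (f @^-1` A)] by apply.
apply: smallest_sub.
  split => /=.
  - by rewrite preimage_set0.
  - by move=> B mB; rewrite setTD preimage_setC -setTD; exact: sC.
  - by move=> F mF; rewrite preimage_bigcup; exact: sU.
move=> _ [B mB ->] /=; rewrite cylE preimage_bigcap.
apply: generated_bigcap => i; apply: sub_gen_smallest.
exists i.1, i.2, (B i); split => //.
by apply/seteqP; split => y /=; rewrite crd_mkc.
Qed.

(** A decision based on finitely many tests is constant on the cells of a finite measurable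
    partition. *)
Lemma measurable_pick d (T : measurableType d) (I J : finType) (pass : T -> I -> bool)
    (dec : {ffun I -> bool} -> J) (i : J) :
  (forall a, measurable [set z | pass z a]) ->
  measurable [set z | dec [ffun a => pass z a] = i].
Proof.
move=> mp.
have -> : [set z | dec [ffun a => pass z a] = i] =
    \bigcup_(f in [set f | dec f = i]) \bigcap_(a in [set: I]) [set z | pass z a = f a].
  apply/seteqP; split => z /=.
    by move=> zi; exists [ffun a => pass z a] => // a _ /=; rewrite ffunE.
  by move=> [f fi zf]; rewrite -fi; congr dec; apply/ffunP => a; rewrite ffunE; exact: zf.
apply: fin_bigcup_measurable; first exact: finite_finset.
move=> f _; apply: fin_bigcap_measurable; first exact: finite_finset.
move=> a _; case: (f a); first exact: mp.
rewrite (_ : mkset _ = ~` [set z | pass z a]); first exact: measurableC.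
by apply/seteqP; split => z /=; case: (pass z a).
Qed.

Lemma exists_threshold_decoder (n S M M2 : nat) (W : Type) (c : 'I_M -> 'I_n -> W)
    (met : W -> ('I_S -> R[i]) -> R) (t : R) : (0 < M)%N ->
  (forall x d (T : measurableType d) (y : T -> 'I_S -> R[i]),
     (forall s, cmeasurable (fun z => y z s)) -> measurable_fun setT (fun z => met x (y z))) ->
  exists dec : 'M[R[i]]_(n, S) -> 'I_(M + M2),
    (forall i, mx_events (dec @^-1` [set i])) /\
    forall (y : 'M[R[i]]_(n, S)) i, t <= \sum_b met (c i b) (fun s => y b s) ->
      (forall i', i' != i -> \sum_b met (c i' b) (fun s => y b s) < t) ->
      dec y = lshift M2 i.
Proof.
move=> M0 mmet.
pose pass (z : cspace (R := R) ('I_n * 'I_S)%type) (i : 'I_M) :=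
  t <= \sum_b met (c i b) (fun s => cplx (crd z (b, s))).
(* If several codewords pass, any of them is taken; if none does, message 0 is returned. The [M2]
   padding messages are never decoded. *)
pose decF (f : {ffun 'I_M -> bool}) : 'I_(M + M2) :=
  if [pick i | f i] is Some i then lshift M2 i else lshift M2 (Ordinal M0).
pose cr (y : 'M[R[i]]_(n, S)) : cspace (R := R) ('I_n * 'I_S)%type :=
  mkc (fun i => reim (y i.1 i.2)).
have passE y i : pass (cr y) i = (t <= \sum_b met (c i b) (fun s => y b s)).
  rewrite /pass; congr (_ <= _); apply: eq_bigr => b _; congr (met _ _).
  by apply/funext => s; rewrite crd_mkc cplx_reim.
exists (fun y => decF [ffun i => pass (cr y) i]); split => [i|y i ti ti'].
  apply: (@mx_events_mkc n S [set z | decF [ffun a => pass z a] = i]).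
  apply: measurable_pick => i'.
  have mm : measurable_fun setT (fun z => \sum_b met (c i' b) (fun s => cplx (crd z (b, s)))).
    apply: measurable_sum => b; apply: mmet => s; apply: cmeasurable_cplx.
    exact: measurable_crd.
  have := measurable_fun_ler (measurable_cst t) mm measurableT (Y := [set true]).
  rewrite setTI => /(_ Logic.I).
  rewrite (_ : _ @^-1` _ = [set z | pass z i'])//.
rewrite /decF; case: pickP => [i'|/(_ i)]; rewrite ffunE passE ?ti//.
by have [->|/ti'] := eqVneq i' i; rewrite // ltNge => /negbTE->.
Qed.

Lemma exists_padding (n S M M2 : nat) (sy : 'I_M -> 'I_n -> 'I_S -> R[i]) (p : R) :
  (0 < M2)%N -> (forall b s, \sum_i abs2 (sy i b s) <= (M + M2)%:R * p) ->
  exists cw : 'I_(M + M2) -> 'M[R[i]]_(n, S),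
    (forall i b s, cw (lshift M2 i) b s = sy i b s) /\
    forall b s, (\sum_i abs2 (cw i b s)) / (M + M2)%:R = p.
Proof.
move=> M20 sp; pose r b s := ((M + M2)%:R * p - \sum_i abs2 (sy i b s)) / M2%:R.
have M2r : 0 < M2%:R :> R by rewrite ltr0n.
have MM : 0 < (M + M2)%:R :> R by rewrite ltr0n addn_gt0 M20 orbT.
have r0 b s : 0 <= r b s by rewrite divr_ge0 ?subr_ge0 ?(ltW M2r).
exists (fun i : 'I_(M + M2) => \matrix_(b, s) match fintype.split i with
  | inl i' => sy i' b s | inr _ => Num.sqrt (r b s) +i* 0 end).
split=> [i b s|b s].
  by rewrite mxE -[lshift _ _]/(unsplit (inl i)) unsplitK.
rewrite big_split_ord/=.
under eq_bigr do rewrite mxE -[lshift _ _]/(unsplit (inl _)) unsplitK.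
under [X in _ + X]eq_bigr do rewrite mxE -[rshift _ _]/(unsplit (inr _)) unsplitK
  /abs2 /= sqr_sqrtr// expr0n addr0.
rewrite sumr_const card_ord -[_ *+ M2]mulr_natl.
have -> : M2%:R * r b s = (M + M2)%:R * p - \sum_i abs2 (sy i b s).
  by rewrite /r mulrC divfK ?gt_eqF.
by rewrite addrC subrK mulrC mulKf ?gt_eqF.
Qed.

End decoders.

(** * Codes for a block channel with random gains *)

Section block_fading.
Context {R : realType} {d d' : measure_display}.
Context {Omega : measurableType d} {T : measurableType d'}.
Variables (P : probability Omega R) (mu : probability T R).
Variables (Z : nat -> Omega -> T).
Hypotheses (mZ : forall b, measurable_fun setT (Z b)).
Hypothesis PZ : forall b b' A B, b != b' -> measurable A -> measurable B ->
  P (Z b @^-1` A `&` Z b' @^-1` B) = (mu A * mu B)%E.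
Variables (S : nat) (a u : 'I_S -> T -> R[i]) (D : 'I_S -> R) (p : R).
Hypotheses (ma : forall s, cmeasurable (a s)) (meas_u : forall s, cmeasurable (u s))
  (ai : forall s, sq_integrable mu (a s)) (ui : forall s, sq_integrable mu (u s))
  (uD : forall s, \int[mu]_z abs2 (u s z) <= D s) (p0 : 0 < p).

Let g s := cexp mu (a s).
Let theta s := (p * (\int[mu]_z abs2 (a s z)) - p * abs2 (g s) + D s)^-1.
Let snr s := theta s * abs2 (g s) * p.

Lemma theta_ge0 s : 0 <= theta s.
Proof. by rewrite invr_ge0; exact: (slot_metric_denom_ge0 (ltW p0) (ma s) (ai s) (uD s)). Qed.

Lemma snr_ge0 s : 0 <= snr s.
Proof. by rewrite !mulr_ge0 ?theta_ge0 ?abs2_ge0 ?(ltW p0). Qed.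

Section block_metric.
Variables (A0 : finType) (q : A0 -> R) (sym : A0 -> R[i]) (v e : R).
Hypotheses (q0 : forall x, 0 <= q x) (q1 : \sum_x q x = 1)
  (qN : forall f : R[i] -> R, \sum_x q x * f (- sym x) = \sum_x q x * f (sym x))
  (qp : \sum_x q x * abs2 (sym x) = p) (v0 : 0 < v).
Hypothesis qexp : forall s y,
  \sum_x q x * expR (slot_metric sym p v (theta s) (g s) x y) <= expR e / (1 + v * snr s).

Definition block_output (x : {ffun 'I_S -> A0}) (z : T) (s : 'I_S) : R[i] :=
  a s z * sym (x s) + u s z.

Definition block_metric (x : {ffun 'I_S -> A0}) (y : 'I_S -> R[i]) : R :=
  \sum_s slot_metric sym p v (theta s) (g s) (x s) (y s).

Lemma measurable_block_metric x d1 (T1 : measurableType d1) (y : T1 -> 'I_S -> R[i]) :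
  (forall s, cmeasurable (fun z => y z s)) -> measurable_fun setT (fun z => block_metric x (y z)).
Proof.
move=> my; apply: measurable_sum => s; rewrite /slot_metric.
apply: measurable_funB; apply: measurable_funM => //; apply: measurable_abs2 => //.
by apply: cmeasurableD => //; exact: cmeasurable_cst.
Qed.

Lemma cmeasurable_block_output x s : cmeasurable (fun z => block_output x z s).
Proof. by apply: cmeasurableD => //; apply: cmeasurableM => //; exact: cmeasurable_cst. Qed.

Lemma integrable_slot_metric s i :
  mu.-integrable setT (EFin \o (fun z => slot_metric sym p v (theta s) (g s) i (a s z * sym i + u s z))).
Proof. exact: slot_metric_integrable. Qed.

Lemma integrable_block_metric x :
  mu.-integrable setT (EFin \o (fun z => block_metric x (block_output x z))).
Proof.
apply: (@integrable_sumR _ _ _ mu _ _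
  (fun s z => slot_metric sym p v (theta s) (g s) (x s) (a s z * sym (x s) + u s z))) => s.
exact: integrable_slot_metric.
Qed.

(** For a fixed output [y] the average over independent symbols factors into the slot bounds,
    whatever the joint law of the slots. *)
Lemma block_metric_exp y :
  \sum_x iid_weight q x * expR (block_metric x y) <= expR (- \sum_s (ln (1 + v * snr s) - e)).
Proof.
rewrite /block_metric; under eq_bigr do rewrite expR_sum.
rewrite (iid_sum_prod q (fun s x => expR (slot_metric sym p v (theta s) (g s) x (y s)))).
rewrite -sumrN expR_sum; apply: ler_prod => s _; apply/andP; split.
  by apply: sumr_ge0 => x _; rewrite mulr_ge0 ?expR_ge0.
apply: (le_trans (qexp s (y s))).
have c0 : 0 < 1 + v * snr s by rewrite ltr_pwDl// mulr_ge0 ?snr_ge0// ltW.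
by rewrite opprB expRD expRN lnK ?posrE.
Qed.

Lemma block_metric_mean :
  \sum_s ((1 + snr s) / (1 + v * snr s) - 1) <=
  \sum_x iid_weight q x * \int[mu]_z block_metric x (block_output x z).
Proof.
have -> : \sum_x iid_weight q x * \int[mu]_z block_metric x (block_output x z) =
    \sum_s \sum_i q i * \int[mu]_z slot_metric sym p v (theta s) (g s) i (a s z * sym i + u s z).
  under [RHS]eq_bigr => s _ do rewrite -(iid_sum1 q1 s
    (fun i => \int[mu]_z slot_metric sym p v (theta s) (g s) i (a s z * sym i + u s z))).
  rewrite exchange_big/=; apply: eq_bigr => x _; rewrite -mulr_sumr; congr (_ * _).
  rewrite -(Rintegral_sum _ (f := fun s z => slot_metric sym p v (theta s) (g s) (x s) (a s z * sym (x s) + u s z)))//.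
  by move=> s; exact: integrable_slot_metric.
by apply: ler_sum => s _; exact: (slot_metric_mean q1 qN qp v0 (ltW p0)).
Qed.

End block_metric.

Lemma exists_channel_code (margin eps : R) : 0 < margin -> 0 < eps ->
  margin < \sum_s ln (1 + snr s) ->
  exists n0, forall n, (n0 <= n)%N ->
  exists M (cw : 'I_M -> 'M[R[i]]_(n, S)) (dec : 'M[R[i]]_(n, S) -> 'I_M),
  [/\ (0 < M)%N, forall i, mx_events (dec @^-1` [set i]),
    n%:R * (\sum_s ln (1 + snr s) - margin) <= ln M%:R,
    forall b s, (\sum_i abs2 (cw i b s)) / M%:R = p &
    ((M%:R^-1)%:E * \sum_i P [set w |
       dec (\matrix_(b, s) (a s (Z b w) * cw i b s + u s (Z b w))%R) != i] <= eps%:E)%E].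
Proof.
move=> margin0 eps0; set G := \sum_s ln _ => Gm.
(* The constellation loses [e] per slot, at most margin / 4 per block; the successor keeps the
   denominator positive when S = 0. *)
pose e := margin / (4 * S.+1%:R).
have S0 : 0 < S.+1%:R :> R by rewrite ltr0n.
have e0 : 0 < e by rewrite divr_gt0// mulr_gt0.
have Se : S%:R * e <= margin / 4.
  have -> : margin / 4 = S.+1%:R * e.
    by rewrite /e; field; rewrite gt_eqF.
  by rewrite ler_wpM2r ?(ltW e0)// ler_nat.
have tm0 : 0 <= \sum_s snr s by apply: sumr_ge0 => s _; exact: snr_ge0.
have snr_tm s : snr s <= \sum_s snr s.
  by rewrite [leRHS](bigD1 s)//= lerDl sumr_ge0// => s' _; exact: snr_ge0.
(* The sum of all SNRs dominates each of them, so one constellation serves all slots. *)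
have [A0 [q [sym [v [v0 [q0 q1] qN qp qexp0]]]]] := exists_constellation (ltW p0) e0 tm0.
have qexp s y : \sum_x q x * expR (slot_metric sym p v (theta s) (g s) x y) <=
    expR e / (1 + v * snr s).
  exact: (qexp0 (theta s) (g s) y (theta_ge0 s) (snr_tm s)).
pose rho := \sum_s (ln (1 + v * snr s) - e).
pose m := \sum_x iid_weight q x * \int[mu]_z block_metric sym v x (block_output sym x z).
have mrho : G - margin / 4 <= m + rho.
  have h : G <= \sum_s ((1 + snr s) / (1 + v * snr s) - 1) + \sum_s ln (1 + v * snr s).
    by rewrite -big_split; apply: ler_sum => s _; apply: slot_rate_le => //; exact: snr_ge0.
  have := block_metric_mean q1 qN qp v0; rewrite -/m => hm.
  have -> : rho = \sum_s ln (1 + v * snr s) - S%:R * e.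
    by rewrite /rho sumrB sumr_const card_ord mulr_natl.
  lra.
pose dl := margin / 8; have dl0 : 0 < dl by rewrite divr_gt0.
pose eta := eps / 4; have eta0 : 0 < eta by rewrite divr_gt0.
have up (s : 'I_S) : \sum_x iid_weight q x * abs2 (sym (x s)) = p.
  by rewrite (iid_sum1 q1 s (fun x => abs2 (sym x))).
have mmet (x x' : {ffun 'I_S -> A0}) :
    measurable_fun setT (fun z => block_metric sym v x' (block_output sym x z)).
  by apply: measurable_block_metric => s; exact: cmeasurable_block_output.
have [n1 [kk H]] := exists_codebook mZ PZ (iid_weight_ge0 q0) (iid_sum 'I_S q1) mmet
  (integrable_block_metric sym v) (block_metric_exp q0 v0 qexp) p0 dl0 eta0 eta0 up.
pose r := m + rho - 2 * dl.
have rG : G - margin / 2 <= r by rewrite /r /dl; lra.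
have r0 : 0 < r by apply: lt_le_trans rG; lra.
have [n2 H2] := expR_ge_affine kk 1 r0.
have [n3 H3] := expR_ge_affine 0 (1 + eta^-1) r0.
exists (maxn n1 (maxn n2 n3)) => n; rewrite !geq_max => /and3P[nn1 /H2{}H2 /H3{}H3].
(* Rounding down respects the random coding bound; [H2] and [H3] carry an extra 1 so that M >= kk n
   and M >= 1 / eta survive it. *)
pose M := Num.truncn (expR (n%:R * r)).
have MR : M%:R <= expR (n%:R * r) by rewrite truncn_le// expR_ge0.
have RM : expR (n%:R * r) < M%:R + 1 by rewrite natr1; exact: truncnS_gt.
have Meta : eta^-1 <= M%:R by lra.
have M0 : (0 < M)%N by rewrite -(ltr_nat R) (lt_le_trans _ Meta)// invr_gt0.
have M0R : 0 < M%:R :> R by rewrite ltr0n.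
have kM : kk * n%:R <= M%:R by lra.
have [C [Cerr Cpow]] := H n M nn1 kM M0 MR.
(* At least eta M extra messages make room for the power excess of the first M. Being at least 1,
   [M2] also makes up for the rounding of M. *)
pose M2 := (Num.truncn (eta * M%:R)).+1.
have M2l : eta * M%:R <= M2%:R by rewrite ltW//; exact: truncnS_gt.
have M2u : M2%:R <= eta * M%:R + 1.
  by rewrite /M2 -natr1 lerD2r truncn_le// mulr_ge0 ?ltW.
have [dec [mdec decP]] := @exists_threshold_decoder R n S M M2 _ (fun i b => C i b)
  (block_metric sym v) (n%:R * (m - dl)) M0 (measurable_block_metric sym v).
have pow (b : 'I_n) (s : 'I_S) : \sum_i abs2 (sym (C i b s)) <= (M + M2)%:R * p.
  apply: (le_trans (Cpow s b)); rewrite mulrA ler_wpM2r ?(ltW p0)// natrD.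
  by rewrite mulrDl mul1r lerD2l.
have [cw [cwE cwp]] := exists_padding (isT : (0 < M2)%N) pow.
exists (M + M2)%N, cw, dec; split=> //; first by rewrite addn_gt0 M0.
  apply: (@le_trans _ _ (n%:R * r)); first by rewrite ler_wpM2l//; lra.
  rewrite -[leLHS]expRK ler_ln ?posrE ?expR_gt0 ?ltr0n ?addn_gt0 ?M0//.
  rewrite (le_trans (ltW RM))// natrD lerD2l ler1n.
  by [].
pose out (i : 'I_(M + M2)) (w : Omega) : 'M[R[i]]_(n, S) :=
  \matrix_(b, s) (a s (Z b w) * cw i b s + u s (Z b w)).
pose Err i := [set w | dec (out i w) != i].
have mErr i : measurable (Err i).
  have -> : Err i = ~` (out i @^-1` (dec @^-1` [set i])).
    by apply/seteqP; split => w /= /eqP.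
  apply: measurableC; apply: mx_events_preimage (mdec i) => b s.
  under eq_fun do rewrite mxE.
  apply: cmeasurableD; last exact: (measurableT_comp (meas_u s) (mZ b)).
  apply: cmeasurableM; last exact: cmeasurable_cst.
  exact: (measurableT_comp (ma s) (mZ b)).
have errP i : P (Err i) = (fine (P (Err i)))%:E by rewrite fineK// fin_num_measure.
under eq_bigr do rewrite -/(out _ _) -/(Err _) errP.
rewrite sumEFin -EFinM lee_fin mulrC ler_pdivrMr ?ltr0n ?addn_gt0 ?M0//.
rewrite big_split_ord/=.
have e1 : \sum_(i < M) fine (P (Err (lshift M2 i))) <= eta * M%:R.
  apply: le_trans Cerr; apply: ler_sum => i _; apply: fine_le.
  - exact: fin_num_measure.
  - by apply: fin_num_measure; exact: measurable_confused.
  apply: le_measure; rewrite ?inE//; first exact: measurable_confused.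
  move=> w /= /eqP; apply: contra_notP => /not_orP[h1 h2].
  have outE b : (fun s => out (lshift M2 i) w b s) = block_output sym (C i b) (Z b w).
    by apply/funext => s; rewrite mxE cwE.
  apply: decP => [|i' i'i].
    by under eq_bigr do rewrite outE; rewrite leNgt; apply/negP.
  under eq_bigr do rewrite outE; rewrite ltNge; apply/negP => h.
  by apply: h2; exists i'.
have e2 : \sum_(i < M2) fine (P (Err (rshift M i))) <= M2%:R.
  rewrite -[M2 in leRHS]card_ord -sumr_const; apply: ler_sum => i _.
  by rewrite -lee_fin -errP; exact: probability_le1.
(* The codebook errs with weight at most eta M, the padding with at most M2 <= eta M + 1 <= 2 eta M;
   together they stay below eps M = 4 eta M. *)
have etaM : 1 <= eta * M%:R by rewrite -ler_pdivrMl// mulr1.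
have epsE : eps * M%:R = 4 * (eta * M%:R) by rewrite /eta; field.
have h : eta * M%:R + M2%:R <= eps * M%:R by lra.
apply: (le_trans (lerD e1 e2)); apply: (le_trans h).
by rewrite ler_pM2l// ler_nat leq_addr.
Qed.

End block_fading.

(** * Achievability *)

Section achievability.
Context {R : realType} {L K N B T : nat}.
Context {d : measure_display} {Omega : measurableType d}.
Variables (P : probability Omega R).
Variables (pr : uplink_params R L K) (X : uplink_rvs R L K N Omega).
Variable v : nat -> 'M[R[i]]_(N, B) -> 'cV[R[i]]_N.
Hypothesis ok : uplink_params_ok (B := B) (T := T) pr.
Hypothesis mod : uplink_model (B := B) (T := T) P pr X.
Hypothesis fp : full_power (T := T) P pr X.
Hypothesis mv : filter_meas (T := T) v.
Variables (j : 'I_L) (k : 'I_K).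
Hypothesis fm : finite_moments (T := T) P X v j.

Let G := \sum_(i < T - B) ln (1 + SINR P pr X v j k (B + i).+1).

Lemma rateE : rate (T := T) P pr X v j k = G / (T%:R * ln 2).
Proof.
rewrite /rate -[B.+1]add0n big_addn big_mkord subSS invfM mulrCA; congr (_ * _).
rewrite mulr_suml; apply: eq_bigr => i _.
by rewrite addnS [(i + B)%N]addnC.
Qed.

(** The trivial code of rate 0, for the cases in which the margin swallows the whole rate. *)
Lemma one_message_code (n : nat) :
  exists c : @block_code R B T n 1,
    code_power c (pmax pr j k) /\ error_prob P X v j k c = 0%E.
Proof.
pose cw (_ : 'I_1) : 'M[R[i]]_(n, T - B) := const_mx (Num.sqrt (pmax pr j k) +i* 0).
pose dec (_ : 'M[R[i]]_(n, T - B)) : 'I_1 := ord0.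
have mdec i : mx_events (dec @^-1` [set i]).
  rewrite (_ : _ @^-1` _ = setT); last by apply/seteqP; split => y //= _; rewrite (ord1 i).
  have [s0 sC _] := smallest_sigma_algebra setT [set U | exists a b (A : set (measurableTypeR R * measurableTypeR R)),
    measurable A /\ U = [set Z : 'M[R[i]]_(n, T - B) | A (reim (Z a b))]].
  by rewrite -[setT]setD0; exact: sC.
exists (BlockCode cw mdec); split.
  move=> b s; rewrite big_ord1 divr1 mxE /abs2 /= expr0n addr0 sqr_sqrtr//.
  have T0 : (0 < T)%N by have := ltn_ord s; lia.
  exact: pmax_ge0 fp T0 j k.
rewrite /error_prob big_ord1 [X in P X](_ : _ = set0) ?measure0 ?mule0//.
by apply/seteqP; split => w //=; rewrite (ord1 (decoder _ _)) eqxx.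
Qed.

Lemma exists_code (margin eps : R) : 0 < margin -> 0 < eps -> margin < G ->
  exists n0, forall n, (n0 <= n)%N ->
  exists M (c : @block_code R B T n M),
    [/\ (0 < M)%N, n%:R * (G - margin) <= ln M%:R,
        code_power c (pmax pr j k) & (error_prob P X v j k c <= eps%:E)%E].
Proof.
move=> m0 e0 mG.
have T0 : (0 < T)%N.
  case: (posnP T) => // Tz; move: mG; rewrite /G big1 ?ltNge ?(ltW m0)//.
  by move=> [i iT]; exfalso; move: iT; rewrite Tz; lia.
pose BT : (B <= T)%N := pilot_len_le ok.
have [D HD] := choice (slot_SINR ok mod fp mv k fm T0).
(* With zero power every SINR is 0, so G = 0, against margin < G. *)
have p0 : 0 < pmax pr j k.
  rewrite lt_neqAle (pmax_ge0 fp T0 j k) andbT; apply: contraTneq mG => p0.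
  rewrite -leNgt /G big1 ?(ltW m0)// => i _; have [_ _ _ /= ->] := HD i.
  by rewrite -p0 mulr0 addr0 ln1.
pose mu := block_law ok mod T0 j.
pose a (i : 'I_(T - B)) := filtered_channel (block_rvs (N := N) (B := B) (T := T) pr) v j j k (B + i).+1.
pose u (i : 'I_(T - B)) := interference pr v BT j k i.
have snrE : G = \sum_(i < T - B) ln (1 +
    (pmax pr j k * (\int[mu]_z abs2 (a i z)) - pmax pr j k * abs2 (cexp mu (a i)) + D i)^-1 *
    abs2 (cexp mu (a i)) * pmax pr j k).
  by apply: eq_bigr => i _; have [_ _ _ /= ->] := HD i.
have ma i : cmeasurable (a i).
  by apply: cmeasurable_filtered_channel => //; exact: slot_lt.
have meas_u i : cmeasurable (u i) by exact: cmeasurable_interference.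
have ai i : sq_integrable mu (a i) by have [] := HD i.
have ui i : sq_integrable mu (u i) by have [] := HD i.
have uD i : \int[mu]_z abs2 (u i z) <= D i by have [] := HD i.
rewrite snrE in mG *.
have [n0 H] := exists_channel_code (fun b => block_vec_meas ok mod T0 j b)
  (fun b b' A A' => @block_vec_indep R L K N B T d Omega P pr X ok mod fp T0 j b b' A A')
  ma meas_u ai ui uD p0 m0 e0 mG.
exists n0 => n /H[M [cw [dec [M0 mdec MG pow err]]]].
exists M, (BlockCode cw mdec); split => //.
apply: le_trans err; rewrite /error_prob; apply: lee_wpmul2l; first by rewrite lee_fin invr_ge0.
rewrite le_eqVlt; apply/orP; left; apply/eqP; apply: eq_bigr => i _; congr (P _).
have outE w : filter_output X v j k (BlockCode cw mdec) i w =
    \matrix_(b, s) (a s (block_vec X j b w) * cw i b s + u s (block_vec X j b w)).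
  apply/matrixP => b s; rewrite [LHS]mxE [RHS]mxE.
  have sT : (1 <= B + s.+1 <= T)%N by have := ltn_ord s; lia.
  transitivity (slot_output (T := T) pr j v k (cw i b s) (B + s.+1) (block_vec X j b w)).
    exact: (slot_output_canon mod).
  by rewrite addnS (slot_outputE pr v BT j k s).
by apply/seteqP; split => w /=; rewrite outE.
Qed.

End achievability.

Theorem lemma1 (R : realType) (L K N B T : nat)
    (d : measure_display) (Omega : measurableType d) (P : probability Omega R)
    (pr : uplink_params R L K) (X : uplink_rvs R L K N Omega)
    (j : 'I_L) (k : 'I_K) (v : nat -> 'M[R[i]]_(N, B) -> 'cV[R[i]]_N) :
  uplink_params_ok (B := B) (T := T) pr ->
  uplink_model (B := B) (T := T) P pr X ->
  full_power (T := T) P pr X ->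
  filter_meas (T := T) v ->
  finite_moments (T := T) P X v j ->
  ergodic_achievable_rate (T := T) P pr X v j k (rate (T := T) P pr X v j k).
Proof.
move=> ok mod fp mv fm margin eps m0 e0; rewrite rateE.
set G := \sum_(i < T - B) _.
have ln2 : 0 < ln 2 :> R by rewrite ln_gt0// ltr1n.
(* For T = 0 the inverse of T is 0 by convention, so the rate is 0. *)
have [T0|T_gt0] := posnP T.
  exists 0%N => n _; have [c [cp ce]] := one_message_code v fp j k n.
  exists 1%N, c; split => //; last by rewrite ce lee_fin ltW.
  by rewrite /log2 ln1 T0 muln0 !mul0r invr0 mulr0 sub0r oppr_le0 ltW.
have TR : 0 < T%:R :> R by rewrite ltr0n.
(* The margin in nats per block instead of bits per channel use. *)
pose margin' := margin * (T%:R * ln 2).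
have Tln : 0 < T%:R * ln 2 :> R by rewrite mulr_gt0.
have m'0 : 0 < margin' by rewrite mulr_gt0.
have [Gm|mG] := leP G margin'.
  exists 0%N => n _; have [c [cp ce]] := one_message_code v fp j k n.
  exists 1%N, c; split => //; last by rewrite ce lee_fin ltW.
  by rewrite /log2 ln1 !mul0r subr_le0 ler_pdivrMr.
have [n0 H] := exists_code ok mod fp mv fm m'0 e0 mG.
exists n0.+1 => n n0n; have [M [c [M0 MG cp ce]]] := H n (ltnW n0n).
exists M, c; split => //.
have nR : 0 < n%:R :> R by rewrite ltr0n (leq_trans _ n0n).
have nT : 0 < (n * T)%N%:R * ln 2 :> R by rewrite mulr_gt0// natrM mulr_gt0.
rewrite /log2 -mulrA -invfM [ln 2 * _]mulrC ler_pdivlMr//.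
apply: le_trans MG; rewrite -/G le_eqVlt; apply/orP; left; apply/eqP.
by rewrite natrM /margin'; field; rewrite !gt_eqF.
Qed.
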